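(* For all $a,b\in K$ with $a^3=b^3=-1$ and all $i,j\in\{2,3,4\}$ with $i<j$, the pair $(\varphi_{ij}(a,b),\psi_{ij}(a,b))$ is a matrix factorization of $f_4$. Moreover, the families of graded MCM $R_4$-modules $$\mathcal{M}=\{\operatorname{Coker}\varphi_{ij}(a,b)\mid a,b\in K,\ a^3=b^3=-1,\ i,j\in\{2,3,4\},\ i<j\},$$ $$\mathcal{N}=\{\operatorname{Coker}\psi_{ij}(a,b)\mid a,b\in K,\ a^3=b^3=-1,\ i,j\in\{2,3,4\},\ i<j\}$$ have the following properties: (i) Every two generated, non-free, graded MCM $R_4$-module is isomorphic to one of the modules of $\mathcal{M}\cup\mathcal{N}$. (ii) Any two different modules of $\mathcal{M}\cup\mathcal{N}$ (i.e. members of the two families given by different matrices $\varphi_{ij}(a,b)$, $\psi_{ij}(a,b)$) are not isomorphic. (iii) The modules of $\mathcal{M}$ are (up to isomorphism) the first syzygies, and also the duals, of the modules of $\mathcal{N}$. (iv) All modules of $\mathcal{M}\cup\mathcal{N}$ have rank one.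
   Context: $K$ is an algebraically closed field of characteristic $0$, $S=K[Y_1,Y_2,Y_3,Y_4]$ with the standard grading, $f_4=Y_1^3+Y_2^3+Y_3^3+Y_4^3$, $R_4=S/(f_4)$. MCM means (finitely generated) maximal Cohen-Macaulay. ''Two generated'' means that the minimal number of generators is $2$. Isomorphisms are isomorphisms of $R_4$-modules (degree shifts of the grading are disregarded). The dual of $M$ is $\operatorname{Hom}_{R_4}(M,R_4)$; the first syzygy of $M$ is the kernel of a minimal surjection from a graded free $R_4$-module onto $M$. A matrix factorization of $f_4$ is a pair $(\varphi,\psi)$ of $n\times n$ matrices over $S$ with $\varphi\psi=\psi\varphi=f_4 I_n$; $\operatorname{Coker}\varphi$ denotes the cokernel of $\varphi: S^n\to S^n$, which is annihilated by $f_4$ and hence an $R_4$-module. For $a,b\in K$ with $a^3=b^3=-1$ and $i<j$ in $\{2,3,4\}$, let $s$ be the remaining element, $\{i,j,s\}=\{2,3,4\}$, and put $$\varphi_{ij}(a,b)=\begin{pmatrix} Y_1-aY_s & -(Y_i^2+bY_iY_j+b^2Y_j^2)\\ Y_i-bY_j & Y_1^2+aY_1Y_s+a^2Y_s^2\end{pmatrix},$$ $$\psi_{ij}(a,b)=\begin{pmatrix} Y_1^2+aY_1Y_s+a^2Y_s^2 & Y_i^2+bY_iY_j+b^2Y_j^2\\ -(Y_i-bY_j) & Y_1-aY_s\end{pmatrix}.$$ *)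

(* Defs.v *)
From HB Require Import structures.
From mathcomp Require Import all_boot all_algebra.
From mathcomp Require Import mpoly.
From mathcomp Require Import boolp classical_sets functions.

Set Implicit Arguments.
Unset Strict Implicit.
Unset Printing Implicit Defensive.

Import GRing.Theory.
Local Open Scope ring_scope.
Local Open Scope quotient_scope.

Section Modules.
Variable R : comNzRingType.
Implicit Types M N Z : lmodType R.

Definition iso M N : Prop := exists f : {linear M -> N}, bijective f.

Definition generated_by M (n : nat) : Prop :=
  exists g : 'I_n -> M, forall x, exists c : 'I_n -> R, x = \sum_i c i *: g i.

Definition min_gens M (n : nat) : Prop :=
  generated_by M n /\ forall k, generated_by M k -> (n <= k)%N.

Definition fin_free M : Prop := exists n : nat, iso M 'rV[R]_n.

(* [xM xs k] is the submodule (x_0, .., x_(k-1)) M. *)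
Definition xM M (xs : seq R) (k : nat) (y : M) : Prop :=
  exists u : 'I_k -> M, y = \sum_(i < k) xs`_i *: u i.

Definition regular_seq M (xs : seq R) : Prop :=
  (forall (k : nat) (y : M), (k < size xs)%N ->
     xM xs k (xs`_k *: y) -> xM xs k y)
  /\ exists y : M, ~ xM xs (size xs) y.

(* Length of the longest [M]-regular sequence in [I]. *)
Definition depth (I : R -> Prop) M (d : nat) : Prop :=
  (exists xs, [/\ forall x, x \in xs -> I x, regular_seq M xs & size xs = d])
  /\ forall xs, (forall x, x \in xs -> I x) -> regular_seq M xs ->
       (size xs <= d)%N.

(* [idealr_closed] includes properness. *)
Definition prime_ideal (P : {pred R}) : Prop :=
  idealr_closed P /\ prime_idealr_closed P.

Definition prime_chain (n : nat) (P : nat -> {pred R}) : Prop :=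
  (forall i, (i <= n)%N -> prime_ideal (P i))
  /\ forall i, (i < n)%N ->
       {subset P i <= P i.+1} /\ exists2 x, x \in P i.+1 & x \notin P i.

Definition krull_dim (n : nat) : Prop :=
  (exists P, prime_chain n P) /\ forall m P, prime_chain m P -> (m <= n)%N.

(* Maximal Cohen-Macaulay with respect to the ideal [I], which is to be the
   irrelevant maximal ideal of a graded ring. *)
Definition MCM (I : R -> Prop) M : Prop :=
  (exists n, generated_by M n) /\ exists d, krull_dim d /\ depth I M d.

Definition total_quotient (Q : comUnitRingType) (h : {rmorphism R -> Q}) :=
  [/\ injective h,
      forall s, GRing.lreg s -> h s \is a GRing.unit
    & forall q, exists a s, GRing.lreg s /\ q = h a / h s].

(* [M] has rank [r] when its localization at the non-zero-divisors of [R],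
   i.e. [M] tensored with the total quotient ring [Q] of [R], is free of rank
   [r] over [Q]; [j] below exhibits [Q^r] as that localization. *)
Definition has_rank M (r : nat) : Prop :=
  exists (Q : comUnitRingType) (h : {rmorphism R -> Q}),
    total_quotient h /\
    exists j : {linear M -> 'rV[Q]_r | h \; *:%R},
      (forall v, exists s x, GRing.lreg s /\ h s *: v = j x) /\
      (forall x, j x = 0 <-> exists s, GRing.lreg s /\ s *: x = 0).

(* [deg d] is the homogeneous component of degree [d] of [R], and [G d] that
   of [M]. *)
Definition grading (deg : int -> R -> Prop) M (G : int -> M -> Prop) : Prop :=
  [/\ forall d, G d 0,
      forall d x y, G d x -> G d y -> G d (x - y),
      forall e d r x, deg e r -> G d x -> G (e + d) (r *: x),
      forall x, exists (s : seq int) (c : int -> M),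
        (forall d, G d (c d)) /\ x = \sum_(d <- s) c d
    & forall (s : seq int) (c : int -> M), uniq s -> (forall d, G d (c d)) ->
        \sum_(d <- s) c d = 0 -> forall d, d \in s -> c d = 0].

(* [Z] is the kernel of a minimal homogeneous surjection [p] (of degree 0) onto
   the graded module [(M, G)] from the graded free module with basis elements
   in degrees [d j]; [k] is the inclusion.  Minimality: the kernel of [p] is
   contained in [I] times the free module, [I] the irrelevant ideal. *)
Definition first_syzygy (deg : int -> R -> Prop) (I : R -> Prop)
    M (G : int -> M -> Prop) Z : Prop :=
  exists (n : nat) (d : 'I_n -> int)
         (p : {linear 'rV[R]_n -> M}) (k : {linear Z -> 'rV[R]_n}),
    [/\ forall (e : int) (v : 'rV[R]_n),
          (forall j, deg (e - d j) (v 0 j)) -> G e (p v),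
        forall x, exists v, p v = x,
        forall v : 'rV[R]_n, p v = 0 -> forall j, I (v 0 j),
        injective k
      & forall v, p v = 0 <-> exists z, v = k z].

Section Dual.
Variable M : lmodType R.

Definition is_linear_form : {pred (M -> R^o)} :=
  [pred f : M -> R^o | `[< linear f >]].

Fact is_linear_form_submod : submod_closed is_linear_form.
Proof.
split=> [|a f g]; rewrite !inE.
  by move=> a x y; rewrite scaler0 addr0.
move=> lf lg b x y.
rewrite !fctE /= lf lg !scalerDr !scalerA mulrC.
by rewrite -!addrA; congr (_ + _); rewrite addrCA.
Qed.

HB.instance Definition _ :=
  GRing.isSubmodClosed.Build R (M -> R^o) is_linear_form is_linear_form_submod.

(* Hom_R(M, R), with pointwise operations. *)
Record dual := Dual { dual_val : M -> R^o; _ : dual_val \in is_linear_form }.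

HB.instance Definition _ := [isSub for dual_val].
HB.instance Definition _ := [Choice of dual by <:].
HB.instance Definition _ := [SubChoice_isSubLmodule of dual by <:].

End Dual.

End Modules.

Section Cokernel.
Variables (S : comNzRingType) (I : idealr S) (n : nat).
Implicit Types A : 'M[S]_n.

(* Im A + I S^n.  If Coker A is annihilated by I (as when A belongs to a matrix
   factorization of f and I = (f)) this is Im A; the summand I S^n makes the
   quotient an S/I-module for every A. *)
Definition coker_rel A : {pred 'cV[S]_n} :=
  [pred v | `[< exists (u w : 'cV[S]_n),
                  (forall i, w i 0 \in (I : pred S)) /\ v = A *m u + w >]].

Fact coker_rel_zmod A : zmod_closed (coker_rel A).
Proof.
split; first by apply/asboolP; exists 0, 0; split=> [i|];
  rewrite ?mxE ?rpred0 // mulmx0 addr0.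
move=> _ _ /asboolP[u [w [wI ->]]] /asboolP[u' [w' [w'I ->]]]; apply/asboolP.
exists (u - u'), (w - w'); split=> [i|]; first by rewrite !mxE rpredB.
by rewrite mulmxBr opprD addrACA.
Qed.

HB.instance Definition _ A :=
  GRing.isZmodClosed.Build _ (coker_rel A) (coker_rel_zmod A).

Lemma coker_rel_mf A B (f : S) :
    (forall p, (p \in (I : pred S)) <-> exists q, p = q * f) ->
    A *m B = f%:M ->
  forall v, v \in coker_rel A <-> exists u, v = A *m u.
Proof.
move=> If AB v; split; last first.
  move=> [u ->]; apply/asboolP; exists u, 0; rewrite addr0; split=> // i.
  by rewrite mxE rpred0.
move=> /asboolP[u [w [wI ->]]].
have /choice[q wE] i : exists q, w i 0 = q * f by apply/If/wI.
exists (u + B *m \col_i q i); rewrite mulmxDr mulmxA AB mul_scalar_mx.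
by congr (_ + _); apply/colP=> i; rewrite !mxE wE mulrC.
Qed.

(* The cokernel of A : S^n -> S^n (acting on column vectors), as a module over
   S/I. *)
Definition coker A := Quotient.quot (coker_rel A).

HB.instance Definition _ A := GRing.Zmodule.on (coker A).
HB.instance Definition _ A :=
  EqQuotient.on (coker A).

Variable A : 'M[S]_n.

Let M := Quotient.quot (coker_rel A).

Definition coker_scale (r : {ideal_quot I}) (x : M) : M :=
  \pi_M (repr r *: repr x).

Fact coker_relZ a v : v \in coker_rel A -> a *: v \in coker_rel A.
Proof.
move=> /asboolP[u [w [wI ->]]]; apply/asboolP; exists (a *: u), (a *: w).
split=> [i|]; first by rewrite mxE idealMr.
by rewrite scalerDr scalemxAr.
Qed.

Fact coker_relI a v : a \in (I : pred S) -> a *: v \in coker_rel A.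
Proof.
move=> aI; apply/asboolP; exists 0, (a *: v); split=> [i|].
  by rewrite mxE mulrC idealMr.
by rewrite mulmx0 add0r.
Qed.

Lemma coker_scaleE a v :
  coker_scale (\pi_{ideal_quot I} a) (\pi_M v) = \pi_M (a *: v).
Proof.
apply/eqP; rewrite /coker_scale -Quotient.idealrBE.
set b := repr _; set w := repr _.
have ba : b - a \in (I : pred S) by rewrite Quotient.idealrBE reprK.
have wv : w - v \in coker_rel A by rewrite Quotient.idealrBE reprK.
have -> : b *: w - a *: v = (b - a) *: w + a *: (w - v).
  by rewrite scalerBl scalerBr addrA subrK.
by apply: rpredD; [apply: coker_relI | apply: coker_relZ].
Qed.

Fact coker_scaleA a b v :
  coker_scale a (coker_scale b v) = coker_scale (a * b) v.
Proof.
elim/quotW: a => a; elim/quotW: b => b; elim/quotW: v => v.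
by rewrite (coker_scaleE b v) (coker_scaleE a) -rmorphM coker_scaleE scalerA.
Qed.

Fact coker_scale1 : left_id 1 coker_scale.
Proof.
by move=> v; elim/quotW: v => v;
   rewrite -(rmorph1 \pi_{ideal_quot I}) coker_scaleE scale1r.
Qed.

Fact coker_scaleDr : right_distributive coker_scale +%R.
Proof.
move=> a u v; elim/quotW: a => a; elim/quotW: u => u; elim/quotW: v => v.
by rewrite -raddfD !coker_scaleE scalerDr raddfD.
Qed.

Fact coker_scaleDl v : {morph coker_scale^~ v : a b / a + b}.
Proof.
move=> a b; elim/quotW: a => a; elim/quotW: b => b; elim/quotW: v => v.
by rewrite -rmorphD !coker_scaleE scalerDl raddfD.
Qed.

HB.instance Definition _ :=
  GRing.Zmodule_isLmodule.Build {ideal_quot I} (coker A)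
    coker_scaleA coker_scale1 coker_scaleDr coker_scaleDl.

End Cokernel.

Section FermatCubic.
Variable K : closedFieldType.
Let S := {mpoly K[4]}.

(* The variable Y_k of the text is ['X_i] with [i : 'I_4] of value k - 1. *)
Definition f4 : S := \sum_(i < 4) 'X_i ^+ 3.

Definition f4_ideal : {pred S} := [pred p | `[< exists q, p = q * f4 >]].

Fact f4_ideal_closed : idealr_closed f4_ideal.
Proof.
split; first by apply/asboolP; exists 0; rewrite mul0r.
  apply/negP=> /asboolP[q /(congr1 (fun p : S => p.@[fun=> 0]))].
  rewrite mevalM meval1 /f4 raddf_sum big1 => [|i _].
    by rewrite mulr0 => /eqP; rewrite oner_eq0.
  by rewrite /= rmorphXn /= mevalXU expr0n.
move=> a _ _ /asboolP[q ->] /asboolP[q' ->]; apply/asboolP.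
by exists (a * q + q'); rewrite mulrDl mulrA.
Qed.

HB.instance Definition _ := isIdealr.Build S f4_ideal f4_ideal_closed.

Definition R4 := {ideal_quot f4_ideal}.

Definition R4_deg (d : int) (r : R4) : Prop :=
  exists p : S, r = \pi_R4 p /\
    match d with Posz n => p \is n.-homog | Negz _ => p = 0 end.

(* The irrelevant maximal ideal (Y_1, Y_2, Y_3, Y_4) of R_4. *)
Definition R4_irr (r : R4) : Prop :=
  exists p : S, r = \pi_R4 p /\ p@_0%MM = 0.

Definition mat2 (a b c d : S) : 'M[S]_2 :=
  \matrix_(i, j) if i == 0 then (if j == 0 then a else b)
                 else (if j == 0 then c else d).

Definition phi (i j s : 'I_4) (a b : K) : 'M[S]_2 :=
  mat2 ('X_0 - a *: 'X_s)
       (- ('X_i ^+ 2 + b *: ('X_i * 'X_j) + b ^+ 2 *: 'X_j ^+ 2))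
       ('X_i - b *: 'X_j)
       ('X_0 ^+ 2 + a *: ('X_0 * 'X_s) + a ^+ 2 *: 'X_s ^+ 2).

Definition psi (i j s : 'I_4) (a b : K) : 'M[S]_2 :=
  mat2 ('X_0 ^+ 2 + a *: ('X_0 * 'X_s) + a ^+ 2 *: 'X_s ^+ 2)
       ('X_i ^+ 2 + b *: ('X_i * 'X_j) + b ^+ 2 *: 'X_j ^+ 2)
       (- ('X_i - b *: 'X_j))
       ('X_0 - a *: 'X_s).

Definition matrix_factorization n (f : S) (A B : 'M[S]_n) : Prop :=
  A *m B = f%:M /\ B *m A = f%:M.

(* i < j and {i, j, s} = {2, 3, 4}, in the 1-based numbering. *)
Definition admissible (i j s : 'I_4) (a b : K) : Prop :=
  [/\ (i < j)%N, [set i; j; s]%SET = [set~ 0]%SET, a ^+ 3 = -1 & b ^+ 3 = -1].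

(* The families are given by their matrices. *)
Definition famM (A : 'M[S]_2) : Prop :=
  exists i j s a b, admissible i j s a b /\ A = phi i j s a b.

Definition famN (A : 'M[S]_2) : Prop :=
  exists i j s a b, admissible i j s a b /\ A = psi i j s a b.

Definition Coker n (A : 'M[S]_n) : lmodType R4 := coker f4_ideal A.

Definition gradable (M : lmodType R4) : Prop :=
  exists G : int -> M -> Prop, grading R4_deg G.

Definition graded_MCM (M : lmodType R4) : Prop :=
  gradable M /\ MCM R4_irr M.

(* [Z] is, up to isomorphism, the first syzygy of [M], for whichever grading
   of [M]. *)
Definition is_the_first_syzygy (M Z : lmodType R4) : Prop :=
  forall (G : int -> M -> Prop), grading R4_deg G ->
  forall Z' : lmodType R4, first_syzygy R4_deg R4_irr G Z' <-> iso Z' Z.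

End FermatCubic.

(* Main.v *)
Require Import Defs.
From HB Require Import structures.
From mathcomp Require Import all_boot all_order all_algebra.
From mathcomp Require Import mpoly boolp.
From mathcomp Require Import zify ring.

(** Let f be the cubic.  If a and b are cube roots of -1, then X_0^3 + X_s^3 is the
    product of L1 = X_0 - a X_s and a quadric Q2, and X_i^3 + X_j^3 is the
    product of L2 = X_i - b X_j and a quadric Q1.  So f = L1 Q2 + L2 Q1 is the
    common determinant of phi and psi, which are adjugate to each other
    ([phi_psi]).

    Let M be a graded maximal Cohen-Macaulay module with two generators.  Its
    syzygies over the polynomial ring S form a free module: this is the instance
    of the Auslander-Buchsbaum formula at depth 3.  Indeed the regular
    sequence on M makes its second Koszul homology vanish ([koszul_regular]),
    while Euler's formula makes the Koszul complex of S exact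
    ([koszul_exact]); together they rule out a homogeneous relation of least
    degree between minimal syzygies ([min_gens_free_homog]).  As f kills M, the
    relation matrix A is square and part of a factorization A B = B A = f
    ([free_syzygy]).  Since f is prime ([f4_prime]), det A divides f^2 in one
    of three ways, and it is f up to a unit unless M is free or has fewer
    generators ([two_gens_relations]).

    The entries of A are homogeneous of positive degree and the degrees along
    the diagonal add up to 3, so a row or a column of A consists of two linear
    forms ([classify_matrix]).  They are independent and f vanishes where they
    do, so they define one of the lines of the Fermat cubic surface.  On such a
    line two coordinates are multiples of the two others ([fermat_line],
    [span_contains_line]): up to row operations the forms are L1 and L2, and
    then the other column is determined modulo this one ([column_mx_equiv]).
    This identifies A with some phi or psi.

    Two minimal presentations of one module are related by matrices that are
    invertible modulo the irrelevant ideal, so the linear parts of the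
    matrices are invariants ([presents_compare]).  They tell phi from psi, and
    the space of linear forms that they span determines i, j, s, a and b
    ([fam_distinct]).

    Conversely the three last variables are a regular sequence on the cokernel
    of a reduced matrix factorization ([coker_regular]).  The dimension of R4
    is 3, and no regular sequence is longer, because both a regular sequence
    and a chain of primes yield algebraically independent elements
    ([regular_indep]), while any four elements of R4 are dependent
    ([algebraic_dependence]).  The factorization gives exactness of the
    periodic complex with differentials phi and psi, hence the first syzygies
    ([rowR4_ker]); transposing it gives the duals ([dual_presents]); and a row
    orthogonal to the first column of the matrix embeds the cokernel in R4 up
    to torsion, which gives the rank ([rank_mat2]). *)

Set Implicit Arguments.
Unset Strict Implicit.
Unset Printing Implicit Defensive.

Import Order.TTheory GRing.Theory Num.Theory.
Local Open Scope ring_scope.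

(** * Submodules and noetherian modules *)

Lemma ex_choice (X Y : Type) (P : X -> Y -> Prop) :
  (forall x, exists y, P x y) -> exists f, forall x, P x (f x).
Proof. by move=> /choice[f fP]; exists f. Qed.

Definition linear_of (R : nzRingType) (U V : lmodType R) (f : U -> V)
    (lf : linear f) : {linear U -> V} :=
  HB.pack f (GRing.isLinear.Build R U V _ f lf).

Section Noetherian.

Definition submod (R : nzRingType) (V : lmodType R) (I : V -> Prop) :=
  I 0 /\ forall a x y, I x -> I y -> I (a *: x + y).

(** Finite generation is expressed by induction over the submodules J that
    contain the generators; this avoids naming the span. *)
Definition noetherian (R : nzRingType) (V : lmodType R) :=
  forall I : V -> Prop, submod I ->
  exists s : seq V, (forall x, x \in s -> I x) /\
    forall J : V -> Prop, submod J -> (forall x, x \in s -> J x) ->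
      forall x, I x -> J x.

Section SubmodTheory.
Variables (R : nzRingType) (V : lmodType R) (I : V -> Prop).
Hypothesis sI : submod I.

Lemma submodD x y : I x -> I y -> I (x + y).
Proof. by move=> Ix Iy; rewrite -[x]scale1r; apply: sI.2. Qed.

Lemma submodZ a x : I x -> I (a *: x).
Proof. by move=> Ix; rewrite -[_ *: _]addr0; apply: sI.2 => //; exact: sI.1. Qed.

Lemma submodN x : I x -> I (- x).
Proof. by rewrite -scaleN1r; apply: submodZ. Qed.

Lemma submodB x y : I x -> I y -> I (x - y).
Proof. by move=> Ix Iy; apply/submodD/submodN. Qed.

Lemma submod_sum (J : Type) (r : seq J) (P : pred J) (F : J -> V) :
  (forall j, P j -> I (F j)) -> I (\sum_(j <- r | P j) F j).
Proof. by move=> IF; apply: big_ind => //; [exact: sI.1 | exact: submodD]. Qed.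
End SubmodTheory.

Lemma submodI (R : nzRingType) (V : lmodType R) (I J : V -> Prop) :
  submod I -> submod J -> submod (fun x => I x /\ J x).
Proof.
move=> sI sJ; split; first by split; [exact: sI.1 | exact: sJ.1].
by move=> a x y [? ?] [? ?]; split; [apply: sI.2 | apply: sJ.2].
Qed.

(** Generators of the image of I in W, lifted to I, together with the images
    of generators of the trace of I on U, generate I. *)
Lemma noetherian_ext (R : nzRingType) (U V W : lmodType R)
    (g : {linear U -> V}) (f : {linear V -> W}) :
    (forall v, f v = 0 -> exists u, v = g u) ->
  noetherian U -> noetherian W -> noetherian V.
Proof.
move=> exact_gf nU nW I sI.
have sfI : submod (fun w => exists2 v, I v & f v = w).
  split; first by exists 0; [exact: sI.1 | rewrite linear0].
  move=> a _ _ [v Iv <-] [v' Iv' <-].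
  by exists (a *: v + v'); [exact: sI.2 | rewrite linearP].
have sgI : submod (fun u => I (g u)).
  split; first by rewrite linear0; exact: sI.1.
  by move=> a u u' Iu Iu'; rewrite linearP; exact: sI.2.
have [sW [sWI genW]] := nW _ sfI.
have [sU [sUI genU]] := nU _ sgI.
have [lift liftP] : exists lift : W -> V,
    forall w, w \in sW -> I (lift w) /\ f (lift w) = w.
  apply: (ex_choice (P := fun w v => w \in sW -> I v /\ f v = w)) => w.
  by have [/sWI[v Iv fv]|] := pselect (w \in sW); [exists v | exists 0].
exists (map lift sW ++ map g sU); split.
  move=> x; rewrite mem_cat => /orP[/mapP[w /liftP[Iw _] ->]//|].
  by move=> /mapP[u /sUI Iu ->].
move=> J sJ Js x Ix.
have [|||v [Iv Jv] fv] := genW (fun w => exists2 v, I v /\ J v & f v = w) _ _ (f x).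
- split; first by exists 0; rewrite ?linear0 //; split; [exact: sI.1|exact: sJ.1].
  move=> a _ _ [v [Iv Jv] <-] [v' [Iv' Jv'] <-].
  by exists (a *: v + v'); [split; [exact: sI.2|exact: sJ.2] | rewrite linearP].
- move=> w ws; have [Iw fw] := liftP _ ws; exists (lift w) => //; split=> //.
  by apply: Js; rewrite mem_cat map_f.
- by exists x.
have [u xvE] : exists u, x - v = g u by apply: exact_gf; rewrite linearB fv subrr.
rewrite -(subrK v x); apply: submodD => //; rewrite xvE.
apply: (genU (fun u => J (g u))); last by rewrite -xvE; apply: submodB.
- split; first by rewrite linear0; exact: sJ.1.
  by move=> a y y' Jy Jy'; rewrite linearP; exact: sJ.2.
- by move=> y ys; apply: Js; rewrite mem_cat map_f ?orbT.
Qed.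

Lemma noetherian_surj (A B : nzRingType) (h : {rmorphism A -> B}) :
  (forall b, exists a, h a = b) -> noetherian A^o -> noetherian B^o.
Proof.
move=> surj nA I sI.
have pre (J : B^o -> Prop) : submod J -> submod (fun a : A^o => J (h a)).
  move=> sJ; split; first by rewrite rmorph0; exact: sJ.1.
  by move=> a x y Jx Jy; rewrite rmorphD rmorphM; exact: sJ.2.
have [s [sIs gen]] := nA _ (pre _ sI).
exists (map h s : seq B^o); split; first by move=> _ /mapP[x /sIs Ix ->].
move=> J sJ Js x; have [a <-] := surj x => Ia.
by apply: (gen _ (pre _ sJ)) Ia => y ys; apply: Js; apply: map_f.
Qed.

Lemma noetherian_field (K : fieldType) : noetherian K^o.
Proof.
move=> I sI; have [[x Ix x0]|I0] := pselect (exists2 x, I x & x != 0).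
  exists [:: x]; split; first by move=> y; rewrite inE => /eqP->.
  move=> J sJ Jx y _; rewrite -[y](divfK x0).
  by apply: (submodZ sJ); apply: Jx; rewrite inE.
exists [::]; split=> // J sJ _ x Ix.
have [->|x0] := eqVneq x 0; first exact: sJ.1.
by case: I0; exists x.
Qed.

(** The leading coefficients of the elements of I of degree at most d form
    an ideal lc I d, which grows with d and is constant from some N on.
    Polynomials in I realizing generators of lc I d for d up to N suffice:
    subtracting one of them lowers the degree. *)
Lemma hilbert_basis (R : comNzRingType) : noetherian R^o -> noetherian {poly R}^o.
Proof.
move=> nR I sI.
pose lc (I : {poly R}^o -> Prop) d (a : R^o) :=
  exists p : {poly R}, [/\ I p, (size p <= d.+1)%N & p`_d = a].
have slc J d : submod J -> submod (lc J d).
  move=> sJ; split; first by exists 0; rewrite size_poly0 coef0; split => //; exact: sJ.1.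
  move=> a _ _ [p [Jp sp <-]] [q [Jq sq <-]]; exists (a%:P * p + q); split.
  - exact: sJ.2.
  - by rewrite (leq_trans (size_polyD _ _)) // geq_max sq andbT mul_polyC
      (leq_trans (size_scale_leq _ _)).
  - by rewrite coefD coefCM.
have lcS J d a : submod J -> lc J d a -> lc J d.+1 a.
  move=> sJ [p [Jp sp pd]]; exists ('X * p); split; first exact: (submodZ sJ).
  - by rewrite -commr_polyX (leq_trans (size_polyMleq _ _)) // size_polyX addn2.
  - by rewrite coefXM.
have lcS' J d e a : submod J -> (d <= e)%N -> lc J d a -> lc J e a.
  move=> sJ /subnK <-; elim: (e - d)%N => // k IHk Ja.
  by apply: lcS => //; apply: IHk.
have sU : submod (fun a => exists d, lc I d a).
  split; first by exists 0%N; apply: (slc _ _ sI).1.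
  move=> a x y [d lx] [e ly]; exists (d + e)%N; apply: (slc _ _ sI).2.
    by apply: lcS' lx => //; exact: leq_addr.
  by apply: lcS' ly => //; exact: leq_addl.
have [s [sU' gens]] := nR _ sU.
have [N lcN] : exists N, forall a, a \in s -> lc I N a.
  elim: s sU' {gens} => [_|a s IHs sU']; first by exists 0%N.
  have [|N lcN] := IHs; first by move=> b bs; apply: sU'; rewrite inE bs orbT.
  have [|d ld] := sU' a; first by rewrite inE eqxx.
  exists (N + d)%N => b; rewrite inE => /orP[/eqP->|/lcN].
    by apply: lcS' ld => //; exact: leq_addl.
  by apply: lcS' => //; exact: leq_addr.
have gen d : exists t : seq {poly R}^o, (forall p, p \in t -> I p) /\
    forall J, submod J -> (forall p, p \in t -> J p) ->
      forall a, lc I d a -> lc (fun p => I p /\ J p) d a.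
  have [u [uI genu]] := nR _ (slc _ d sI).
  have [lift liftP] : exists lift : R -> {poly R}, forall a, a \in u ->
      [/\ I (lift a), (size (lift a) <= d.+1)%N & (lift a)`_d = a].
    apply: (ex_choice (P := fun (a : R) (p : {poly R}) => a \in u ->
      [/\ I p, (size p <= d.+1)%N & p`_d = a])) => a.
    by have [/uI[p ?]|] := pselect (a \in u); [exists p | exists 0].
  exists (map lift u); split; first by move=> _ /mapP[a /liftP[? _ _] ->].
  move=> J sJ Ju; apply: genu; first exact/slc/submodI.
  move=> a au; have [? ? ?] := liftP _ au; exists (lift a); split=> //; split=> //.
  by apply: Ju; apply: map_f.
have [t tP] := choice gen.
exists (flatten [seq t d | d <- iota 0 N.+1]); split.
  by move=> p /flatten_mapP[d _]; apply: (tP d).1.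
move=> J sJ Jt p Ip; have [n] := ubnP (size p); elim: n p Ip => // n IHn p Ip.
have [->|p0] := eqVneq p 0; first by rewrite ltnS => _; exact: sJ.1.
rewrite ltnS; set d := (size p).-1 => pn.
have sp : size p = d.+1 by rewrite prednK // size_poly_gt0.
have [q [[Iq Jq] sq qd]] : lc (fun p => I p /\ J p) d p`_d.
  have [dN|Nd] := leqP d N.
    apply: (tP d).2 => //; last by exists p; rewrite sp.
    move=> r rt; apply: Jt; apply/flatten_mapP; exists d => //.
    by rewrite mem_iota.
  apply: (lcS' _ N) => //; [exact: submodI | exact: ltnW |].
  apply: (tP N).2 => //.
    by move=> r rt; apply: Jt; apply/flatten_mapP; exists N => //; rewrite mem_iota ltnS leqnn.
  apply: gens; [exact: slc | exact: lcN |].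
  by exists d, p; rewrite sp.
rewrite -(subrK q p); apply: (submodD sJ) => //; apply: IHn; first exact: (submodB sI).
apply: leq_trans pn; rewrite sp ltnS; apply/leq_sizeP => j.
rewrite leq_eqVlt => /orP[/eqP<-|dj]; first by rewrite coefB qd subrr.
by rewrite coefB !nth_default ?subr0 // ?sp // (leq_trans sq).
Qed.

End Noetherian.

(** Hilbert's theorem, one variable at a time: {mpoly K[n.+1]} is the image
    of {poly {mpoly K[n]}} under evaluation at the last variable. *)
Lemma mpoly_noetherian (K : fieldType) n : noetherian ({mpoly K[n]})^o.
Proof.
elim: n => [|n IHn].
  apply: (@noetherian_surj K _ (@mpolyC 0 K)); last exact: noetherian_field.
  by move=> p; exists (p@_0%MM); rewrite /= mpolyKC.
have cX : commr_rmorph (@mwiden n K) 'X_ord_max by move=> x; exact: mulrC.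
apply: (@noetherian_surj {poly {mpoly K[n]}} _ (horner_morph cX)); last exact: hilbert_basis.
have [h [hX hU hC]] : exists h : {rmorphism {poly {mpoly K[n]}} -> {mpoly K[n.+1]}},
    [/\ h =1 horner_morph cX, h 'X = 'X_ord_max
      & forall p, h p%:P = mwiden p].
  exists (horner_morph cX); split=> //; first exact: horner_morphX.
  exact: horner_morphC.
suff surj : forall b, exists a, h a = b.
  by move=> b; have [a <-] := surj b; exists a; symmetry; apply: hX.
elim/mpolyind => [|c m p _ _ [q <-]]; first by exists 0; rewrite rmorph0.
suff [r <-] : exists r, h r = 'X_[m].
  exists ((c%:MP)%:P * r + q).
  by rewrite rmorphD rmorphM /= hC -mul_mpolyC; congr (_ * _ + _); exact: mwidenC.
rewrite mpolyXE_id; elim/big_rec: _ => [|i r _ [q' <-]].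
  by exists 1; rewrite rmorph1.
suff [y <-] : exists y, h y = 'X_i.
  by exists (y ^+ m i * q'); rewrite rmorphM rmorphXn.
have [[j ->]|->] : (exists j, i = widen_ord (leqnSn n) j) \/ i = ord_max.
- have := ltn_ord i; rewrite ltnS leq_eqVlt => /orP[/eqP|] ni.
    by right; apply/val_inj.
  by left; exists (Ordinal ni); apply/val_inj.
- by exists ('X_j)%:P; rewrite hC mwidenX mnmwiden1.
- by exists 'X; rewrite hU.
Qed.

Lemma noetherian_cV (R : nzRingType) n : noetherian R^o -> noetherian 'cV[R]_n.
Proof.
move=> nR; elim: n => [|n IHn].
  move=> I sI; exists [::]; split=> // J sJ _ x _.
  by rewrite (_ : x = 0); [exact: sJ.1 | apply/colP; case].
have lf : linear (fun v : 'cV[R]_n.+1 => v 0 0 : R^o).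
  by move=> a u v; rewrite !mxE.
have lg : linear (fun u : 'cV[R]_n =>
    \col_(i < n.+1) oapp (fun j => u j 0) 0 (unlift 0 i)).
  move=> a u v; apply/colP=> i; rewrite !mxE.
  by case: (unlift 0 i) => [j|] /=; rewrite ?mxE ?mulr0 ?addr0.
apply: (noetherian_ext (g := linear_of lg) (f := linear_of lf)) => // v v0.
exists (\col_i v (lift 0 i) 0); apply/colP => i; rewrite !mxE.
by case: unliftP => [j|] -> /=; rewrite ?mxE.
Qed.

(** * Algebraic dependence by counting, independence of regular sequences *)

Lemma linear_dependence (K : fieldType) (I J : finType) (a : I -> J -> K) :
  (#|J| < #|I|)%N ->
  exists c : I -> K, (exists i, c i != 0) /\ forall j, \sum_i c i * a i j = 0.
Proof.
move=> JI; pose A := \matrix_(i < #|I|, j < #|J|) a (enum_val i) (enum_val j).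
have kA : kermx A != 0.
  rewrite -mxrank_eq0 mxrank_ker subn_eq0 -ltnNge.
  exact: leq_ltn_trans (rank_leq_col _) JI.
have [i vi] : exists i, row i (kermx A) != 0.
  apply/existsP; rewrite -negb_forall; apply: contraNN kA => /forallP k0.
  by apply/eqP/row_matrixP => i; rewrite row0; apply/eqP.
set v := row i _ in vi; have vA : v *m A = 0 by apply/sub_kermxP/row_sub.
exists (fun x => v 0 (enum_rank x)); split.
  have [j vj] : exists j, v 0 j != 0.
    apply/existsP; rewrite -negb_forall; apply: contraNN vi => /forallP v0.
    by apply/eqP/rowP => j; rewrite [RHS]mxE; apply/eqP.
  by exists (enum_val j); rewrite enum_valK.
move=> j; have := congr1 (fun M : 'rV_#|J| => M 0 (enum_rank j)) vA.
rewrite mxE [RHS]mxE => vAj; rewrite -[RHS]vAj (reindex_onto (@enum_val I I) enum_rank) /=; last by move=> x _; rewrite enum_rankK.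
apply: eq_big => [x|x _]; first by rewrite enum_valK eqxx.
by rewrite !mxE enum_valK enum_rankK.
Qed.

Section Box.
Variables (R : nzRingType) (n : nat).
Implicit Types p q : {mpoly R[n]}.

(** Exponents are bounded variable by variable, so that the monomials in
    question are counted by a power rather than by a binomial coefficient. *)
Definition box_le (B : nat) p := forall m, m \in msupp p -> forall i, (m i <= B)%N.

Lemma box_leM A B p q : box_le A p -> box_le B q -> box_le (A + B) (p * q).
Proof.
move=> pA qB m /msuppM_le/allpairsP[[m1 m2] /= [m1p m2q ->]] i.
by rewrite mnmDE leq_add ?pA ?qB.
Qed.

Lemma box_leX A p k : box_le A p -> box_le (k * A) (p ^+ k).
Proof.
move=> pA; elim: k => [|k IHk]; last by rewrite exprS mulSn; apply: box_leM.
by move=> m; rewrite expr0 msupp1 inE => /eqP-> i; rewrite mnmE.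
Qed.

Lemma box_leW A B p : (A <= B)%N -> box_le A p -> box_le B p.
Proof. by move=> AB pA m mp i; apply: leq_trans AB; apply: pA. Qed.

Lemma box_le_exists p : exists A, box_le A p.
Proof.
exists (msize p) => m /msize_mdeg_lt/ltnW mp i; apply: leq_trans mp.
by rewrite mdegE (bigD1 i) //= leq_addr.
Qed.

Lemma box_eq0 B p : box_le B p ->
    (forall e : {ffun 'I_n -> 'I_B.+1}, p@_[multinom (e i : nat) | i < n] = 0) ->
  p = 0.
Proof.
move=> pB p0; apply/mpolyP => m; rewrite mcoeff0.
have [mp|/memN_msupp_eq0//] := boolP (m \in msupp p).
rewrite -[RHS](p0 [ffun i => inord (m i)]); congr (p@__).
by apply/mnmP => i; rewrite mnmE ffunE inordK // ltnS pB.
Qed.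
End Box.

(** The inequality behind algebraic dependence. On the right, (N+1)^4
    monomials in four polynomials of box degree D and the multiples of f by
    the monomials of a box; on the left, the dimension of a box containing
    them all. The two large fourth powers differ by O(N^3). *)
Lemma box_count D :
  exists N, ((4 * N.+1 * D + 4) ^ 4 < N.+1 ^ 4 + (4 * N.+1 * D + 1) ^ 4)%N.
Proof.
have le1 x : (0 < x -> (x + 3) ^ 4 <= x ^ 4 + 255 * x ^ 3)%N.
  by rewrite !expnS expn0; nia.
exists (255 * (4 * D.+1) ^ 3)%N.
move: (255)%N le1 => C le1; set N := (C * _)%N.
have xN : (4 * N.+1 * D + 1 <= 4 * D.+1 * N.+1)%N by nia.
rewrite -[4%N in X in (X < _)%N]/(1 + 3)%N addnA.
move: (4 * N.+1 * D + 1)%N (addn_gt0 (4 * N.+1 * D) 1) xN => x.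
rewrite orbT => x0 xN.
apply: leq_ltn_trans (le1 x x0) _; rewrite addnC ltn_add2r.
apply: (@leq_ltn_trans (C * ((4 * D.+1) ^ 3 * N.+1 ^ 3))%N).
  by rewrite leq_mul2l -expnMn leq_exp2r ?xN ?orbT.
by rewrite mulnA -/N [X in (_ < X)%N]expnS ltn_mul2r expn_gt0 /= ltnS leqnn.
Qed.

Section Dependence.
Variables (K : fieldType).
Notation S := {mpoly K[4]}.

Lemma box_leC B (c : K) (p : S) : box_le B p -> box_le B (c *: p).
Proof.
move=> pB m; rewrite mcoeff_msupp mcoeffZ => cp; apply: pB.
by rewrite mcoeff_msupp; apply: contraNneq cp => ->; rewrite mulr0.
Qed.

Lemma box_le_sum (I : finType) B (F : I -> S) :
  (forall i, box_le B (F i)) -> box_le B (\sum_i F i).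
Proof.
move=> FB; apply: big_ind => // [m|p q pB qB m]; first by rewrite msupp0.
by move/msuppD_le; rewrite mem_cat => /orP[/pB|/qB].
Qed.

Definition mono4 (r : 'I_4 -> S) i j k l : S :=
  r 0 ^+ i * r 1 ^+ j * r 2%:R ^+ k * r 3%:R ^+ l.

(** Modulo f, four polynomials satisfy a polynomial relation: by
    [box_count], their monomials of bounded degree and enough multiples of f
    are linearly dependent, and the multiples of f alone are not. *)
Lemma algebraic_dependence (f : S) (r : 'I_4 -> S) : f != 0 -> box_le 3 f ->
  exists n (c : nat -> nat -> nat -> nat -> K),
    (exists i j k l, [/\ (i < n)%N, (j < n)%N, (k < n)%N & (l < n)%N] /\ c i j k l != 0) /\
    exists q, \sum_(i < n) \sum_(j < n) \sum_(k < n) \sum_(l < n)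
      c i j k l *: mono4 r i j k l = q * f.
Proof.
move=> f0 f3.
have [D rD] : exists D, forall i, box_le D (r i).
  have /choice[d dP] i := box_le_exists (r i).
  by exists (\max_i d i)%N => i; apply: box_leW (dP i); exact: leq_bigmax.
have [N cN] := box_count D.
pose E := ('I_N.+1 * 'I_N.+1 * 'I_N.+1 * 'I_N.+1)%type.
pose L := {ffun 'I_4 -> 'I_(4 * N.+1 * D).+1}.
pose J := {ffun 'I_4 -> 'I_(4 * N.+1 * D + 3).+1}.
pose mn (e : L) := [multinom (e i : nat) | i < 4].
pose g (x : E + L) : S := match x with
  | inl e => mono4 r e.1.1.1 e.1.1.2 e.1.2 e.2
  | inr e => f * 'X_[mn e] end.
have gB x : box_le (4 * N.+1 * D + 3) (g x).
  case: x => [[[[i j] k] l]|e] /=; last first.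
    rewrite addnC; apply: box_leM => // m; rewrite msuppX inE => /eqP-> t.
    by rewrite mnmE -ltnS.
  have rX t (e : 'I_N.+1) : box_le (N.+1 * D) (r t ^+ e).
    by apply: (box_leW _ (box_leX (rD t))); rewrite leq_mul2r ltnW ?orbT.
  have -> : (4 * N.+1 * D + 3 = N.+1 * D + N.+1 * D + N.+1 * D + N.+1 * D + 3)%N by lia.
  apply: (@box_leW _ _ _ _ _ (leq_addr 3 _)).
  by do 3![apply: box_leM; last exact: rX]; exact: rX.
have [|c [[x cx] c0]] := linear_dependence (I := (E + L)%type) (J := J)
    (fun x e => (g x)@_[multinom (e i : nat) | i < 4]).
  rewrite card_sum !card_prod !card_ffun !card_ord -addnS -[(_ * D).+1]addn1.
  by rewrite (_ : N.+1 * N.+1 * N.+1 * N.+1 = N.+1 ^ 4)%N // !expnS expn0 muln1 !mulnA.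
have sum0 : \sum_x c x *: g x = 0.
  apply: (@box_eq0 _ _ (4 * N.+1 * D + 3)).
    by apply: box_le_sum => y; exact: box_leC.
  by move=> e; rewrite -[RHS](c0 e) raddf_sum; apply: eq_bigr => y _; rewrite /= mcoeffZ.
have sumE : \sum_x c x *: g x = \sum_(e : E) c (inl e) *: g (inl e)
    + f * \sum_(e : L) c (inr e) *: 'X_[mn e].
  rewrite big_sumType /=; congr (_ + _).
  by rewrite mulr_sumr; apply: eq_bigr => e _; rewrite scalerAr.
exists N.+1, (fun i j k l => c (inl (inord i, inord j, inord k, inord l))); split; last first.
  exists (- \sum_(e : L) c (inr e) *: 'X_[mn e]).
  rewrite mulrC mulrN; apply/eqP; rewrite -addr_eq0; apply/eqP; rewrite -[RHS]sum0 sumE; congr (_ + _).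
  rewrite !pair_bigA /=; apply: eq_bigr => [[[[i j] k] l]] _ /=.
  by rewrite !inord_val.
case: x cx => [[[[i j] k] l]|e] cx.
  by exists i, j, k, l; rewrite !inord_val; split=> //; split.
have [[[[[i j] k] l] ce]|nc] := pselect (exists e : E, c (inl e) != 0).
  by exists i, j, k, l; rewrite !inord_val; split=> //; split.
case/eqP: cx; have : f * \sum_(e : L) c (inr e) *: 'X_[mn e] = 0.
  move: sum0; rewrite sumE [X in X + _]big1 ?add0r // => e' _.
  have [->|ce'] := eqVneq (c (inl e')) 0; first by rewrite scale0r.
  by case: nc; exists e'.
move/eqP; rewrite mulf_eq0 (negbTE f0) /= => /eqP/(congr1 (mcoeff (mn e))).
rewrite raddf_sum mcoeff0 (bigD1 e) //= mcoeffZ mcoeffX eqxx mulr1 big1 ?addr0 //.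
move=> e1 ne1; rewrite mcoeffZ mcoeffX; case: eqP => [mE|_]; last by rewrite mulr0.
case/eqP: ne1; apply/ffunP => t; apply/val_inj.
by have := congr1 (fun m : 'X_{1..4} => m t) mE; rewrite !mnmE.
Qed.
End Dependence.

Section Independence.
Variables (R : comNzRingType) (V : lmodType R).

(** One step of the independence of a regular sequence. If P(x) maps V into
    N, then the constant coefficient of P maps V into N', which contains x
    V, and vanishes by assumption; what is left is a multiple of x, and x
    may be cancelled modulo N. *)
Lemma horner_indep (A : nzRingType) (ev : {rmorphism A -> R}) (x : R) (N N' : V -> Prop) :
    submod N' -> (forall y, N y -> N' y) -> (forall y, N' (x *: y)) ->
    (forall y, N (x *: y) -> N y) ->
    (forall a, (forall y, N' (ev a *: y)) -> a = 0) ->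
  forall P : {poly A}, (forall y, N ((map_poly ev P).[x] *: y)) -> P = 0.
Proof.
move=> sN' NN' xN' xN ev0; elim/poly_ind => [//|P c IHP].
rewrite rmorphD rmorphM /= map_polyX map_polyC /= => PN.
have PNE y : N (x *: ((map_poly ev P).[x] *: y) + ev c *: y).
  by have := PN y; rewrite hornerMXaddC scalerDl mulrC scalerA.
have c0 : c = 0.
  apply: ev0 => y; rewrite -[_ *: y](addKr (x *: ((map_poly ev P).[x] *: y))).
  by apply: (submodD sN'); [apply: (submodN sN') | apply: NN'].
rewrite c0 addr0 IHP ?mul0r // => y; apply: xN.
by have := PNE y; rewrite c0 rmorph0 scale0r addr0.
Qed.

Variables (K : fieldType) (iota : {rmorphism K -> R}) (x : nat -> R) (N : nat -> V -> Prop).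
Hypothesis sN : forall k, submod (N k).
Hypothesis NS : forall k y, (k < 4)%N -> N k y -> N k.+1 y.
Hypothesis xN : forall k y, (k < 4)%N -> N k.+1 (x k *: y).
Hypothesis regx : forall k y, (k < 4)%N -> N k (x k *: y) -> N k y.
Hypothesis N4 : exists y, ~ N 4 y.

(** Elements x_0, ..., x_3 each of which is regular modulo N_k and maps V
    into N_(k+1) are algebraically independent over K. This covers both
    regular sequences, with N_k the submodule (x_0, ..., x_(k-1)) V, and
    chains of prime ideals N_k. *)
Lemma regular_indep n (c : nat -> nat -> nat -> nat -> K) :
    (forall y, N 0 ((\sum_(i < n) \sum_(j < n) \sum_(k < n) \sum_(l < n)
       iota (c i j k l) * (x 0%N ^+ i * x 1%N ^+ j * x 2%N ^+ k * x 3%N ^+ l)) *: y)) ->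
  forall i j k l, (i < n)%N -> (j < n)%N -> (k < n)%N -> (l < n)%N -> c i j k l = 0.
Proof.
move=> c0.
have step (A : nzRingType) (ev : {rmorphism A -> R}) m : (m < 4)%N ->
    (forall a, (forall y, N m.+1 (ev a *: y)) -> a = 0) ->
  forall P : {poly A}, (forall y, N m ((map_poly ev P).[x m] *: y)) -> P = 0.
  by move=> m4; apply: horner_indep => // y; [exact: NS | exact: xN | exact: regx].
have ev3 a : (forall y, N 4 (iota a *: y)) -> a = 0.
  move=> Na; apply/eqP; apply: contraT => a0; have [y []] := N4.
  rewrite -[y]scale1r -(rmorph1 iota) -(divff a0) rmorphM -scalerA; exact: Na.
pose up (A : nzRingType) (ev : {rmorphism A -> R}) m : {rmorphism {poly A} -> R} :=
  (horner_eval (x m) \o map_poly ev : {rmorphism _ -> _}).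
have {}step (A : nzRingType) (ev : {rmorphism A -> R}) m : (m < 4)%N ->
    (forall a, (forall y, N m.+1 (ev a *: y)) -> a = 0) ->
    (forall P, (forall y, N m (up A ev m P *: y)) -> P = 0).
  exact: step.
have ev0 := step _ _ 0%N isT (step _ _ 1%N isT (step _ _ 2%N isT (step _ _ 3%N isT ev3))).
have upE (A : nzRingType) (ev : {rmorphism A -> R}) m (E : nat -> A) :
    up A ev m (\poly_(i < n) E i) = \sum_(i < n) ev (E i) * x m ^+ i.
  rewrite /up /= /horner_eval (_ : map_poly ev _ = \poly_(i < n) ev (E i)) ?horner_poly //.
  by apply/polyP => i; rewrite coef_map !coef_poly /=; case: ifP; rewrite ?rmorph0.
pose P := \poly_(i < n) \poly_(j < n) \poly_(k < n) \poly_(l < n) c i j k l.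
have /polyP P0 : P = 0.
  apply: ev0 => y; rewrite upE; move: (c0 y); congr (N 0 (_ *: y)).
  apply: eq_bigr => i _; rewrite upE mulr_suml; apply: eq_bigr => j _.
  rewrite upE !mulr_suml; apply: eq_bigr => k _.
  rewrite upE !mulr_suml; apply: eq_bigr => l _ /=.
  by ring.
move=> i j k l li lj lk ll.
have := P0 i; rewrite coef_poly li coef0 => /polyP/(_ j); rewrite coef_poly lj coef0.
by move/polyP/(_ k); rewrite coef_poly lk coef0 => /polyP/(_ l); rewrite coef_poly ll coef0.
Qed.
End Independence.

(** * Substitutions and homogeneous components of polynomials *)

Section Substitution.
Variables (K : fieldType) (n : nat).
Notation S := {mpoly K[n]}.

Definition subst (s : 'I_n -> S) (p : S) : S := p \mPo [tuple s i | i < n].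

HB.instance Definition _ s := GRing.RMorphism.copy (subst s)
  (comp_mpoly [tuple s i | i < n]).

Lemma substX s i : subst s 'X_i = s i.
Proof. by rewrite /subst comp_mpolyXU -tnth_nth tnth_mktuple. Qed.

Lemma substC s c : subst s c%:MP = c%:MP.
Proof. exact: comp_mpolyC. Qed.

Lemma substZ s c p : subst s (c *: p) = c *: subst s p.
Proof. exact: comp_mpolyZ. Qed.

Lemma subst_cong s (J : S^o -> Prop) : submod J ->
  (forall i, J ('X_i - s i)) -> forall p, J (p - subst s p).
Proof.
move=> sJ Js; elim/mpolyind => [|c m p _ _ IHp]; first by rewrite rmorph0 subrr; exact: sJ.1.
rewrite rmorphD /= substZ opprD addrACA -scalerBr; apply: (submodD sJ) => //.
rewrite -mul_mpolyC; apply: (submodZ sJ); rewrite mpolyXE_id rmorph_prod.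
elim/big_rec2: _ => [|i r q _ Jqr]; first by rewrite subrr; exact: sJ.1.
rewrite rmorphXn /= substX.
have -> : 'X_i ^+ m i * r - s i ^+ m i * q
    = r * ('X_i ^+ m i - s i ^+ m i) + s i ^+ m i * (r - q) by ring.
apply: (submodD sJ); last exact: (submodZ sJ).
by rewrite subrXX mulrA mulrAC; apply: (submodZ sJ).
Qed.

Lemma rmorph_mpoly_eq (A : nzRingType) (g h : {rmorphism S -> A}) :
  (forall c, g c%:MP = h c%:MP) -> (forall i, g 'X_i = h 'X_i) -> forall p, g p = h p.
Proof.
move=> ghC ghX; elim/mpolyind => [|c m p _ _ IHp]; first by rewrite !rmorph0.
rewrite !rmorphD IHp -mul_mpolyC !rmorphM ghC mpolyXE_id !rmorph_prod.
by congr (_ * _ + _); apply: eq_bigr => i _; rewrite !rmorphXn ghX.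
Qed.

Lemma subst_comp (s t : 'I_n -> S) p :
  subst t (subst s p) = subst (fun i => subst t (s i)) p.
Proof.
apply: (rmorph_mpoly_eq (g := subst t \o subst s) (h := subst (fun i => subst t (s i)))).
  by move=> c /=; rewrite !substC.
by move=> i /=; rewrite !substX.
Qed.
End Substitution.

Section Homogeneous.
Variables (K : fieldType) (n : nat).
Notation S := {mpoly K[n]}.
Implicit Types p q : S.

(** The degree is an integer because the gradings of modules involve shifts:
    in a negative degree only 0 is homogeneous. *)
Definition homdeg (z : int) p := forall m, p@_m != 0 -> Posz (mdeg m) = z.

Definition hcomp (z : int) p : S :=
  if z is Posz k then pihomog mdeg k p else 0.

Lemma mcoeff_hcomp z p m : (hcomp z p)@_m = if Posz (mdeg m) == z then p@_m else 0.
Proof.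
case: z => k /=; last by rewrite mcoeff0.
rewrite pihomogE raddf_sum /=; case: ifP => [/eqP[mk]|mk].
  have [mp|mp] := boolP (m \in msupp p).
    rewrite big_mkcond (bigD1_seq m) ?msupp_uniq //= mk eqxx mcoeffZ mcoeffX eqxx mulr1.
    rewrite big1 ?addr0 // => m' m'm; case: ifP; rewrite ?mcoeff0 // => _.
    by rewrite mcoeffZ mcoeffX (negbTE m'm) mulr0.
  rewrite (memN_msupp_eq0 mp) big_seq_cond big1 // => m' /andP[m'p _].
  rewrite mcoeffZ mcoeffX; case: eqP => [m'm|]; last by rewrite mulr0.
  by rewrite -m'm m'p in mp.
rewrite big1 // => m' /eqP m'k; rewrite mcoeffZ mcoeffX; case: eqP => [m'm|]; last by rewrite mulr0.
by rewrite -m'm m'k eqxx in mk.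
Qed.

Fact hcomp_is_linear z : linear (hcomp z).
Proof.
move=> a p q; apply/mpolyP => m.
by rewrite !(mcoeffD, mcoeffZ, mcoeff_hcomp); case: ifP; rewrite ?mulr0 ?addr0.
Qed.
HB.instance Definition _ z := GRing.isLinear.Build K S S _ (hcomp z) (hcomp_is_linear z).

Lemma homog_hcomp z p : homdeg z (hcomp z p).
Proof. by move=> m; rewrite mcoeff_hcomp; case: ifP => [/eqP//|_]; rewrite eqxx. Qed.

Lemma hcomp_id z p : homdeg z p -> hcomp z p = p.
Proof.
move=> hp; apply/mpolyP => m; rewrite mcoeff_hcomp; case: ifP => // /eqP mz.
by have [->|/hp] := eqVneq p@_m 0.
Qed.

Lemma hcomp_other z w p : homdeg z p -> z != w -> hcomp w p = 0.
Proof.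
move=> hp zw; apply/mpolyP => m; rewrite mcoeff_hcomp mcoeff0; case: ifP => // /eqP mw.
by have [//|/hp zE] := eqVneq p@_m 0; rewrite -zE mw eqxx in zw.
Qed.

Lemma homog0 z : homdeg z 0. Proof. by move=> m; rewrite mcoeff0 eqxx. Qed.

Lemma homogD z p q : homdeg z p -> homdeg z q -> homdeg z (p + q).
Proof. by move=> hp hq; rewrite -(hcomp_id hp) -(hcomp_id hq) -raddfD; exact: homog_hcomp. Qed.

Lemma homogN z p : homdeg z p -> homdeg z (- p).
Proof. by move=> hp m; rewrite mcoeffN oppr_eq0; exact: hp. Qed.

Lemma homogB z p q : homdeg z p -> homdeg z q -> homdeg z (p - q).
Proof. by move=> hp hq; apply/homogD/homogN. Qed.

Lemma homogZ z c p : homdeg z p -> homdeg z (c *: p).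
Proof. by move=> hp; rewrite -(hcomp_id hp) -linearZ; exact: homog_hcomp. Qed.

Lemma homog_sum z (I : Type) (r : seq I) (P : pred I) (F : I -> S) :
  (forall i, P i -> homdeg z (F i)) -> homdeg z (\sum_(i <- r | P i) F i).
Proof. by move=> hF; apply: big_ind => //; [exact: homog0 | exact: homogD]. Qed.

Lemma homogM z w p q : homdeg z p -> homdeg w q -> homdeg (z + w) (p * q).
Proof.
move=> hp hq m; rewrite -mcoeff_msupp => /msuppM_le/allpairsP[[m1 m2] /= [m1p m2q ->]].
by rewrite mdegD PoszD hp ?hq -?mcoeff_msupp.
Qed.

Lemma homogXm m : homdeg (mdeg m) 'X_[m].
Proof. by move=> m'; rewrite mcoeffX; case: (m =P m') => [->|]; rewrite ?eqxx. Qed.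

Lemma homogX i : homdeg 1 'X_i.
Proof. by have := @homogXm U_(i)%MM; rewrite mdeg1. Qed.

Lemma homogXn z p k : homdeg z p -> homdeg (z *+ k) (p ^+ k).
Proof.
move=> hp; elim: k => [|k IHk]; last by rewrite exprS mulrS; exact: homogM.
by move=> m; rewrite expr0 mcoeff1; case: (m =P 0%MM) => [->|]; rewrite ?mdeg0 ?eqxx.
Qed.

Lemma homogC c : homdeg 0 c%:MP.
Proof.
by move=> m; rewrite mcoeffC; case: (m =P 0%MM) => [->|]; rewrite ?mdeg0 ?mulr0 ?eqxx.
Qed.

Lemma homog_neg z p : homdeg z p -> (z < 0)%R -> p = 0.
Proof.
move=> hp z0; apply/mpolyP => m; rewrite mcoeff0.
by apply/eqP; apply: contraLR z0 => /hp <-.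
Qed.

Lemma homog_const p : homdeg 0 p -> p = (p@_0%MM)%:MP.
Proof.
move=> hp; apply/mpolyP => m; rewrite mcoeffC.
have [->|m0] := eqVneq m 0%MM; first by rewrite mulr1.
rewrite mulr0; apply/eqP; apply: contraNT m0 => /hp [/eqP]; by rewrite mdeg_eq0.
Qed.

Lemma homog_uniq z w p : p != 0 -> homdeg z p -> homdeg w p -> z = w.
Proof.
move=> p0 hz hw; apply/eqP; apply: contraT => zw; case/eqP: p0.
by rewrite -(hcomp_id hw) (hcomp_other hz zw).
Qed.

Lemma homog_coef0 z p : homdeg z p -> z != 0 -> p@_0%MM = 0.
Proof. by move=> hp z0; apply/eqP; apply: contraNT z0 => /hp; rewrite mdeg0 => <-. Qed.

Lemma hcompM z w p q : homdeg z p -> hcomp w (p * q) = p * hcomp (w - z) q.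
Proof.
move=> hp; rewrite {1 2}[p]mpolyE !mulr_suml raddf_sum /=.
rewrite [LHS]big_seq [RHS]big_seq; apply: eq_bigr => m mp.
have mz : Posz (mdeg m) = z by apply: hp; rewrite -mcoeff_msupp.
rewrite -!scalerAl linearZ /=; congr (_ *: _).
elim/mpolyind: q => [|c k q _ _ IHq]; first by rewrite mulr0 !raddf0 mulr0.
rewrite mulrDr !raddfD /= IHq mulrDr; congr (_ + _).
rewrite -scalerAr !linearZ /= -scalerAr; congr (_ *: _); rewrite -mpolyXD.
have [/eqP kw|kw] := boolP (Posz (mdeg k) == w - z).
  rewrite !hcomp_id ?mpolyXD // -?kw; first exact: homogXm.
  have -> : w = mdeg (m + k)%MM; last by rewrite -mpolyXD; exact: homogXm.
  by rewrite mdegD PoszD mz kw addrC subrK.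
rewrite !(hcomp_other (@homogXm _)) ?mulr0 //.
by apply: contra kw; rewrite mdegD PoszD mz => /eqP<-; rewrite [z + _]addrC addrK.
Qed.

Lemma hcomp0_coef p : hcomp 0 p = (p@_0%MM)%:MP.
Proof. by rewrite [LHS]homog_const ?mcoeff_hcomp ?mdeg0 //; exact: homog_hcomp. Qed.

Lemma euler_formula (d : nat) p : homdeg d p -> \sum_i 'X_i * p^`M(i) = p *+ d.
Proof.
move=> hp; apply/mpolyP => m; rewrite raddf_sum mcoeffMn /=.
have -> : p@_m *+ d = p@_m *+ mdeg m.
  by have [->|/hp[->]] := eqVneq p@_m 0; rewrite ?mul0rn.
rewrite mdegE -sumrMnr; apply: eq_bigr => i _.
case mi : (m i) => [|k].
  rewrite mulr0n mulrC; apply: memN_msupp_eq0; apply/negP.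
  move=> /msuppM_le/allpairsP[[m1 m2] /= [_ + mE]]; rewrite msuppX inE => /eqP m2E.
  by rewrite mE m2E mnmDE mnmE eqxx addn1 in mi.
have mE : m = (m - U_(i) + U_(i))%MM.
  apply/mnmP => j; rewrite mnmDE mnmBE mnmE; case: eqP => [<-|]; rewrite ?mi //.
    by rewrite subn1 addn1.
  by rewrite subn0 addn0.
have -> : ('X_i * p^`M(i))@_m = (p^`M(i))@_(m - U_(i)).
  by rewrite mulrC -[RHS](mcoeffMX _ U_(i)) addmC -mE.
by rewrite mcoeff_deriv -mE mnmBE mnmE eqxx mi subn1.
Qed.

(** By Euler's formula the exterior derivative, divided by the degree, is a
    contracting homotopy of the Koszul complex of the variables. *)
Lemma koszul_exact z (p : 'I_n -> S) : [pchar K] =i pred0 ->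
    (forall i, homdeg z (p i)) -> \sum_i 'X_i * p i = 0 ->
  exists w : 'I_n -> 'I_n -> S, (forall i k, w i k = - w k i) /\
    forall i, p i = \sum_k 'X_k * w i k.
Proof.
move=> charK hp p0.
have [z0|z0] := boolP (z < 0).
  exists (fun _ _ => 0); split=> [i k|i]; first by rewrite oppr0.
  by rewrite (homog_neg (hp i)) // big1 // => k _; rewrite mulr0.
case: z z0 hp => // d _ hp.
have d0 : d.+1%:R != 0 :> K by have /pcharf0P-> := charK.
exists (fun i k => d.+1%:R^-1 *: ((p i)^`M(k) - (p k)^`M(i))); split=> [i k|i].
  by rewrite -scalerN opprB.
rewrite (eq_bigr (fun k => d.+1%:R^-1 *: ('X_k * (p i)^`M(k) - 'X_k * (p k)^`M(i)))); last first.
  by move=> k _; rewrite -scalerAr mulrBr.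
rewrite -scaler_sumr sumrB (euler_formula (hp i)).
have -> : \sum_k 'X_k * (p k)^`M(i) = - p i.
  have /(congr1 (mderiv i)) := p0; rewrite linear_sum linear0 /=.
  under eq_bigr => k _ do rewrite mderivM.
  rewrite big_split /= => /eqP; rewrite addrC addr_eq0 => /eqP->; congr (- _).
  rewrite (bigD1 i) //= big1 ?addr0 => [|k ki].
    by rewrite mderivX mnmE eqxx scale1r (_ : _ - _ = 0)%MM ?mpolyX0 ?mul1r //;
      apply/mnmP => j; rewrite mnmBE subnn mnmE.
  by rewrite mderivX mnmE (negbTE ki) scale0r mul0r.
by rewrite opprK -mulrSr -scaler_nat scalerA mulVf // scale1r.
Qed.
End Homogeneous.

(** * The Fermat cubic is prime *)

Section FractionElt.
Local Open Scope quotient_scope.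

Lemma fraction_numden (R : idomainType) (x : {fraction R}) :
  exists a b : R, b != 0 /\ x * FracField.tofrac b = FracField.tofrac a.
Proof.
elim/quotW: x => x; exists \n_x, \d_x; split; first exact: denom_ratioP.
unlock FracField.tofrac; rewrite -[LHS]FracField.pi_mul; apply/eqmodP.
rewrite /= FracField.equivfE /FracField.mulf.
rewrite !numden_Ratio ?(oner_eq0, mulf_neq0, denom_ratioP) //.
by rewrite !mulr1 mulrC.
Qed.
End FractionElt.

Section CubeRatio.

(** c is a cube in the field of fractions. *)
Definition cube_ratio (D : idomainType) (c : D) :=
  exists p q, q != 0 /\ p ^+ 3 = c * q ^+ 3.

Lemma dvd_root_cubes (D : idomainType) (p q C : {poly D}) r :
    p ^+ 3 = C * q ^+ 3 -> root q r -> q != 0 ->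
  exists p' q', [/\ q = q' * ('X - r%:P), p = p' * ('X - r%:P) & p' ^+ 3 = C * q' ^+ 3].
Proof.
move=> pE qr q0; have pr : root p r.
  have /= := congr1 (fun u : {poly D} => u.[r]) pE.
  rewrite !(horner_exp, hornerM) (rootP qr) expr0n mulr0 => /eqP.
  by rewrite expf_eq0.
have [p' p'E] := factor_theorem _ _ pr; have [q' q'E] := factor_theorem _ _ qr.
exists p', q'; split=> //; move: pE; rewrite q'E p'E !exprMn [RHS]mulrA.
by apply: mulIf; rewrite expf_neq0 // polyXsubC_eq0.
Qed.

(** Once common factors X of the numerator and the denominator are removed,
    they may be evaluated at 0. *)
Lemma cube_ratio_poly (D : idomainType) (c : D) :
  cube_ratio ('X^3 + c%:P) -> cube_ratio c.
Proof.
move=> [p [q []]]; have [n] := ubnP (size q); elim: n p q => // n IHn p q qn q0 pE.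
have [/rootP q00|q00] := boolP (root q 0); last first.
  exists p.[0], q.[0]; split=> //.
  have /= := congr1 (fun u : {poly D} => u.[0]) pE.
  by rewrite !(horner_exp, hornerM) hornerD hornerXn hornerC expr0n add0r.
have [p' [q' [qE _ p'E]]] := dvd_root_cubes pE (introT rootP q00) q0.
have q'0 : q' != 0 by apply: contraNneq q0; rewrite qE => ->; rewrite mul0r.
by apply: (IHn p' q') => //; move: qn; rewrite qE size_Mmonic ?monicXsubC // size_XsubC addn2.
Qed.

(** At the simple root -y of X^3 + y^3, the order of a quotient of cubes
    would be a multiple of 3 and also 1; this is run as a descent on the
    degree of q. *)
Lemma not_cube_ratio (D : idomainType) (y : D) : 3 * y ^+ 2 != 0 ->
  ~ cube_ratio ('X^3 + (y ^+ 3)%:P).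
Proof.
move=> y0 [p [q []]]; have [n] := ubnP (size q); elim: n p q => // n IHn p q qn q0 pE.
have fE : 'X^3 + (y ^+ 3)%:P = ('X^2 - y%:P * 'X + (y ^+ 2)%:P) * ('X - (- y)%:P) :> {poly D}.
  by rewrite !polyCN !rmorphXn /=; ring.
have pr : root p (- y).
  have /= := congr1 (fun u : {poly D} => u.[- y]) pE.
  rewrite fE !(horner_exp, hornerM) hornerXsubC subrr mulr0 mul0r => /eqP.
  by rewrite expf_eq0.
have [p' p'E] := factor_theorem _ _ pr.
have q1 : root q (- y).
  have X0 : 'X - (- y)%:P != 0 :> {poly D} by rewrite polyXsubC_eq0.
  have : p' ^+ 3 * ('X - (- y)%:P) ^+ 2 = ('X^2 - y%:P * 'X + (y ^+ 2)%:P) * q ^+ 3.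
    apply: (mulIf X0); transitivity ((p' * ('X - (- y)%:P)) ^+ 3); first by ring.
    by rewrite -p'E pE fE; ring.
  move=> /(congr1 (fun u : {poly D} => u.[- y])) /=.
  rewrite !(horner_exp, hornerM) hornerXsubC subrr expr0n mulr0 => /esym/eqP.
  rewrite mulf_eq0 expf_eq0 /= => /orP[/eqP yy|/eqP/rootP//].
  by case/eqP: y0; rewrite -[RHS]yy !(hornerD, hornerN, hornerM, hornerXn, hornerX, hornerC); ring.
have [p2 [q' [qE _ p'E2]]] := dvd_root_cubes pE q1 q0.
have q'0 : q' != 0 by apply: contraNneq q0; rewrite qE => ->; rewrite mul0r.
by apply: (IHn p2 q') => //; move: qn; rewrite qE size_Mmonic ?monicXsubC // size_XsubC addn2.
Qed.

(** A cubic without a root in the field of fractions is irreducible over it.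
    As it is monic, Euclidean division by it does not leave D, so that
    primality descends to D. *)
Lemma prime_cubic (D : idomainType) (c : D) (P Q : {poly D}) :
    ~ cube_ratio c -> (exists u, P * Q = u * ('X^3 + c%:P)) ->
  (exists u, P = u * ('X^3 + c%:P)) \/ (exists u, Q = u * ('X^3 + c%:P)).
Proof.
move=> nc [u PQ]; set F := 'X^3 + c%:P in PQ *.
pose m := map_poly (@FracField.tofrac D).
have mF : m F = 'X^3 + (FracField.tofrac c)%:P by rewrite /m rmorphD /= map_polyXn map_polyC.
have mon_F : F \is monic by rewrite /F monicE lead_coefDl ?lead_coefXn // size_polyXn size_polyC; case: (c != 0).
have sF : size F = 4 by rewrite size_polyDl size_polyXn // size_polyC; case: (c != 0).
have size_m p : size (m p) = size p.
  by apply: size_map_inj_poly; [move=> x y /eqP; rewrite tofrac_eq => /eqP | rewrite tofrac0].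
have irrF : irreducible_poly (m F).
  apply: cubic_irreducible; first by rewrite size_m sF.
  move=> x; apply/negP => /rootP; rewrite mF hornerD hornerXn hornerC => /eqP.
  rewrite addr_eq0 => /eqP x3; have [a [b [b0 abE]]] := fraction_numden x.
  case: nc; exists (- a), b; split=> //; apply/eqP; rewrite -tofrac_eq.
  by rewrite !(tofracM, tofracXn, tofracN) -abE exprNn exprMn x3 -signr_odd /=; apply/eqP; ring.
have dvd p : m F %| m p -> exists u, p = u * F.
  move=> Fp; have pE := Pdiv.RingMonic.rdivp_eq mon_F p.
  exists (Pdiv.Ring.rdivp p F); rewrite {1}pE; set r := Pdiv.Ring.rmodp _ _ in pE *.
  have rF : (size r < size F)%N by rewrite Pdiv.Ring.ltn_rmodp monic_neq0.
  suff -> : r = 0 by rewrite addr0.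
  have : m F %| m r.
    have -> : m r = m p - m (Pdiv.Ring.rdivp p F) * m F.
      by rewrite /m -rmorphM -rmorphB {1}pE addrC addKr.
    by rewrite dvdp_subl ?dvdp_mulIr.
  have [->//|r0 /dvdp_leq] := eqVneq r 0.
  by rewrite -size_poly_eq0 size_m size_poly_eq0 r0 !size_m leqNgt rF => /(_ isT).
have : m F %| m P * m Q by rewrite /m -rmorphM PQ rmorphM dvdp_mulIr.
have [cop|ncop] := boolP (coprimep (m F) (m P)).
  by rewrite Gauss_dvdpr // => /dvd; right.
move=> _; left; apply: dvd; have := irrF.2 _ ncop (dvdp_gcdl _ _).
by rewrite /eqp => /andP[_ /dvdp_trans]; apply; exact: dvdp_gcdr.
Qed.
End CubeRatio.

Section MuniIso.
Variables (K : fieldType) (n : nat).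

Fact commX : commr_rmorph (@mwiden n K) 'X_ord_max. Proof. by move=> x; exact: mulrC. Qed.

Definition unmuni : {poly {mpoly K[n]}} -> {mpoly K[n.+1]} := horner_morph commX.
HB.instance Definition _ := GRing.RMorphism.copy unmuni (horner_morph commX).

Lemma unmuniC p : unmuni p%:P = mwiden p. Proof. exact: horner_morphC. Qed.
Lemma unmuniX : unmuni 'X = 'X_ord_max. Proof. exact: horner_morphX. Qed.

Lemma muniXm m : muni 'X_[m] =
  'X_[[multinom m (widen_ord (leqnSn n) i) | i < n]] *: 'X^(m ord_max)
  :> {poly {mpoly K[n]}}.
Proof. by rewrite muniE msuppX big_seq1 mcoeffX eqxx scale1r. Qed.

Lemma muniK : cancel (@muni n K) unmuni.
Proof.
elim/mpolyind => [|c m p _ _ IHp]; first by rewrite muni0 (rmorph0 unmuni).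
rewrite muniD (rmorphD unmuni) /=; congr (_ + _); last exact: IHp.
rewrite muniZ muniXm.
rewrite -!mul_polyC !(rmorphM unmuni) (rmorphXn unmuni) /= !unmuniC unmuniX.
rewrite -mul_mpolyC mwidenC; congr (_ * _).
rewrite mwidenX mpolyXn -mpolyXD; congr 'X_[_]; apply/mnmP => i.
rewrite mnmDE mulmnE mnmE.
have [[j ->]|->] : (exists j, i = widen_ord (leqnSn n) j) \/ i = ord_max.
- have := ltn_ord i; rewrite ltnS leq_eqVlt => /orP[/eqP|] ni.
    by right; apply/val_inj.
  by left; exists (Ordinal ni); apply/val_inj.
- rewrite mnmwiden_widen mnmE -[_ == _]val_eqE /= gtn_eqF ?mul0n ?addn0 //.
- by rewrite mnmwiden_ordmax eqxx mul1n.
Qed.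

Lemma muni_sum_cubes : muni (\sum_(i < n.+1) 'X_i ^+ 3) =
  'X^3 + (\sum_(i < n) 'X_i ^+ 3)%:P :> {poly {mpoly K[n]}}.
Proof.
rewrite raddf_sum big_ord_recr /= addrC; congr (_ + _).
  rewrite rmorphXn /= muniXm mnmE eqxx (_ : [multinom _ | i < n] = 0%MM).
    by rewrite mpolyX0 scale1r.
  by apply/mnmP => i; rewrite !mnmE -val_eqE /= gtn_eqF.
rewrite raddf_sum; apply: eq_bigr => i _; rewrite !rmorphXn /= muniXm mnmE.
rewrite -val_eqE /= ltn_eqF // expr0 alg_polyC -rmorphXn; congr (_ ^+ 3)%:P; congr 'X_[_].
by apply/mnmP => j; rewrite !mnmE.
Qed.
End MuniIso.

Section F4Prime.
Variable K : closedFieldType.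
Hypothesis charK : [pchar K] =i pred0.
Notation S := {mpoly K[4]}.

Lemma nat_neq0 n : n.+1%:R != 0 :> K.
Proof. by have /pcharf0P-> := charK. Qed.

Lemma cube_ratio_morph (D D' : idomainType) (h : {rmorphism D -> D'}) (p : D) :
  injective h -> cube_ratio p -> cube_ratio (h p).
Proof.
move=> injh [a [b [b0 ab]]]; exists (h a), (h b); split.
  by apply: contraNneq b0 => hb; apply/eqP/injh; rewrite hb rmorph0.
by rewrite -!rmorphXn -rmorphM ab.
Qed.

Lemma cube_ratio_muni n (p : {mpoly K[n.+1]}) : cube_ratio p -> cube_ratio (muni p).
Proof. by apply: cube_ratio_morph; exact: can_inj (@muniK K n). Qed.

(** Specializing one variable to 0 reduces to Y^3 + Z^3, a cubic in Z with
    the simple root -Y. *)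
Lemma sum_cubes3 : ~ cube_ratio (\sum_(i < 3) 'X_i ^+ 3 : {mpoly K[3]}).
Proof.
move=> /cube_ratio_muni; rewrite muni_sum_cubes => /cube_ratio_poly.
move=> /cube_ratio_muni; rewrite muni_sum_cubes big_ord1.
apply: not_cube_ratio; rewrite mulf_neq0 ?expf_neq0 //.
  by rewrite -mpolyC_nat mpolyC_eq0 nat_neq0.
by rewrite -msize_poly_eq0 msizeX.
Qed.

Definition prime_elt (R : comNzRingType) (f : R) := forall p q,
  (exists u, p * q = u * f) -> (exists u, p = u * f) \/ (exists u, q = u * f).

Lemma prime_elt_retract (A B : comNzRingType) (h : {rmorphism A -> B})
    (g : {rmorphism B -> A}) (f : A) : cancel h g -> prime_elt (h f) -> prime_elt f.
Proof.
move=> hK prf p q [u pq]; have [|[v pE]|[v qE]] := prf (h p) (h q).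
- by exists (h u); rewrite -!rmorphM pq.
- by left; exists (g v); rewrite -[LHS]hK pE rmorphM hK.
- by right; exists (g v); rewrite -[LHS]hK qE rmorphM hK.
Qed.

Lemma f4_prime : prime_elt (f4 K).
Proof.
have prF : prime_elt (muni (f4 K)).
  rewrite (_ : muni (f4 K) = 'X^3 + (\sum_(i < 3) 'X_i ^+ 3)%:P); last exact: muni_sum_cubes.
  by move=> p q; apply: prime_cubic; exact: sum_cubes3.
exact: (prime_elt_retract (@muniK K 3)).
Qed.

End F4Prime.

(** * Lines on the Fermat cubic surface *)

Section Lines.
Variable K : closedFieldType.
Hypothesis charK : [pchar K] =i pred0.
Notation S := {mpoly K[4]}.

Lemma uniq4 (p q r t k : 'I_4) : uniq [:: p; q; r; t] -> k \in [:: p; q; r; t].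
Proof.
move=> u; have [|_ ->] := uniq_min_size u (s2 := enum 'I_4) (fun x _ => mem_enum _ x).
  by rewrite size_enum_ord.
exact: mem_enum.
Qed.

Lemma sum4 (V : nmodType) (F : 'I_4 -> V) p q r t : uniq [:: p; q; r; t] ->
  \sum_i F i = F p + F q + F r + F t.
Proof.
move=> u; rewrite (perm_big [:: p; q; r; t]) /=.
  by rewrite !big_cons big_nil addr0 !addrA.
apply: uniq_perm => //; first exact: index_enum_uniq.
by move=> k; rewrite mem_index_enum uniq4.
Qed.

Lemma complete4 (r t : 'I_4) : r != t -> exists p q, uniq [:: p; q; r; t].
Proof.
pose o k (H : (k < 4)%N) := Ordinal H.
case: r t => [[|[|[|[|//]]]] ?] [[|[|[|[|//]]]] ?] // _;
 first [by exists (o 0%N isT), (o 1%N isT) | by exists (o 0%N isT), (o 2 isT)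
       | by exists (o 0%N isT), (o 3 isT) | by exists (o 1%N isT), (o 2 isT)
       | by exists (o 1%N isT), (o 3 isT) | by exists (o 2 isT), (o 3 isT)].
Qed.

Lemma set3_uniq (i j s : 'I_4) : [set i; j; s]%SET = [set~ 0]%SET -> (i < j)%N ->
  uniq [:: 0; s; i; j].
Proof.
move=> /setP E ij; have := E i; have := E j; have := E s.
rewrite !inE !eqxx ?orbT /= => /esym s0 /esym j0 /esym i0.
rewrite !inE ![0 == _]eq_sym (negbTE s0) (negbTE j0) (negbTE i0) /=.
have ijN : i != j by apply: contraTneq ij => ->; rewrite ltnn.
rewrite ijN andbT andbT; apply/negP => sij.
have [p [q u]] := complete4 ijN.
have {}E k : k != 0 -> (k == i) || (k == j).
  move=> k0; have := E k; rewrite !inE k0 -orbA.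
  by move: sij => /orP[]/eqP->; rewrite ?orbb // orbCA orbb orbC.
have [pE|p0] := eqVneq p 0; last by move: u; rewrite /= !inE !negb_or => /and4P[/and3P[_ pi pj]]; have := E _ p0; rewrite (negbTE pi) (negbTE pj).
have [qE|q0] := eqVneq q 0; first by move: u; rewrite /= !inE pE qE.
by move: u; rewrite /= !inE !negb_or => /and4P[_ /andP[pi pj]]; have := E _ q0; rewrite (negbTE pi) (negbTE pj).
Qed.

Lemma uniq_set3 (i j s : 'I_4) : uniq [:: 0; s; i; j] -> [set i; j; s]%SET = [set~ 0]%SET.
Proof.
move=> u; apply/setP => k; have := uniq4 k u; rewrite !inE.
have [->|k0] := eqVneq k 0; last by move=> /= /or3P[]->; rewrite ?orbT.
by move=> _; move: u; rewrite /= !inE !negb_or => /andP[/and3P[/negbTE-> /negbTE-> /negbTE->]].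
Qed.

(** A partition of the four indices into two pairs can be written {0, s},
    {i, j} with i < j, as in the definition of the families. *)
Lemma normalize_pairs (C : 'I_4 -> 'I_4 -> Prop) (x y z w : 'I_4) :
    (forall k l, C k l -> C l k) -> uniq [:: x; y; z; w] -> C x y -> C z w ->
  exists i j s : 'I_4, [/\ (i < j)%N, [set i; j; s]%SET = [set~ 0]%SET, C 0 s & C i j].
Proof.
move=> symC.
have with0 (s i j : 'I_4) : uniq [:: 0; s; i; j] -> C 0 s -> C i j ->
    exists i j s : 'I_4, [/\ (i < j)%N, [set i; j; s]%SET = [set~ 0]%SET, C 0 s & C i j].
  move=> u C0 Cij; have [ij|ji|/val_inj ij] := ltngtP i j.
  - by exists i, j, s; split=> //; exact: uniq_set3.
  - exists j, i, s; split=> //; [apply: uniq_set3|exact: symC].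
    by rewrite (perm_uniq (s2 := [:: 0; s; i; j])) // !perm_cons (perm_catC [:: j] [:: i]).
  - by move: u; rewrite ij /= !inE eqxx !andbF.
move=> u Cxy Czw; have := uniq4 0 u; rewrite !inE => /or4P[]/eqP E0; move: u Cxy Czw; rewrite -?E0 => u Cxy Czw.
- exact: (with0 y z w).
- apply: (with0 x z w) => //; last exact: symC.
  by rewrite (perm_uniq (s2 := [:: x; 0; z; w])) // (perm_catCA [:: 0] [:: x] [:: z; w]).
- apply: (with0 w x y) => //.
  by rewrite (perm_uniq (s2 := [:: x; y; 0; w])) // (perm_catC [:: 0; w] [:: x; y]).
- apply: (with0 z x y) => //; last exact: symC.
  rewrite (perm_uniq (s2 := [:: x; y; z; 0])) // perm_sym (perm_catC [:: x; y] [:: z; 0]).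
  by rewrite (perm_catCA [:: z] [:: 0] [:: x; y]).
Qed.

(** The coefficients of the binary cubic vanish. If al and be are both
    nonzero, the mixed ones make (al, be) and (ga, de) proportional, whence
    al^3 + ga^3 = 0, which contradicts the coefficient 1 + al^3 + ga^3 of
    s^3. So be = 0 or al = 0, and the rest follows. *)
Lemma fermat_line (al be ga de : K) :
    (forall s t : K, s ^+ 3 + t ^+ 3 + (al * s + be * t) ^+ 3 + (ga * s + de * t) ^+ 3 = 0) ->
  [/\ be = 0, ga = 0, al ^+ 3 = -1 & de ^+ 3 = -1] \/
  [/\ al = 0, de = 0, be ^+ 3 = -1 & ga ^+ 3 = -1].
Proof.
move=> E; have n2 : 2 != 0 :> K := nat_neq0 charK 1; have n3 : 3 != 0 :> K := nat_neq0 charK 2.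
have E10 : 1 + al ^+ 3 + ga ^+ 3 = 0 by rewrite -[RHS](E 1 0); ring.
have E01 : 1 + be ^+ 3 + de ^+ 3 = 0 by rewrite -[RHS](E 0 1); ring.
pose u := al ^+ 2 * be + ga ^+ 2 * de; pose v := al * be ^+ 2 + ga * de ^+ 2.
(* The values at (1, 1) and (1, -1) give the sum and the difference of the
   mixed coefficients u and v. *)
have uv : 3 * (u + v) = 0.
  transitivity ((1 ^+ 3 + 1 ^+ 3 + (al * 1 + be * 1) ^+ 3 + (ga * 1 + de * 1) ^+ 3)
    - (1 + al ^+ 3 + ga ^+ 3) - (1 + be ^+ 3 + de ^+ 3)); first by rewrite /u /v; ring.
  by rewrite E E10 E01 !subr0.
have uv' : 3 * (v - u) = 0.
  transitivity ((1 ^+ 3 + (-1) ^+ 3 + (al * 1 + be * -1) ^+ 3 + (ga * 1 + de * -1) ^+ 3)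
    - (1 + al ^+ 3 + ga ^+ 3) + (1 + be ^+ 3 + de ^+ 3)); first by rewrite /u /v; ring.
  by rewrite E E10 E01 subr0 addr0.
move/eqP: uv; rewrite mulf_eq0 (negbTE n3) /= => /eqP uv.
move/eqP: uv'; rewrite mulf_eq0 (negbTE n3) /= => /eqP uv'.
have v0 : v = 0.
  have : 2 * v = 0 by rewrite -[RHS]addr0 -{1}uv -uv'; ring.
  by move/eqP; rewrite mulf_eq0 (negbTE n2) => /eqP.
have u0 : u = 0 by rewrite -[RHS]uv v0 addr0.
have cube1 (x : K) : 1 + x ^+ 3 = 0 -> x ^+ 3 = -1.
  by move/eqP; rewrite addrC addr_eq0 => /eqP.
have [b0|b0] := eqVneq be 0.
  have d3 : de ^+ 3 = -1 by apply: cube1; rewrite -[RHS]E01 b0; ring.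
  have d0 : de != 0 by apply: contra_eq_neq d3 => ->; rewrite expr0n eq_sym oppr_eq0 oner_eq0.
  have g0 : ga = 0.
    move/eqP: v0; rewrite /v b0 expr0n mulr0 add0r mulf_eq0 expf_eq0 (negbTE d0) orbF.
    by move/eqP.
  by left; split=> //; apply: cube1; rewrite -[RHS]E10 g0; ring.
have [a0|a0] := eqVneq al 0.
  have g3 : ga ^+ 3 = -1 by apply: cube1; rewrite -[RHS]E10 a0; ring.
  have g0 : ga != 0 by apply: contra_eq_neq g3 => ->; rewrite expr0n eq_sym oppr_eq0 oner_eq0.
  have d0 : de = 0.
    move/eqP: u0; rewrite /u a0 expr0n mul0r add0r mulf_eq0 expf_eq0 (negbTE g0).
    by move/eqP.
  by right; split=> //; apply: cube1; rewrite -[RHS]E01 d0; ring.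
exfalso.
have gd0 : ga * de != 0.
  have abE : al ^+ 2 * be = u - ga * (ga * de) by rewrite /u; ring.
  have : al ^+ 2 * be != 0 by rewrite mulf_neq0 ?expf_neq0.
  by apply: contraNneq => gd; rewrite abE u0 gd mulr0 subr0.
have prop : be * ga = al * de.
  have : ga * de * (be * ga - al * de) = 0.
    by transitivity (be * u - al * v); [rewrite /u /v; ring | rewrite u0 v0 !mulr0 subr0].
  by move/eqP; rewrite mulf_eq0 (negbTE gd0) subr_eq0 => /eqP.
have : be * (al ^+ 3 + ga ^+ 3) = 0.
  transitivity (al * u - ga ^+ 2 * (al * de) + ga ^+ 2 * (be * ga)); first by rewrite /u; ring.
  by rewrite u0 prop mulr0 sub0r addNr.
move/eqP; rewrite mulf_eq0 (negbTE b0) /= => /eqP ag.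
by have /eqP := E10; rewrite -addrA ag addr0 oner_eq0.
Qed.

Lemma homog1_expand (p : S) : homdeg 1 p -> p = \sum_i p@_U_(i) *: 'X_i.
Proof.
move=> hp; apply/mpolyP => m; rewrite raddf_sum /=.
have [m0|/hp[/eqP/mdeg1P[i /eqP mE]]] := eqVneq p@_m 0; last first.
  by rewrite mE (bigD1 i) //= mcoeffZ mcoeffXU eqxx mulr1 big1 ?addr0 // => j ji;
     rewrite mcoeffZ mcoeffXU (negbTE ji) mulr0.
rewrite m0 big1 // => i _; rewrite mcoeffZ mcoeffX.
by case: eqP => [iE|]; rewrite ?mulr0 // iE m0 mul0r.
Qed.

Lemma meval_f4 (x : 'I_4 -> K) : (f4 K).@[x] = \sum_i x i ^+ 3.
Proof. by rewrite /f4 raddf_sum; apply: eq_bigr => i _; rewrite /= rmorphXn /= mevalXU. Qed.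

Lemma meval_homog1 (p : S) x : homdeg 1 p -> p.@[x] = \sum_i p@_U_(i) * x i.
Proof.
move=> hp; rewrite {1}(homog1_expand hp) raddf_sum; apply: eq_bigr => i _.
by rewrite /= mevalZ mevalXU.
Qed.

Lemma homog_binomial (x y : 'I_4) (m : K) : homdeg 1 ('X_x - m *: 'X_y : S).
Proof. by apply: homogB; [exact: homogX | apply: homogZ; exact: homogX]. Qed.

Section TwoForms.
Variables (l1 l2 b d : S) (u : K).
Hypotheses (hl1 : homdeg 1 l1) (hl2 : homdeg 1 l2) (u0 : u != 0).
Hypothesis detE : l1 * d - l2 * b = u *: f4 K.

Lemma zero_locus x : l1.@[x] = 0 -> l2.@[x] = 0 -> \sum_i x i ^+ 3 = 0.
Proof.
move=> x1 x2; have := congr1 (meval x) detE.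
rewrite mevalB !mevalM x1 x2 !mul0r subr0 mevalZ meval_f4 => /esym/eqP.
by rewrite mulf_eq0 (negbTE u0) => /eqP.
Qed.

Definition point p q r t (s w y z : K) : 'I_4 -> K := fun i =>
  if i == p then s else if i == q then w else if i == r then y else if i == t then z else 0.

Lemma pointE p q r t s w y z : uniq [:: p; q; r; t] ->
  [/\ point p q r t s w y z p = s, point p q r t s w y z q = w,
      point p q r t s w y z r = y & point p q r t s w y z t = z].
Proof.
rewrite /= !inE !negb_or /point => /and4P[/and3P[pq pr pt] /andP[qr qt] rt _].
have E k l : k != l -> (l == k) = false by rewrite eq_sym => /negbTE.
by rewrite !eqxx (E _ _ _ pq) (E _ _ _ pr) (E _ _ _ pt) (E _ _ _ qr) (E _ _ _ qt) (E _ _ _ rt).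
Qed.

Lemma line_solutions p q r t al be ga de : uniq [:: p; q; r; t] ->
    (forall s w, let x := point p q r t s w (al * s + be * w) (ga * s + de * w) in
      l1.@[x] = 0 /\ l2.@[x] = 0) ->
  [/\ be = 0, ga = 0, al ^+ 3 = -1 & de ^+ 3 = -1] \/
  [/\ al = 0, de = 0, be ^+ 3 = -1 & ga ^+ 3 = -1].
Proof.
move=> un sol; apply: fermat_line => s w; have [x1 x2] := sol s w.
rewrite -[RHS](zero_locus x1 x2) (sum4 _ un).
by have [-> -> -> ->] := pointE s w (al * s + be * w) (ga * s + de * w) un.
Qed.

Let a i := l1@_U_(i).
Let c i := l2@_U_(i).

(** Dependent forms vanish together on a plane. It would lie on the cubic
    surface, and with it a line that [fermat_line] excludes. *)
Lemma independent_forms : exists r t, a r * c t - a t * c r != 0.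
Proof.
apply: contrapT => nex.
have min0 r t : a r * c t = a t * c r.
  by apply/eqP; rewrite -subr_eq0; apply/negPn/negP => ne; apply: nex; exists r, t.
have [la [r [lr la1 la2]]] : exists (la : 'I_4 -> K) r, [/\ la r != 0,
    (forall x, \sum_i la i * x i = 0 -> \sum_i a i * x i = 0) &
    (forall x, \sum_i la i * x i = 0 -> \sum_i c i * x i = 0)].
  have [[r ar]|a0] := pselect (exists r, a r != 0).
    exists a, r; split=> // x ax; apply: (mulfI ar); rewrite mulr0 mulr_sumr.
    transitivity (c r * (\sum_i a i * x i)); last by rewrite ax mulr0.
    rewrite mulr_sumr; apply: eq_bigr => i _.
    by rewrite !mulrA (min0 r i) [a i * c r]mulrC.
  have {}a0 i : a i = 0 by apply/eqP/negPn/negP => ai; apply: a0; exists i.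
  have [[r cr]|c0] := pselect (exists r, c r != 0).
    by exists c, r; split=> // x _; rewrite big1 // => i _; rewrite a0 mul0r.
  have {}c0 i : c i = 0 by apply/eqP/negPn/negP => ci; apply: c0; exists i.
  exists (fun=> 1), 0; split; first exact: oner_neq0.
    by move=> x _; rewrite big1 // => i _; rewrite a0 mul0r.
  by move=> x _; rewrite big1 // => i _; rewrite c0 mul0r.
have [t rt] : exists t : 'I_4, r != t.
  by have [->|r0] := eqVneq r 0; [exists 1 | exists 0].
have [p [q un]] := complete4 rt.
(* The line cut out by x_t = 0 in the plane la = 0. *)
have := @line_solutions p q r t (- la p / la r) (- la q / la r) 0 0 un.
have cub0 : (0 : K) ^+ 3 <> -1.
  by move/eqP; rewrite expr0n eq_sym oppr_eq0 oner_eq0.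
case=> [s w x|[_ _ _ /cub0//]|[_ _ _ /cub0//]].
suff l0 : \sum_i la i * x i = 0 by rewrite !meval_homog1 // la1 // la2.
rewrite (sum4 _ un) /x.
have [-> -> -> ->] := pointE s w (- la p / la r * s + - la q / la r * w) (0 * s + 0 * w) un.
by field.
Qed.

(** Solved for two of the coordinates, the equations l1 = l2 = 0 define a
    line on the cubic surface; by [fermat_line] each of the two coordinates
    is then a multiple of one of the other two by a cube root of -1. *)
Lemma span_contains_line : exists i j s a b (c1 c2 e1 e2 : K),
  [/\ admissible i j s a b, c1 *: l1 + c2 *: l2 = 'X_0 - a *: 'X_s,
      e1 *: l1 + e2 *: l2 = 'X_i - b *: 'X_j & c1 * e2 - c2 * e1 != 0].
Proof.
pose C x y := exists (mu c1 c2 : K), mu ^+ 3 = -1 /\ c1 *: l1 + c2 *: l2 = 'X_x - mu *: 'X_y.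
have symC x y : C x y -> C y x.
  move=> [mu [c1 [c2 [mu3 cE]]]].
  have mu0 : mu != 0 by apply: contra_eq_neq mu3 => ->; rewrite expr0n eq_sym oppr_eq0 oner_eq0.
  exists mu^-1, (- mu^-1 * c1), (- mu^-1 * c2); split.
    by rewrite exprVn mu3 invrN1.
  by rewrite -!scalerA -scalerDr cE scalerBr scalerA mulNr mulVf // !scaleNr scale1r opprK addrC.
have [x [y [z [w [un Cxy Czw]]]]] : exists x y z w : 'I_4, [/\ uniq [:: x; y; z; w], C x y & C z w].
  have [r [t min]] := independent_forms.
  set D := _ - _ in min.
  have rt : r != t by apply: contraNneq min => rt; rewrite /D rt subrr.
  have [p [q un]] := complete4 rt.
  (* Cramer's rule: la and mu have coefficients (1, 0) and (0, 1) at (X_r,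
     X_t). *)
  pose la : S := (c t / D) *: l1 - (a t / D) *: l2.
  pose mu : S := (a r / D) *: l2 - (c r / D) *: l1.
  pose al := - la@_U_(p); pose be := - la@_U_(q); pose ga := - mu@_U_(p); pose de := - mu@_U_(q).
  have laE : la = 'X_r - al *: 'X_p - be *: 'X_q.
    have hla : homdeg 1 la by apply: homogB; apply: homogZ.
    rewrite {1}(homog1_expand hla) (sum4 _ un).
    have -> : la@_U_(r) = 1.
      by rewrite /la mcoeffB !mcoeffZ -/(a r) -/(c r); apply: (mulfI min); rewrite /D in min *; field.
    have -> : la@_U_(t) = 0.
      by rewrite /la mcoeffB !mcoeffZ -/(a t) -/(c t); rewrite /D in min *; field.
    by rewrite scale1r scale0r addr0 /al /be !scaleNr !opprK addrC addrA.
  have muE : mu = 'X_t - ga *: 'X_p - de *: 'X_q.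
    have hmu : homdeg 1 mu by apply: homogB; apply: homogZ.
    rewrite {1}(homog1_expand hmu) (sum4 _ un).
    have -> : mu@_U_(t) = 1.
      by rewrite /mu mcoeffB !mcoeffZ -/(a t) -/(c t); rewrite /D in min *; field.
    have -> : mu@_U_(r) = 0.
      by rewrite /mu mcoeffB !mcoeffZ -/(a r) -/(c r); rewrite /D in min *; field.
    by rewrite scale1r scale0r addr0 /ga /de !scaleNr !opprK addrC addrA.
  have comb x y : x *: la + y *: mu
      = ((x * c t - y * c r) / D) *: l1 + ((y * a r - x * a t) / D) *: l2.
    rewrite /la /mu !scalerBr !scalerA addrACA -!scaleNr [- _ *: l2 + _]addrC addrACA.
    by rewrite -!scalerDl; congr (_ *: _ + _ *: _); ring.
  have l1E : l1 = a r *: la + a t *: mu.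
    by rewrite comb divff // [a t * a r]mulrC subrr mul0r scale0r scale1r addr0.
  have l2E : l2 = c r *: la + c t *: mu.
    rewrite comb [c r * c t]mulrC subrr mul0r scale0r add0r.
    by rewrite [c t * _]mulrC [c r * _]mulrC divff // scale1r.
  have Crp x y nu : 'X_x - nu *: 'X_y = la \/ 'X_x - nu *: 'X_y = mu -> nu ^+ 3 = -1 -> C x y.
    move=> E nu3; exists nu; case: E => ->.
      by exists (c t / D), (- (a t / D)); rewrite scaleNr.
    by exists (- (c r / D)), (a r / D); rewrite scaleNr addrC.
  have [s w x|[b0 g0 a3 d3]|[a0 d0 b3 g3]] := @line_solutions p q r t al be ga de un.
  - have [pp pq pr pt] := pointE s w (al * s + be * w) (ga * s + de * w) un.
    have la0 : la.@[x] = 0.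
      by rewrite laE !mevalB !mevalZ !mevalXU /x pp pq pr; ring.
    have mu0 : mu.@[x] = 0.
      by rewrite muE !mevalB !mevalZ !mevalXU /x pp pq pt; ring.
    by rewrite l1E l2E !mevalD !mevalZ la0 mu0 !mulr0 addr0.
  - exists r, p, t, q; split.
    + rewrite (perm_uniq (s2 := [:: p; q; r; t])) // perm_sym (perm_catCA [:: p; q] [:: r] [:: t]).
      by rewrite perm_cons perm_cons (perm_catC [:: q] [:: t]).
    + by apply: (Crp _ _ al) => //; left; rewrite laE b0 scale0r subr0.
    + by apply: (Crp _ _ de) => //; right; rewrite muE g0 scale0r subr0.
  - exists r, q, t, p; split.
    + rewrite (perm_uniq (s2 := [:: p; q; r; t])) // perm_sym (perm_catCA [:: p; q] [:: r] [:: t]).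
      by rewrite perm_cons (perm_catC [:: p] [:: q; t]).
    + by apply: (Crp _ _ be) => //; left; rewrite laE a0 scale0r subr0.
    + by apply: (Crp _ _ ga) => //; right; rewrite muE d0 scale0r subr0.
have [i [j [s [ij ijs [al [c1 [c2 [al3 cE]]]] [be [e1 [e2 [be3 eE]]]]]]]] :=
  normalize_pairs symC un Cxy Czw.
exists i, j, s, al, be, c1, c2, e1, e2; split=> //.
have un' := set3_uniq ijs ij.
apply/eqP => det0.
set L1 := 'X_0 - _ in cE; set L2 := 'X_i - _ in eE.
move: un'; rewrite /= !inE !negb_or => /and4P[/and3P[s0 i0 j0] /andP[si sj] ijn _].
have L1_0 : L1@_U_(0) = 1.
  by rewrite /L1 mcoeffB mcoeffZ !mcoeffXU eqxx eq_sym (negbTE s0) mulr0 subr0.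
have L1_i : L1@_U_(i) = 0.
  by rewrite /L1 mcoeffB mcoeffZ !mcoeffXU (negbTE i0) (negbTE si) mulr0 subr0.
have L2_0 : L2@_U_(0) = 0.
  by rewrite /L2 mcoeffB mcoeffZ !mcoeffXU ![_ == 0]eq_sym (negbTE i0) (negbTE j0) mulr0 subr0.
have L2_i : L2@_U_(i) = 1.
  by rewrite /L2 mcoeffB mcoeffZ !mcoeffXU eqxx [j == i]eq_sym (negbTE ijn) mulr0 subr0.
have indep (x1 y1 : K) : x1 *: L1 + y1 *: L2 = 0 -> x1 = 0 /\ y1 = 0.
  move=> xy; split.
    by have := congr1 (mcoeff U_(0)) xy; rewrite mcoeffD !mcoeffZ L1_0 L2_0 mcoeff0 mulr0 mulr1 addr0.
  by have := congr1 (mcoeff U_(i)) xy; rewrite mcoeffD !mcoeffZ L1_i L2_i mcoeff0 mulr0 mulr1 add0r.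
have combL (x1 y1 : K) : x1 *: L1 + y1 *: L2
    = (x1 * c1 + y1 * e1) *: l1 + (x1 * c2 + y1 * e2) *: l2.
  by rewrite -cE -eE !scalerDr !scalerA addrACA -!scalerDl.
have [e10 _] : - e1 = 0 /\ c1 = 0.
  apply: indep; rewrite combL (_ : - e1 * c1 + c1 * e1 = 0); last by ring.
  by rewrite (_ : - e1 * c2 + c1 * e2 = 0) ?scale0r ?addr0 // -[RHS]det0; ring.
have [e20 _] : e2 = 0 /\ - c2 = 0.
  apply: indep; rewrite combL (_ : e2 * c2 + - c2 * e2 = 0); last by ring.
  by rewrite (_ : e2 * c1 + - c2 * e1 = 0) ?scale0r ?addr0 // -[RHS]det0; ring.
have /eqP := L2_i; rewrite -eE e20; move/eqP: e10; rewrite oppr_eq0 => /eqP->.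
by rewrite !scale0r addr0 mcoeff0 eq_sym oner_eq0.
Qed.

End TwoForms.
End Lines.

(** * Homogeneous 2 x 2 matrices with determinant the Fermat cubic *)

Section Mat2.
Variable K : closedFieldType.
Notation S := {mpoly K[4]}.

Lemma ord2P (i : 'I_2) : i = 0 \/ i = 1.
Proof. by case: i => [[|[|//]] ?]; [left | right]; apply/val_inj. Qed.

Lemma mat2P (A B : 'M[S]_2) : A 0 0 = B 0 0 -> A 0 1 = B 0 1 -> A 1 0 = B 1 0 ->
  A 1 1 = B 1 1 -> A = B.
Proof.
move=> e00 e01 e10 e11; apply/matrixP => i j.
by have [->|->] := ord2P i; have [->|->] := ord2P j.
Qed.

Lemma mat2E (A : 'M[S]_2) : A = mat2 (A 0 0) (A 0 1) (A 1 0) (A 1 1).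
Proof. by apply: mat2P; rewrite mxE. Qed.

Lemma mul_mat2 (a b c d a' b' c' d' : S) : mat2 a b c d *m mat2 a' b' c' d' =
  mat2 (a * a' + b * c') (a * b' + b * d') (c * a' + d * c') (c * b' + d * d').
Proof. by apply: mat2P; rewrite !mxE !big_ord_recl big_ord0 !mxE /= addr0. Qed.

Lemma det_mat2 (a b c d : S) : \det (mat2 a b c d) = a * d - b * c.
Proof.
rewrite (expand_det_row _ 0) !big_ord_recl big_ord0 /cofactor !mxE /= !det_mx11 !mxE /=.
by rewrite !addr0 !expr0 mul1r expr1 mulN1r mulrN.
Qed.

Lemma tr_mat2 (a b c d : S) : (mat2 a b c d)^T = mat2 a c b d.
Proof. by apply: mat2P; rewrite !mxE. Qed.

Lemma scalar_mat2 (f : S) : f%:M = mat2 f 0 0 f.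
Proof. by apply: mat2P; rewrite !mxE. Qed.

Definition mx_equiv (A B : 'M[S]_2) := exists P Q, [/\ P \in unitmx, Q \in unitmx & B = P *m A *m Q].

Lemma mx_equiv_trans A B C : mx_equiv A B -> mx_equiv B C -> mx_equiv A C.
Proof.
move=> [P [Q [uP uQ ->]]] [P' [Q' [uP' uQ' ->]]]; exists (P' *m P), (Q *m Q').
by rewrite !unitmx_mul uP uQ uP' uQ' !mulmxA.
Qed.

Lemma mx_equiv_tr A B : mx_equiv A B -> mx_equiv A^T B^T.
Proof.
move=> [P [Q [uP uQ ->]]]; exists Q^T, P^T.
by rewrite !unitmx_tr uP uQ !trmx_mul mulmxA.
Qed.

Lemma unit_const (c : K) : c != 0 -> c%:MP_[4] \is a GRing.unit.
Proof. by move=> c0; apply: (rmorph_unit (@mpolyC 4 K)); rewrite unitfE. Qed.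

End Mat2.

Section Classify.
Variable K : closedFieldType.
Hypothesis charK : [pchar K] =i pred0.
Notation S := {mpoly K[4]}.
Notation f := (f4 K).

Lemma f4_neq0 : f != 0.
Proof.
apply/eqP => /(congr1 (meval (fun i : 'I_4 => if i == 0 then 1 else 0))).
rewrite meval0 meval_f4 (bigD1 0) //= expr1n big1 ?addr0 => [/eqP|i /negbTE->]; last by rewrite expr0n.
by rewrite oner_eq0.
Qed.

Lemma f4_homog : homdeg 3 f.
Proof. by apply: homog_sum => i _; exact: (@homogXn _ _ 1 _ 3 (@homogX _ _ i)). Qed.

Lemma f4_const : f@_0%MM = 0.
Proof. exact: (homog_coef0 f4_homog). Qed.

Lemma f4E (i j s : 'I_4) : [set i; j; s]%SET = [set~ 0]%SET -> (i < j)%N ->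
  f = 'X_0 ^+ 3 + 'X_s ^+ 3 + 'X_i ^+ 3 + 'X_j ^+ 3.
Proof. by move=> ijs ij; rewrite /f4 (sum4 _ (set3_uniq ijs ij)). Qed.

Lemma phi_psi i j s a b : admissible i j s a b ->
  [/\ phi i j s a b *m psi i j s a b = f%:M, psi i j s a b *m phi i j s a b = f%:M
    & \det (phi i j s a b) = f /\ \det (psi i j s a b) = f].
Proof.
move=> [ij ijs a3 b3].
have fE : f = ('X_0 - a *: 'X_s) * ('X_0 ^+ 2 + a *: ('X_0 * 'X_s) + a ^+ 2 *: 'X_s ^+ 2)
    + ('X_i - b *: 'X_j) * ('X_i ^+ 2 + b *: ('X_i * 'X_j) + b ^+ 2 *: 'X_j ^+ 2).
  have C3 (c : K) : c ^+ 3 = -1 -> c%:MP_[4] ^+ 3 = -1.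
    by move=> c3; rewrite -rmorphXn c3 rmorphN rmorph1.
  rewrite (f4E ijs ij) -!mul_mpolyC !rmorphXn /=.
  move: (C3 a a3) (C3 b b3) => {a3 b3}.
  move: (a%:MP_[4]) (b%:MP_[4]) ('X_0 : S) ('X_i : S) ('X_j : S) ('X_s : S) => A B X Y Z W A3 B3.
  transitivity (X ^+ 3 - A ^+ 3 * W ^+ 3 + (Y ^+ 3 - B ^+ 3 * Z ^+ 3)).
    by rewrite A3 B3; ring.
  by ring.
rewrite /phi /psi !mul_mat2 !det_mat2 scalar_mat2 {ijs ij a3 b3}.
move: fE; move: ('X_0 - _) ('X_0 ^+ 2 + _ + _) ('X_i - _) ('X_i ^+ 2 + _ + _) => A B C D ->.
by split; [congr mat2; ring | congr mat2; ring | split; ring].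
Qed.

(** Since f is prime, it divides one of the two factors; then u is a
    multiple of the other. *)
Lemma irrelevant_prod_multiple (x y : S) u : x@_0%MM = 0 -> y@_0%MM = 0 -> x * y = u * f ->
  u@_0%MM = 0.
Proof.
move=> x0 y0 xy; have fM (v w : S) : v * f * w = u * f -> u = v * w.
  by move=> E; apply: (mulIf f4_neq0); rewrite -E mulrAC.
have [|[v xE]|[v yE]] := f4_prime charK (p := x) (q := y); first by exists u.
  have -> : u = v * y by apply: fM; rewrite -xE.
  by rewrite (rmorphM (mcoeff 0%MM)) /= y0 mulr0.
have -> : u = v * x by apply: fM; rewrite -yE mulrC.
by rewrite (rmorphM (mcoeff 0%MM)) /= x0 mulr0.
Qed.

(** The ideal of X_0 - a X_s is the kernel of the substitution of a X_s for
    X_0, which does not kill X_i - b X_j. *)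
Lemma dvd_linear_form (i j s : 'I_4) (a b : K) (h g : S) : uniq [:: 0; s; i; j] ->
    ('X_0 - a *: 'X_s) * g = ('X_i - b *: 'X_j) * h ->
  exists k, h = k * ('X_0 - a *: 'X_s).
Proof.
rewrite /= !inE !negb_or => /and4P[/and3P[s0 i0 j0] _ ij _] E.
pose sg (k : 'I_4) : S := if k == 0 then a *: 'X_s else 'X_k.
pose J (p : S^o) := exists k : S, p = k * ('X_0 - a *: 'X_s).
have sJ : submod J.
  split; first by exists 0; rewrite mul0r.
  by move=> c _ _ [x ->] [y ->]; exists (c * x + y); rewrite mulrDl -mulrA.
have cong p : J (p - subst sg p).
  apply: subst_cong => // k; rewrite /sg; case: eqP => [->|_].
    by exists 1; rewrite mul1r.
  by exists 0; rewrite subrr mul0r.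
have sg0 k : 0 != k -> subst sg 'X_k = 'X_k.
  by move=> k0; rewrite substX /sg eq_sym (negbTE k0).
have sgh : subst sg h = 0.
  have := congr1 (subst sg) E; rewrite !rmorphM !rmorphB /= !substZ.
  rewrite (sg0 _ s0) (sg0 _ i0) (sg0 _ j0) substX /sg eqxx subrr mul0r => /esym/eqP.
  rewrite mulf_eq0 => /orP[|/eqP//] /eqP /(congr1 (mcoeff U_(i))).
  rewrite mcoeffB mcoeffZ !mcoeffXU eqxx [j == i]eq_sym (negbTE ij) mulr0 subr0 mcoeff0.
  by move/eqP; rewrite oner_eq0.
by have := cong h; rewrite sgh subr0.
Qed.

Lemma clear_column (L1 L2 Q1 Q2 g v w : S) : v * w = 1 ->
  mat2 L1 (- Q1) L2 Q2 =
  mat2 L1 (- (v * Q1) + g * L1) L2 (v * Q2 + g * L2) *m mat2 1 (- (g * w)) 0 w.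
Proof.
move=> vw; rewrite mul_mat2; congr mat2.
- by ring.
- by transitivity (- (v * w * Q1)); [rewrite vw mul1r | ring].
- by ring.
- by transitivity (v * w * Q2); [rewrite vw mul1r | ring].
Qed.

(** Row operations turn the first column into that of some phi. The second
    columns then have proportional determinants against (L1, L2), so up to a
    constant they differ by a syzygy of (L1, L2), which is a multiple of the
    first column because L1, L2 is a regular sequence. *)
Lemma column_mx_equiv (l1 l2 b d : S) (u : K) : homdeg 1 l1 -> homdeg 1 l2 -> u != 0 ->
  l1 * d - b * l2 = u *: f -> exists B, famM B /\ mx_equiv (mat2 l1 b l2 d) B.
Proof.
move=> hl1 hl2 u0 detE; have detE' : l1 * d - l2 * b = u *: f by rewrite -detE (mulrC l2).
have [i [j [s [al [be [c1 [c2 [e1 [e2 [adm cE eE det0]]]]]]]]]] :=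
  span_contains_line charK hl1 hl2 u0 detE'.
exists (phi i j s al be); split; first by exists i, j, s, al, be.
have [_ _ [detphi _]] := phi_psi adm; have [ij ijs _ _] := adm.
have un := set3_uniq ijs ij.
move: detphi; rewrite /phi det_mat2.
set L1 := 'X_0 - _ in cE *; set L2 := 'X_i - _ in eE *.
set Q2 := 'X_0 ^+ 2 + _ + _; set Q1 := 'X_i ^+ 2 + _ + _ => detphi.
pose P : 'M[S]_2 := mat2 c1%:MP c2%:MP e1%:MP e2%:MP.
have uP : P \in unitmx.
  by rewrite unitmxE /P det_mat2 -!rmorphM -rmorphB unit_const.
pose v := u * (c1 * e2 - c2 * e1).
have v0 : v != 0 by rewrite mulf_neq0.
pose b' := c1 *: b + c2 *: d; pose d' := e1 *: b + e2 *: d.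
have PA : P *m mat2 l1 b l2 d = mat2 L1 b' L2 d'.
  by rewrite /P mul_mat2 !mul_mpolyC cE eE.
have det' : L1 * d' - b' * L2 = v *: f.
  have := det_mulmx P (mat2 l1 b l2 d); rewrite PA !det_mat2 detE => ->.
  by rewrite -!rmorphM -rmorphB mul_mpolyC scalerA mulrC.
(* Both columns have determinant v f against (L1, L2). *)
have E : L1 * (d' - v *: Q2) = L2 * (b' + v *: Q1).
  move: det'; rewrite -detphi -!mul_mpolyC mulNr opprK => det'.
  apply/eqP; rewrite -subr_eq0; apply/eqP.
  transitivity (L1 * d' - b' * L2 - v%:MP * (L1 * Q2 + Q1 * L2)); first by ring.
  by rewrite det' subrr.
have [g] := dvd_linear_form un E; rewrite -/L1 => gE.
have L10 : L1 != 0.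
  apply/eqP => L0; have := congr1 (mcoeff U_(0)) L0.
  rewrite /L1 mcoeffB mcoeffZ !mcoeffXU eqxx mcoeff0; move: un.
  rewrite /= inE => /andP[/norP[s0 _] _].
  by rewrite [s == 0]eq_sym (negbTE s0) mulr0 subr0 => /eqP; rewrite oner_eq0.
have dE : d' = v *: Q2 + g * L2.
  apply: (mulfI L10); transitivity (L1 * (d' - v *: Q2) + L1 * (v *: Q2)).
    by rewrite -mulrDr subrK.
  by rewrite E gE; move: (v *: Q2) => w; ring.
have bE : b' = - (v *: Q1) + g * L1 by rewrite -gE addrC addrK.
pose Q : 'M[S]_2 := mat2 1 (- (g * v^-1%:MP)) 0 v^-1%:MP.
have uQ : Q \in unitmx.
  by rewrite unitmxE /Q det_mat2 mul1r mulr0 subr0 unit_const // invr_eq0.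
exists P, Q; split; [exact: uP | exact: uQ |].
rewrite PA dE bE -!mul_mpolyC; apply: clear_column.
by rewrite -rmorphM divff // rmorph1.
Qed.

Lemma phi_tr_psi i j s (a b : K) : mx_equiv (phi i j s a b)^T (psi i j s a b).
Proof.
exists (mat2 0 1 (-1) 0), (mat2 0 (-1) 1 0); split.
- by rewrite unitmxE det_mat2 mul0r sub0r mulrN1 opprK unitr1.
- by rewrite unitmxE det_mat2 mul0r sub0r mulN1r opprK unitr1.
- by rewrite /phi /psi tr_mat2 !mul_mat2; congr mat2; ring.
Qed.

Lemma swap_cols (a b c d : S) : mx_equiv (mat2 a b c d) (mat2 b (- a) d (- c)).
Proof.
exists 1%:M, (mat2 0 (-1) 1 0); split; first exact: unitmx1.
- by rewrite unitmxE det_mat2 mul0r sub0r mulN1r opprK unitr1.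
- by rewrite mul1mx mul_mat2; congr mat2; ring.
Qed.

(** No entry vanishes: otherwise f would be, up to a constant, a product of
    two elements of the irrelevant ideal. Hence all entries have positive
    degree, and the degrees on either diagonal add up to 3, which leaves a
    row or a column of linear forms. Transposition and exchange of rows or
    columns bring all cases back to a first column of linear forms. *)
Lemma classify_matrix (A : 'M[S]_2) (c d : 'I_2 -> int) (u : S) :
    (forall i j, homdeg (c j - d i) (A i j)) -> (forall i j, (A i j)@_0%MM = 0) ->
    u \is a GRing.unit -> \det A = u * f ->
  exists B, (famM B \/ famN B) /\ mx_equiv A B.
Proof.
move=> hA A0 uu detA.
have [w w0 uE] : exists2 w, w != 0 & u = w%:MP.
  have := uu; rewrite -[_ \is a _]/(mpoly_unit u) => /andP[/eqP uE u0].
  by exists u@_0%MM; rewrite // -unitfE.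
have {uE}detA : \det A = w *: f by rewrite detA uE mul_mpolyC.
have u0 : u@_0%MM != 0.
  by have := uu; rewrite -[_ \is a _]/(mpoly_unit u) => /andP[_]; rewrite unitfE.
have nprod (x y : S) : x@_0%MM = 0 -> y@_0%MM = 0 -> x * y <> w *: f.
  move=> x0 y0 /esym; rewrite -mul_mpolyC => /esym/(irrelevant_prod_multiple x0 y0).
  by rewrite mcoeffC eqxx mulr1 => /eqP; rewrite (negbTE w0).
have detE : A 0 0 * A 1 1 - A 0 1 * A 1 0 = w *: f by rewrite -detA [A in RHS]mat2E det_mat2.
have [nz00 nz11] : A 0 0 != 0 /\ A 1 1 != 0.
  apply/andP; rewrite -negb_or -mulf_eq0; apply/eqP => E.
  by apply: (@nprod (- A 0 1) (A 1 0)); rewrite ?mcoeffN ?A0 ?oppr0 // -detE E sub0r mulNr.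
have [nz01 nz10] : A 0 1 != 0 /\ A 1 0 != 0.
  apply/andP; rewrite -negb_or -mulf_eq0; apply/eqP => E.
  by apply: (@nprod (A 0 0) (A 1 1)); rewrite ?A0 // -detE E subr0.
have pos i j : A i j != 0 -> 1 <= c j - d i.
  move=> nz; have [lt|le|E] := ltgtP (c j - d i) 0.
  - by case/eqP: nz; apply: (homog_neg (hA i j)).
  - by [].
  - by case/eqP: nz; have := hA i j; rewrite E => /homog_const->; rewrite A0 rmorph0.
have := pos _ _ nz00; have := pos _ _ nz01; have := pos _ _ nz10; have := pos _ _ nz11.
have tot : c 0 + c 1 - d 0 - d 1 = 3.
  apply: (@homog_uniq _ _ _ _ (w *: f)); last exact/homogZ/f4_homog.
    by rewrite -mul_mpolyC mulf_neq0 ?mpolyC_eq0 ?f4_neq0.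
  rewrite -detE; apply: homogB.
    by have := homogM (hA 0 0) (hA 1 1); rewrite (_ : _ + _ = c 0 + c 1 - d 0 - d 1); last by ring.
  by have := homogM (hA 0 1) (hA 1 0); rewrite (_ : _ + _ = c 0 + c 1 - d 0 - d 1); last by ring.
move=> p11 p10 p01 p00.
have col (a b c' d' : S) : homdeg 1 a -> homdeg 1 c' -> a * d' - b * c' = w *: f ->
    exists B, (famM B \/ famN B) /\ mx_equiv (mat2 a b c' d') B.
  move=> ha hcomp E; have [B [fB eB]] := column_mx_equiv ha hcomp w0 E.
  by exists B; split; [left | exact: eB].
have col' (a b c' d' : S) : homdeg 1 b -> homdeg 1 d' -> a * d' - b * c' = w *: f ->
    exists B, (famM B \/ famN B) /\ mx_equiv (mat2 a b c' d') B.
  move=> hb hd E; have [|B [fB eB]] := col b (- a) d' (- c') hb hd.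
    by rewrite -E; ring.
  by exists B; split; [exact: fB | exact: (mx_equiv_trans (swap_cols a b c' d') eB)].
have row (a b c' d' : S) : homdeg 1 a -> homdeg 1 b -> a * d' - b * c' = w *: f ->
    exists B, (famM B \/ famN B) /\ mx_equiv (mat2 a b c' d') B.
  move=> ha hb E; have [|B [[i [j [s [x [y [adm BE]]]]]] eB]] := column_mx_equiv (b := c') (d := d') ha hb w0.
    by rewrite -E; ring.
  exists (psi i j s x y); split; first by right; exists i, j, s, x, y.
  move: (mx_equiv_tr eB); rewrite tr_mat2 BE => eB'.
  exact: (mx_equiv_trans eB' (phi_tr_psi i j s x y)).
have row' (a b c' d' : S) : homdeg 1 c' -> homdeg 1 d' -> a * d' - b * c' = w *: f ->
    exists B, (famM B \/ famN B) /\ mx_equiv (mat2 a b c' d') B.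
  move=> hcomp hd E; have [|B [fB eB]] := row c' d' (- a) (- b) hcomp hd.
    by rewrite -E; ring.
  exists B; split; first exact: fB.
  suff e1 : mx_equiv (mat2 a b c' d') (mat2 c' d' (- a) (- b)) by exact: (mx_equiv_trans e1 eB).
  exists (mat2 0 1 (-1) 0), 1%:M; split.
  - by rewrite unitmxE det_mat2 mul0r sub0r mulrN1 opprK unitr1.
  - exact: unitmx1.
  - by rewrite mulmx1 mul_mat2; congr mat2; ring.
rewrite [A]mat2E.
have [d00|d00] : c 0 - d 0 = 1 \/ c 1 - d 1 = 1 by lia.
- have [d01|d10] : c 1 - d 0 = 1 \/ c 0 - d 1 = 1 by lia.
  + by apply: row => //; [rewrite -d00|rewrite -d01]; exact: hA.
  + by apply: col => //; [rewrite -d00|rewrite -d10]; exact: hA.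
- have [d01|d10] : c 1 - d 0 = 1 \/ c 0 - d 1 = 1 by lia.
  + by apply: col' => //; [rewrite -d01|rewrite -d00]; exact: hA.
  + by apply: row' => //; [rewrite -d10|rewrite -d00]; exact: hA.
Qed.

End Classify.

(** * Minimal homogeneous generators *)

Section Comb.
Variables (R : comNzRingType) (V : lmodType R).

Definition comb n (h : 'I_n -> V) (c : 'cV[R]_n) : V := \sum_i c i 0 *: h i.

Lemma comb_is_linear n (h : 'I_n -> V) : linear (comb h).
Proof.
move=> a x y; rewrite /comb scaler_sumr -big_split; apply: eq_bigr => i _.
by rewrite !mxE scalerDl scalerA.
Qed.
HB.instance Definition _ n h := GRing.isLinear.Build R _ _ _ (@comb n h) (@comb_is_linear n h).

Lemma comb_delta n (h : 'I_n -> V) i : comb h (delta_mx i 0) = h i.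
Proof.
rewrite /comb (bigD1 i) //= mxE !eqxx scale1r big1 ?addr0 // => j ji.
by rewrite mxE (negbTE ji) scale0r.
Qed.

Lemma comb_mulmx m n (h : 'I_m -> V) (A : 'M[R]_(m, n)) c :
  comb h (A *m c) = comb (fun j => comb h (col j A)) c.
Proof.
rewrite /comb; under [RHS]eq_bigr => j _ do rewrite scaler_sumr.
rewrite exchange_big; apply: eq_bigr => i _; rewrite mxE scaler_suml.
by apply: eq_bigr => j _; rewrite mxE scalerA mulrC.
Qed.

Lemma submod_comb n (h : 'I_n -> V) : submod (fun x => exists c, x = comb h c).
Proof.
split; first by exists 0; rewrite linear0.
by move=> a _ _ [c ->] [c' ->]; exists (a *: c + c'); rewrite linearP.
Qed.

(** Same encoding as in [noetherian]. *)
Definition fin_gen (Z : V -> Prop) := exists s : seq V, (forall x, x \in s -> Z x) /\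
  forall J : V -> Prop, submod J -> (forall x, x \in s -> J x) -> forall x, Z x -> J x.

End Comb.

Section Graded.
Variable K : fieldType.
Variable r : nat.
Notation S := {mpoly K[r]}.
Variables (V : lmodType S) (G : int -> V -> Prop).
Hypothesis grG : grading (@homdeg K r) G.

Let G0 d : G d 0. Proof. by case: grG. Qed.
Let GB d x y : G d x -> G d y -> G d (x - y). Proof. by case: grG => _ + _ _ _; apply. Qed.
Let GZ e d p x : homdeg e p -> G d x -> G (e + d) (p *: x). Proof. by case: grG => _ _ + _ _; apply. Qed.

Lemma gradedD d x y : G d x -> G d y -> G d (x + y).
Proof. by move=> Gx Gy; rewrite -[y]opprK -[- y]sub0r; do !apply: GB. Qed.

Lemma graded_sum d (I : Type) (s : seq I) (P : pred I) (F : I -> V) :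
  (forall i, P i -> G d (F i)) -> G d (\sum_(i <- s | P i) F i).
Proof. by move=> GF; apply: big_ind => //; exact: gradedD. Qed.

Lemma graded_uniq_decomp x : exists (s : seq int) (c : int -> V),
  [/\ uniq s, forall d, G d (c d) & x = \sum_(d <- s) c d].
Proof.
have [_ _ _ /(_ x)[s [c [Gc xE]]] _] := grG.
exists (undup s), (fun d => c d *+ count_mem d s); split; first exact: undup_uniq.
  move=> d; elim: (count_mem d s) => [|k IHk]; first by rewrite mulr0n.
  by rewrite mulrS; apply: gradedD.
by rewrite xE -big_undup_iterop_count; apply: eq_bigr.
Qed.

Lemma sum_hcomp (p : S) (d : int) (T : seq int) : uniq T ->
    (forall m, p@_m != 0 -> Posz (mdeg m) + d \in T) ->
  \sum_(e <- T) hcomp (e - d) p = p.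
Proof.
move=> uT pT; apply/mpolyP => m; rewrite raddf_sum /=.
have E e : (hcomp (e - d) p)@_m = if e == Posz (mdeg m) + d then p@_m else 0.
  by rewrite mcoeff_hcomp eq_sym subr_eq.
have [pm|/pT mT] := eqVneq p@_m 0.
  by rewrite pm big1 // => e _; rewrite E pm if_same.
rewrite (bigD1_seq _ mT uT) /= E eqxx big1 ?addr0 // => e /negbTE ne.
by rewrite E ne.
Qed.

(** Homogeneous elements are related in each degree separately. *)
Lemma comb_component n (h : 'I_n -> V) (d : 'I_n -> int) c e :
    (forall j, G (d j) (h j)) -> comb h c = 0 ->
  comb h (\col_j hcomp (e - d j) (c j 0)) = 0.
Proof.
move=> Gh c0.
pose T := undup (flatten [seq [seq Posz (mdeg m) + d j | m <- msupp (c j 0)] | j <- enum 'I_n]).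
have inT j m : (c j 0)@_m != 0 -> Posz (mdeg m) + d j \in T.
  rewrite -mcoeff_msupp mem_undup => cm; apply/flatten_mapP; exists j; first exact: mem_enum.
  by apply/mapP; exists m.
pose y e := comb h (\col_j hcomp (e - d j) (c j 0)).
have yE x : y x = \sum_j hcomp (x - d j) (c j 0) *: h j.
  by apply: eq_bigr => j _; rewrite mxE.
have Gy x : G x (y x).
  rewrite yE; apply: graded_sum => j _; rewrite -[X in G X](subrK (d j)).
  by apply: GZ => //; exact: homog_hcomp.
have sum0 : \sum_(x <- T) y x = 0.
  rewrite -[RHS]c0; under eq_bigr do rewrite yE.
  rewrite exchange_big; apply: eq_bigr => j _; rewrite -scaler_suml; congr (_ *: _).
  by apply: sum_hcomp (undup_uniq _) _; exact: inT.
have [_ _ _ _ dirG] := grG.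
have [eT|eT] := boolP (e \in T); first exact: (dirG T y (undup_uniq _) Gy sum0).
rewrite -/(y e) yE big1 // => j _; suff -> : hcomp (e - d j) (c j 0) = 0 by rewrite scale0r.
apply/mpolyP => m; rewrite mcoeff_hcomp mcoeff0; case: eqP => // mE.
by apply/eqP; apply: contraNT eT => /inT; rewrite mE subrK.
Qed.

Variable Z : V -> Prop.
Hypothesis gZ : forall (s : seq int) (c : int -> V), uniq s -> (forall d, G d (c d)) ->
  Z (\sum_(d <- s) c d) -> forall d, d \in s -> Z (c d).

Lemma homog_gens : fin_gen Z -> exists n (h : 'I_n -> V) (d : 'I_n -> int),
  [/\ forall i, G (d i) (h i), forall i, Z (h i) & forall x, Z x -> exists c, x = comb h c].
Proof.
move=> [s [sZs gen]].
have [L [LG LZ Lgen]] : exists L : seq (int * V), [/\ forall p, p \in L -> G p.1 p.2,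
    forall p, p \in L -> Z p.2 & forall J : V -> Prop, submod J ->
      (forall p, p \in L -> J p.2) -> forall x, x \in s -> J x].
  elim: s sZs {gen} => [_|x s IHs xsZ]; first by exists [::].
  have [L [LG LZ Lgen]] : exists L : seq (int * V), [/\ forall p, p \in L -> G p.1 p.2,
    forall p, p \in L -> Z p.2 & forall J : V -> Prop, submod J ->
      (forall p, p \in L -> J p.2) -> forall x, x \in s -> J x].
    by apply: IHs => y ys; apply: xsZ; rewrite inE ys orbT.
  have [t [c [ut Gc xE]]] := graded_uniq_decomp x.
  have Zx : Z x by apply: xsZ; rewrite inE eqxx.
  exists ([seq (d, c d) | d <- t] ++ L); split.
  - by move=> p; rewrite mem_cat => /orP[/mapP[d _ ->]|/LG]//=.
  - move=> p; rewrite mem_cat => /orP[/mapP[d dt ->]|/LZ]//=.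
    by apply: (gZ ut Gc) => //; rewrite -xE.
  - move=> J sJ JL y; rewrite inE => /orP[/eqP->|]; last first.
      by apply: Lgen => // p pL; apply: JL; rewrite mem_cat pL orbT.
    rewrite xE big_seq; apply: submod_sum => // d dt.
    by apply: (JL (d, c d)); rewrite mem_cat map_f.
exists (size L), (fun i => (tnth (in_tuple L) i).2), (fun i => (tnth (in_tuple L) i).1).
split=> [i|i|]; [exact/LG/mem_tnth | exact/LZ/mem_tnth |].
move=> x Zx; apply: (gen _ (submod_comb _)) => // {x Zx}; apply: Lgen; first exact: submod_comb.
move=> p pL; have [i ->] : exists i, p = tnth (in_tuple L) i by apply/tnthP.
by exists (delta_mx i 0); rewrite comb_delta.
Qed.

(** In a homogeneous generating system of least size, a relation with a
    nonzero constant coefficient would have a homogeneous component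
    expressing one generator by the others. *)
Lemma min_homog_gens : fin_gen Z -> exists n (h : 'I_n -> V) (d : 'I_n -> int),
  [/\ forall i, G (d i) (h i), forall i, Z (h i), forall x, Z x -> exists c, x = comb h c
    & forall c, comb h c = 0 -> forall i, (c i 0)@_0%MM = 0].
Proof.
move=> fgZ.
pose HG n := exists (h : 'I_n -> V) (d : 'I_n -> int),
  [/\ forall i, G (d i) (h i), forall i, Z (h i) & forall x, Z x -> exists c, x = comb h c].
have exHG : exists n, `[< HG n >].
  by have [n HGn] := homog_gens fgZ; exists n; apply/asboolP.
case: (ex_minnP exHG) => n /asboolP[h [d [Gh Zh gen]]] minn.
exists n, h, d; split=> // c c0 i; apply/eqP; apply: contraT => ci.
case: n h d Gh Zh gen c c0 i ci minn => [|n] h d Gh Zh gen c c0 i ci minn; first by have := ltn_ord i.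
suff /asboolP/minn : HG n by rewrite ltnn.
exists (h \o lift i), (d \o lift i); split=> [j|j|x Zx]; [exact: Gh|exact: Zh|].
pose J x := exists c, x = comb (h \o lift i) c.
have sJ : submod J by exact: submod_comb.
have Jl j : J (h (lift i j)) by exists (delta_mx j 0); rewrite comb_delta.
have Ji : J (h i).
  have := comb_component (d i) Gh c0; rewrite /comb (bigD1 i) //= mxE subrr hcomp0_coef.
  set a := (c i 0)@_0%MM in ci *; move/eqP; rewrite addr_eq0 => /eqP E.
  have -> : h i = (a^-1)%:MP *: (a%:MP *: h i).
    by rewrite scalerA -rmorphM mulVf // rmorph1 scale1r.
  rewrite E; apply: (submodZ sJ); apply: (submodN sJ); apply: (submod_sum sJ) => j ji.
  by apply: (submodZ sJ); move: ji; case: (unliftP i j) => [k ->|->] //; rewrite eqxx.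
have [c' ->] := gen x Zx; apply: (submod_sum sJ) => j _; apply: (submodZ sJ).
by case: (unliftP i j) => [k ->|->].
Qed.
End Graded.

Section Rank.
Variable (K : fieldType) (r : nat).
Notation S := {mpoly K[r]}.
Variable (V : lmodType S).

(** Reduction modulo the irrelevant ideal. *)
Definition const_mx0 m n (A : 'M[S]_(m, n)) : 'M[K]_(m, n) := map_mx (mcoeff 0%MM) A.

Lemma const_mx0M m n p (A : 'M[S]_(m, n)) (B : 'M[S]_(n, p)) :
  const_mx0 (A *m B) = const_mx0 A *m const_mx0 B.
Proof. exact: (map_mxM (mcoeff 0%MM)). Qed.

Lemma lift_gens n m (h : 'I_n -> V) (g : 'I_m -> V) :
    (forall x, exists c, x = comb h c) ->
  exists P : 'M[S]_(n, m), forall c, comb g c = comb h (P *m c).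
Proof.
move=> gen; have [P PE] := ex_choice (fun j => gen (g j)).
exists (\matrix_(i, j) P j i 0) => c; rewrite comb_mulmx; apply: eq_bigr => j _.
by rewrite PE; congr (_ *: comb h _); apply/colP => i; rewrite !mxE.
Qed.

(** The columns of P Q are lifts of the generators h_j to the free module
    that maps onto V by h, so they differ from the basis by relations of h. *)
Lemma lift_inverse n m (h : 'I_n -> V) (g : 'I_m -> V) (P : 'M[S]_(n, m)) (Q : 'M[S]_(m, n)) :
    (forall c, comb h c = 0 -> forall i, (c i 0)@_0%MM = 0) ->
    (forall c, comb g c = comb h (P *m c)) -> (forall c, comb h c = comb g (Q *m c)) ->
  const_mx0 P *m const_mx0 Q = 1%:M.
Proof.
move=> minh PE QE; rewrite -const_mx0M; apply/matrixP => i j.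
have E : comb h (delta_mx j 0 - col j (P *m Q)) = 0.
  by rewrite colE linearB /= -mulmxA -PE -QE subrr.
move: (P *m Q) E => A E; have := minh _ E i.
rewrite !mxE raddfB /= eqxx andbT => /eqP; rewrite subr_eq0 => /eqP <-.
by rewrite rmorph_nat.
Qed.

Lemma min_gens_le n m (h : 'I_n -> V) (g : 'I_m -> V) :
    (forall x, exists c, x = comb h c) ->
    (forall c, comb h c = 0 -> forall i, (c i 0)@_0%MM = 0) ->
    (forall x, exists c, x = comb g c) -> (n <= m)%N.
Proof.
move=> genh minh geng; have [P PE] := lift_gens g genh; have [Q QE] := lift_gens h geng.
have PQ := lift_inverse minh PE QE.
by rewrite -(mxrank1 K n) -PQ (leq_trans (mxrankM_maxl _ _)) // rank_leq_col.
Qed.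
End Rank.

(** * The Koszul complex on four elements *)

Section KoszulMatrices.
Variable R : comNzRingType.

Definition mx_of_rows m n (s : seq (seq R)) : 'M[R]_(m, n) :=
  \matrix_(i, j) (nth [::] s i)`_j.

(** The Koszul differentials, in bases of the exterior powers of R^4 ordered
    lexicographically. Their transposes, with c in the place of y, form a
    homotopy between 0 and multiplication by dot c y. *)
Definition kos1 (y : 'I_4 -> R) : 'M_(1, 4) := mx_of_rows 1 4
  [:: [:: y 0; y 1; y 2%:R; y 3%:R]].
Definition kos2 (y : 'I_4 -> R) : 'M_(4, 6) := mx_of_rows 4 6
  [:: [:: y 1; y 2%:R; y 3%:R; 0; 0; 0];
      [:: - y 0; 0; 0; y 2%:R; y 3%:R; 0];
      [:: 0; - y 0; 0; - y 1; 0; y 3%:R];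
      [:: 0; 0; - y 0; 0; - y 1; - y 2%:R]].
Definition kos3 (y : 'I_4 -> R) : 'M_(6, 4) := mx_of_rows 6 4
  [:: [:: y 2%:R; y 3%:R; 0; 0];
      [:: - y 1; 0; y 3%:R; 0];
      [:: 0; - y 1; - y 2%:R; 0];
      [:: y 0; 0; 0; y 3%:R];
      [:: 0; y 0; 0; - y 2%:R];
      [:: 0; 0; y 0; y 1]].
Definition kos4 (y : 'I_4 -> R) : 'M_(4, 1) := mx_of_rows 4 1
  [:: [:: y 3%:R]; [:: - y 2%:R]; [:: y 1]; [:: - y 0]].

Definition dot (c y : 'I_4 -> R) := c 0 * y 0 + c 1 * y 1 + c 2%:R * y 2%:R + c 3%:R * y 3%:R.

Lemma kos12 y : kos1 y *m kos2 y = 0.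
Proof.
apply/matrixP => i j; rewrite ord1 {i}; rewrite !mxE !big_ord_recl big_ord0 !mxE /=.
case: j => [[|[|[|[|[|[|//]]]]]] ?] /=; ring.
Qed.

Lemma kos23 y : kos2 y *m kos3 y = 0.
Proof.
apply/matrixP => i j; rewrite !mxE !big_ord_recl big_ord0 !mxE /=.
case: i => [[|[|[|[|//]]]] ?]; case: j => [[|[|[|[|//]]]] ?] /=; ring.
Qed.

Lemma kos34 y : kos3 y *m kos4 y = 0.
Proof.
apply/matrixP => i j; rewrite ord1 {j}; rewrite !mxE !big_ord_recl big_ord0 !mxE /=.
case: i => [[|[|[|[|[|[|//]]]]]] ?] /=; ring.
Qed.

Lemma homotopy4 c y : (kos4 c)^T *m kos4 y = (dot c y)%:M.
Proof.
apply/matrixP => i j; rewrite !ord1; rewrite !mxE !big_ord_recl big_ord0 !mxE /= /dot.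
ring.
Qed.

Lemma homotopy3 c y : kos4 y *m (kos4 c)^T + (kos3 c)^T *m kos3 y = (dot c y)%:M.
Proof.
apply/matrixP => i j; rewrite !mxE !big_ord_recl !big_ord0 !mxE /= /dot.
case: i => [[|[|[|[|//]]]] ?]; case: j => [[|[|[|[|//]]]] ?] /=; rewrite ?mulr1n ?mulr0n; ring.
Qed.

Lemma homotopy2 c y : kos3 y *m (kos3 c)^T + (kos2 c)^T *m kos2 y = (dot c y)%:M.
Proof.
apply/matrixP => i j; rewrite !mxE !big_ord_recl !big_ord0 !mxE /= /dot.
case: i => [[|[|[|[|[|[|//]]]]]] ?]; case: j => [[|[|[|[|[|[|//]]]]]] ?] /=;
  rewrite ?mulr1n ?mulr0n; ring.
Qed.
End KoszulMatrices.

Section Action.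
Variables (R : comNzRingType) (V : lmodType R).

Definition act m n (A : 'M[R]_(m, n)) (a : 'I_n -> V) : 'I_m -> V :=
  fun i => \sum_j A i j *: a j.

Lemma act_mulmx m n p (A : 'M[R]_(m, n)) (B : 'M[R]_(n, p)) a i :
  act (A *m B) a i = act A (act B a) i.
Proof.
rewrite /act; under [RHS]eq_bigr => j _ do rewrite scaler_sumr.
rewrite exchange_big; apply: eq_bigr => k _; rewrite mxE scaler_suml.
by apply: eq_bigr => j _; rewrite scalerA.
Qed.

Lemma act_scalar n x (a : 'I_n -> V) i : act x%:M a i = x *: a i.
Proof.
rewrite /act (bigD1 i) //= mxE eqxx big1 ?addr0 // => j ji.
by rewrite mxE eq_sym (negbTE ji) scale0r.
Qed.

Lemma act_addmx m n (A B : 'M[R]_(m, n)) a i : act (A + B) a i = act A a i + act B a i.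
Proof. by rewrite /act -big_split; apply: eq_bigr => j _; rewrite mxE scalerDl. Qed.

Lemma act0mx m n a i : act (0 : 'M[R]_(m, n)) a i = 0.
Proof. by rewrite /act big1 // => j _; rewrite mxE scale0r. Qed.

Lemma act_sub m n (A : 'M[R]_(m, n)) a b i :
  act A (fun j => a j - b j) i = act A a i - act A b i.
Proof. by rewrite /act -sumrB; apply: eq_bigr => j _; rewrite scalerBr. Qed.

Lemma act_scale m n (A : 'M[R]_(m, n)) x a i :
  act A (fun j => x *: a j) i = x *: act A a i.
Proof. by rewrite /act scaler_sumr; apply: eq_bigr => j _; rewrite !scalerA mulrC. Qed.

Lemma submod_act m n (A : 'M[R]_(m, n)) (N : V -> Prop) a i :
  submod N -> (forall j, N (a j)) -> N (act A a i).
Proof. by move=> sN Na; apply: (submod_sum sN) => j _; apply: (submodZ sN). Qed.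

(** Exactness in the middle of (V/N)^p -> (V/N)^n -> (V/N)^m, with maps B
    and A. *)
Definition exact_mod (N : V -> Prop) m n p (A : 'M[R]_(m, n)) (B : 'M[R]_(n, p)) :=
  forall a, (forall i, N (act A a i)) -> exists b, forall i, N (a i - act B b i).

(** Multiplication by x is homotopic to 0 and injective on V/N. For a cycle
    a, the homotopy gives x a = B (E a) modulo N; so E a is a cycle modulo
    N', that is E a = C b + x u modulo N, and x (a - B u) = 0 modulo N. Thus
    exactness at a place modulo N + x V yields exactness at the next lower
    place modulo N. *)
Lemma exact_mod_regular (N N' : V -> Prop) m n p q (A : 'M[R]_(m, n)) (B : 'M[R]_(n, p))
    (C : 'M[R]_(p, q)) (E : 'M[R]_(p, n)) (F : 'M[R]_(n, m)) (x : R) :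
    submod N -> (forall v, N (x *: v) -> N v) ->
    submod N' -> (forall v, N v -> N' v) -> (forall v, N' (x *: v)) ->
    (forall v, N' v -> exists u, N (v - x *: u)) ->
    B *m C = 0 -> B *m E + F *m A = x%:M ->
  exact_mod N' B C -> exact_mod N A B.
Proof.
move=> sN regx sN' NN' xN' N'E BC hom exBC a Aa.
have xa i : x *: a i = act B (act E a) i + act F (act A a) i.
  by rewrite -act_scalar -hom act_addmx !act_mulmx.
have FAN i : N (act F (act A a) i) by exact: submod_act.
have [i|b bP] := exBC (act E a).
  have -> : act B (act E a) i = x *: a i - act F (act A a) i by rewrite xa addrK.
  by apply: (submodB sN') => //; exact: NN'.
have [u uP] := ex_choice (fun i => N'E _ (bP i)).
exists u => i; apply: regx.
have -> : x *: (a i - act B u i)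
    = act B (fun j => act E a j - act C b j - x *: u j) i + act F (act A a) i.
  by rewrite scalerBr xa !act_sub act_scale -(act_mulmx B C) BC act0mx subr0 addrAC.
by apply: (submodD sN) => //; exact: submod_act.
Qed.

(** Depth sensitivity of the Koszul complex: each element of a regular
    sequence contained in the ideal (y) kills the homology at one more
    place, from the top. *)
Lemma koszul_regular (y : 'I_4 -> R) (x : nat -> R) (N : nat -> V -> Prop) :
    (forall k, submod (N k)) ->
    (forall k v, (k < 3)%N -> N k (x k *: v) -> N k v) ->
    (forall k v, N k v -> N k.+1 v) -> (forall k v, N k.+1 (x k *: v)) ->
    (forall k v, N k.+1 v -> exists u, N k (v - x k *: u)) ->
    (forall k, (k < 3)%N -> exists c, x k = dot c y) ->
  exact_mod (N 0%N) (kos2 y) (kos3 y).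
Proof.
move=> sN regx NS xN NSE irr.
have [c0 c0E] := irr 0%N isT; have [c1 c1E] := irr 1%N isT; have [c2 c2E] := irr 2%N isT.
apply: (exact_mod_regular (sN 0%N) _ (sN 1%N) (NS 0%N) (xN 0%N) (NSE 0%N) (kos34 y)).
- by move=> v; exact: regx.
- by rewrite c0E; exact: homotopy2.
apply: (exact_mod_regular (C := 0 : 'M_(1, 0)) (sN 1%N) _ (sN 2%N) (NS 1%N) (xN 1%N) (NSE 1%N)).
- by move=> v; exact: regx.
- exact: mulmx0.
- by rewrite c1E; exact: homotopy3.
move=> a a0; exists (fun=> 0) => i; rewrite act0mx subr0; apply: regx => //.
rewrite c2E -act_scalar -homotopy4 act_mulmx; exact: submod_act.
Qed.
End Action.

Section Syzygies.
Variable K : fieldType.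
Hypothesis charK : [pchar K] =i pred0.
Notation S := {mpoly K[4]}.
Notation X := (fun i : 'I_4 => 'X_i : S).

Lemma irrelevant_expand (p : S) : p@_0%MM = 0 -> exists c, p = \sum_i c i * 'X_i.
Proof.
move=> p0; pose J (q : S^o) := exists c : 'I_4 -> S, q = \sum_i c i * 'X_i.
have sJ : submod J.
  split; first by exists (fun=> 0); rewrite big1 // => i _; rewrite mul0r.
  move=> a _ _ [c ->] [c' ->]; exists (fun i => a * c i + c' i).
  rewrite scaler_sumr -big_split; apply: eq_bigr => i _.
  by rewrite mulrDl -mulrA.
have JX i : J ('X_i - 0).
  exists (fun j => (i == j)%:R); rewrite subr0 (bigD1 i) //= eqxx mul1r big1 ?addr0 // => j ji.
  by rewrite eq_sym (negbTE ji) mul0r.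
have := subst_cong sJ JX p; suff -> : subst (fun=> 0) p = (p@_0%MM)%:MP by rewrite p0 subr0.
elim/mpolyind: p {p0} => [|c m p _ _ IHp]; first by rewrite rmorph0 mcoeff0 rmorph0.
rewrite rmorphD /= IHp substZ mcoeffD rmorphD /= -mul_mpolyC; congr (_ + _).
rewrite mcoeffZ mcoeffX rmorphM /=; congr (_ * _).
have [->|m0] := eqVneq m 0%MM; first by rewrite mpolyX0 !rmorph1.
have [i mi] : exists i, m i != 0%N.
  apply/existsP; rewrite -negb_forall; apply: contraNN m0 => /forallP m0.
  by apply/eqP/mnmP => i; rewrite mnmE; apply/eqP.
rewrite mpolyXE_id rmorph_prod (bigD1 i) //= rmorphXn /= substX expr0n (negbTE mi) mul0r.
by rewrite rmorph0.
Qed.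

Lemma sum4E (V : nmodType) (F : 'I_4 -> V) : \sum_i F i = F 0 + F 1 + F 2%:R + F 3%:R.
Proof. exact: sum4. Qed.

Lemma koszul_exact_mx z (p : 'I_4 -> S) : (forall i, homdeg z (p i)) ->
    \sum_i 'X_i * p i = 0 ->
  exists w : 'I_6 -> S, forall i, p i = \sum_s kos2 X i s * w s.
Proof.
move=> hp /(koszul_exact charK hp)[w [wN pE]].
have wii i : w i i = 0.
  have := wN i i => /eqP; rewrite -addr_eq0 -mulr2n -mulr_natl mulf_eq0 -mpolyC_nat mpolyC_eq0.
  by have /pcharf0P-> := charK; move/eqP.
exists (fun s => [:: w 0 1; w 0 2%:R; w 0 3%:R; w 1 2%:R; w 1 3%:R; w 2%:R 3%:R]`_s) => i.
rewrite pE sum4E !big_ord_recl big_ord0 !mxE.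
case: i => [[|[|[|[|//]]]] i4] /=.
- have -> : Ordinal i4 = 0 by apply/val_inj.
  by rewrite wii; ring.
- have -> : Ordinal i4 = 1 by apply/val_inj.
  by rewrite wii (wN 1 0); ring.
- have -> : Ordinal i4 = 2%:R by apply/val_inj.
  by rewrite wii (wN 2%:R 0) (wN 2%:R 1); ring.
- have -> : Ordinal i4 = 3%:R by apply/val_inj.
  by rewrite wii (wN 3%:R 0) (wN 3%:R 1) (wN 3%:R 2%:R); ring.
Qed.
End Syzygies.

(** * Freeness of the syzygies of a module of depth three *)

Section FreeSyzygy.
Variable K : fieldType.
Hypothesis charK : [pchar K] =i pred0.
Notation S := {mpoly K[4]}.
Notation X := (fun i : 'I_4 => 'X_i : S).
Variables (n : nat) (d : 'I_n -> int).

Definition twist (e : int) (v : 'cV[S]_n) := forall j, homdeg (e - d j) (v j 0).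

Definition twist_comp (e : int) (v : 'cV[S]_n) : 'cV[S]_n := \col_j hcomp (e - d j) (v j 0).

Lemma twist_comp_sum (s : seq int) (c : int -> 'cV[S]_n) e : uniq s ->
  (forall x, twist x (c x)) -> e \in s -> twist_comp e (\sum_(x <- s) c x) = c e.
Proof.
move=> us Gc es; apply/colP => j; rewrite mxE summxE raddf_sum /= (bigD1_seq e) //=.
rewrite hcomp_id; last exact: Gc.
rewrite big1 ?addr0 // => x xe; apply: (hcomp_other (Gc x j)).
by apply: contra xe => /eqP E; rewrite -(subrK (d j) x) E subrK.
Qed.

Lemma twist_grading : grading (@homdeg K 4) twist.
Proof.
split.
- by move=> e j; rewrite mxE; exact: homog0.
- by move=> e x y Gx Gy j; rewrite !mxE; apply: homogB.
- by move=> e e' p x hp Gx j; rewrite mxE -addrA; apply: homogM.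
- move=> v.
  pose T := undup (flatten [seq [seq Posz (mdeg m) + d j | m <- msupp (v j 0)] | j <- enum 'I_n]).
  exists T, (fun e => twist_comp e v); split.
    by move=> e j; rewrite mxE; exact: homog_hcomp.
  apply/colP => j; rewrite summxE; under eq_bigr do rewrite mxE.
  rewrite sum_hcomp ?undup_uniq // => m vm.
  rewrite mem_undup; apply/flatten_mapP; exists j; first exact: mem_enum.
  by apply/mapP; exists m => //; rewrite mcoeff_msupp.
- move=> s c us Gc c0 e es; rewrite -(twist_comp_sum us Gc es) c0.
  by apply/colP => j; rewrite !mxE raddf0.
Qed.

Variables (V : lmodType S) (G : int -> V -> Prop) (h : 'I_n -> V).
Hypothesis grG : grading (@homdeg K 4) G.
Hypothesis Gh : forall j, G (d j) (h j).
Hypothesis gen : forall x, exists c, x = comb h c.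
Hypothesis exactV : exact_mod (fun v : V => v = 0) (kos2 X) (kos3 X).

Let Z (v : 'cV[S]_n) := comb h v = 0.

Lemma submod_ker : submod Z.
Proof.
split; first exact: linear0.
by move=> a x y Zx Zy; rewrite /Z linearP /= Zx Zy scaler0 addr0.
Qed.

(** Over S the relation between the z_i comes from vectors w_s that need not
    be syzygies of h. But their images in V form a Koszul cycle, hence a
    boundary since V has vanishing second Koszul homology; lifting it to S^n
    corrects the w_s into syzygies without changing the z_i. *)
Lemma koszul_syzygy e (z : 'I_4 -> 'cV[S]_n) :
    (forall i, Z (z i)) -> (forall i, twist e (z i)) -> \sum_i 'X_i *: z i = 0 ->
  exists w : 'I_6 -> 'cV[S]_n, (forall s, Z (w s)) /\ forall i, z i = act (kos2 X) w i.
Proof.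
move=> Zz Gz z0.
have /ex_choice[w0 w0E] (j : 'I_n) : exists w : 'I_6 -> S,
    forall i, z i j 0 = \sum_s kos2 X i s * w s.
  apply: (koszul_exact_mx charK (z := e - d j)) => [i|]; first exact: Gz.
  have := congr1 (fun v : 'cV[S]_n => v j 0) z0; rewrite summxE [RHS]mxE => E.
  by rewrite -[RHS]E; apply: eq_bigr => i _; rewrite mxE.
pose w s : 'cV[S]_n := \col_j w0 j s.
have zE i : z i = act (kos2 X) w i.
  apply/colP => j; rewrite w0E summxE; apply: eq_bigr => s _.
  by rewrite [RHS]mxE [w s j 0]mxE.
have [|u uE] := exactV (a := fun s => comb h (w s)).
  move=> i; rewrite -[RHS](Zz i) zE /act linear_sum; apply: eq_bigr => s _.
  by rewrite linearZ.
have [u' u'E] := ex_choice (fun i => gen (u i)).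
exists (fun s => w s - act (kos3 X) u' s); split=> [s|i].
  rewrite /Z linearB; rewrite -[RHS](uE s); congr (_ - _).
  by rewrite /act linear_sum; apply: eq_bigr => i _; rewrite linearZ /= u'E.
by rewrite act_sub -act_mulmx kos23 act0mx subr0.
Qed.

Section MinGens.
Variables (k : nat) (z : 'I_k -> 'cV[S]_n) (e : 'I_k -> int).
Hypothesis Gz : forall j, twist (e j) (z j).
Hypothesis Zz : forall j, Z (z j).
Hypothesis genz : forall x, Z x -> exists c, x = comb z c.
Hypothesis minz : forall c, comb z c = 0 -> forall i, (c i 0)@_0%MM = 0.

(** By minimality the coefficients of a relation are c_j = sum_i X_i a_ij.
    The syzygies y_i = sum_j a_ij z_j satisfy sum_i X_i y_i = 0, so y = kos2
    w for syzygies w_s = sum_j b_sj z_j. The coefficients a_ij - (kos2 b)_ij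
    then form a relation of degree one less, which is zero by induction, and
    c = kos1 kos2 b = 0. *)
Lemma min_gens_free_homog (t : nat) E (c : 'cV[S]_k) :
    (forall j, E - e j < t%:Z) -> (forall j, homdeg (E - e j) (c j 0)) ->
  comb z c = 0 -> c = 0.
Proof.
elim: t E c => [|t IHt] E c Et hcE c0.
  by apply/colP => j; rewrite mxE; apply: (homog_neg (hcE j)); exact: Et.
have /ex_choice[a0 a0E] (j : 'I_k) : exists a : 'I_4 -> S, c j 0 = \sum_i a i * 'X_i.
  by apply: irrelevant_expand; exact: minz.
pose a i j := hcomp (E - 1 - e j) (a0 j i).
have aE j : c j 0 = \sum_i 'X_i * a i j.
  rewrite -(hcomp_id (hcE j)) a0E raddf_sum; apply: eq_bigr => i _ /=.
  by rewrite mulrC (hcompM _ _ (@homogX _ _ i)) /a addrAC.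
pose y i := comb z (\col_j a i j).
have Zy i : Z (y i) by apply: (submod_sum submod_ker) => j _; apply: (submodZ submod_ker).
have Gy i : twist (E - 1) (y i).
  apply: (graded_sum twist_grading) => j _; rewrite mxE -[X in twist X](subrK (e j)).
  by case: twist_grading => _ _ GZ _ _; apply: GZ; [exact: homog_hcomp | exact: Gz].
have y0 : \sum_i 'X_i *: y i = 0.
  rewrite -[RHS]c0 /y /comb; under eq_bigr => i _ do rewrite scaler_sumr.
  rewrite exchange_big; apply: eq_bigr => j _; rewrite aE scaler_suml.
  by apply: eq_bigr => i _; rewrite mxE scalerA.
have [w [Zw yE]] := koszul_syzygy Zy Gy y0.
have /ex_choice[b0 b0E] s := genz (Zw s).
pose b s j := hcomp (E - 1 - 1 - e j) (b0 s j 0).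
have relE i : comb z (\col_j (a i j - \sum_s kos2 X i s * b0 s j 0)) = 0.
  have lin (kk : 'I_6 -> S) : \col_j (a i j - \sum_s kk s * b0 s j 0)
      = \col_j a i j - \sum_s kk s *: b0 s.
    apply/colP => j; rewrite !mxE summxE; congr (_ - _); apply: eq_bigr => s _.
    by rewrite mxE.
  rewrite lin linearB /= -/(y i) yE; apply/eqP; rewrite subr_eq0; apply/eqP.
  by rewrite linear_sum; apply: eq_bigr => s _; rewrite linearZ /= b0E.
have hk i s : homdeg 1 (kos2 X i s).
  rewrite mxE; have hN j : homdeg 1 (- 'X_j : S) by apply: homogN; exact: homogX.
  case: i => [[|[|[|[|//]]]] i4]; case: s => [[|[|[|[|[|[|//]]]]]] s6] /=;
    by [exact: homogX | exact: hN | exact: homog0].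
have kE i s j : hcomp (E - 1 - e j) (kos2 X i s * b0 s j 0) = kos2 X i s * b s j.
  by rewrite (hcompM _ _ (hk i s)) /b; congr (_ * hcomp _ _); rewrite addrAC.
have abE i j : a i j = \sum_s kos2 X i s * b s j.
  have := comb_component twist_grading (E - 1) Gz (relE i) => rel1.
  have lt l : E - 1 - e l < t%:Z by have := Et l; lia.
  have hom l : homdeg (E - 1 - e l)
      ((\col_j hcomp (E - 1 - e j) ((\col_j (a i j - \sum_s kos2 X i s * b0 s j 0)) j 0)) l 0).
    by rewrite mxE; exact: homog_hcomp.
  have /colP/(_ j) := IHt _ _ lt hom rel1; rewrite mxE [X in hcomp _ X]mxE [RHS]mxE.
  rewrite raddfB /= => /eqP; rewrite subr_eq0.
  rewrite hcomp_id; last exact: homog_hcomp.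
  by move=> /eqP->; rewrite raddf_sum; apply: eq_bigr => s _; exact: kE.
apply/colP => j; rewrite [RHS]mxE aE; under eq_bigr do rewrite abE mulr_sumr.
rewrite exchange_big /=; apply: big1 => s _.
under eq_bigr do rewrite mulrA; rewrite -mulr_suml.
have := congr1 (fun M : 'M[S]_(1, 6) => M 0 s) (kos12 X); rewrite mxE [RHS]mxE => kos.
suff -> : \sum_i 'X_i * kos2 X i s = 0 by rewrite mul0r.
rewrite -[RHS]kos; apply: eq_bigr => i _; congr (_ * _); rewrite mxE.
by case: i => [[|[|[|[|//]]]] i4] /=; congr 'X__; apply/val_inj.
Qed.

Lemma min_gens_free (c : 'cV[S]_k) : comb z c = 0 -> c = 0.
Proof.
move=> c0; apply/colP => j; rewrite mxE; apply/mpolyP => m; rewrite mcoeff0.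
pose E := Posz (mdeg m) + e j.
have cE := comb_component twist_grading E Gz c0.
have [t Et] : exists t : nat, forall l, E - e l < t%:Z.
  exists (\sum_l `|E - e l|.+1)%N => l; rewrite (bigD1 l) //=.
  by apply: (@le_lt_trans _ _ `|E - e l|%N%:Z); [rewrite abszE ler_norm | rewrite ltz_nat ltn_addr].
have := min_gens_free_homog Et _ cE.
move=> /(_ _)/colP/(_ j); rewrite !mxE => H.
have /(congr1 (mcoeff m)) : hcomp (E - e j) (c j 0) = 0.
  by apply: H => l; rewrite mxE; exact: homog_hcomp.
by rewrite mcoeff_hcomp /E addrK eqxx mcoeff0.
Qed.
End MinGens.

Variable f : S.
Hypothesis killf : forall v : V, f *: v = 0.
Hypothesis f_point : exists x, f.@[x] != 0.
Hypothesis minh : forall c, comb h c = 0 -> forall i, (c i 0)@_0%MM = 0.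

(** The minimal syzygies z_j are independent, so they form the columns of an
    injective matrix A. As f kills V, the columns of f I are combinations f
    I = A B; then B A = f I by injectivity, and A is square by evaluation at
    a point where f does not vanish. *)
Lemma free_syzygy : exists (A B : 'M[S]_n) (e : 'I_n -> int),
  [/\ forall i j, homdeg (e j - d i) (A i j), forall i j, (A i j)@_0%MM = 0,
      A *m B = f%:M, B *m A = f%:M & forall c, comb h c = 0 <-> exists u, c = A *m u].
Proof.
have gradedZ (s : seq int) (c : int -> 'cV[S]_n) : uniq s -> (forall x, twist x (c x)) ->
    Z (\sum_(x <- s) c x) -> forall x, x \in s -> Z (c x).
  move=> us Gc Zc x xs; rewrite -(twist_comp_sum us Gc xs).
  exact: (comb_component grG x Gh Zc).
have fgZ : fin_gen Z := @noetherian_cV _ n (@mpoly_noetherian K 4) _ submod_ker.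
have [k [z [e [Gz Zz genz minz]]]] := min_homog_gens twist_grading gradedZ fgZ.
have free := min_gens_free Gz Zz genz minz.
pose A : 'M[S]_(n, k) := \matrix_(i, j) z j i 0.
have AE c : A *m c = comb z c.
  apply/colP => i; rewrite mxE summxE; apply: eq_bigr => j _.
  by rewrite !mxE mulrC.
have fZ j : Z (f *: delta_mx j 0) by rewrite /Z linearZ /= killf.
have /ex_choice[b bE] j := genz _ (fZ j).
pose B : 'M[S]_(k, n) := \matrix_(i, j) b j i 0.
have AB : A *m B = f%:M.
  apply/matrixP => i j; have := congr1 (fun v : 'cV[S]_n => v i 0) (bE j).
  rewrite -AE !mxE eqxx andbT mulr_natr => ->.
  by apply: eq_bigr => l _; rewrite !mxE.
have BA : B *m A = f%:M.
  apply/matrixP => i j; have := free ((B *m A - f%:M) *m delta_mx j 0).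
  rewrite -AE mulmxA mulmxBr mulmxA AB scalar_mxC subrr mul0mx => /(_ erefl)/colP/(_ i).
  rewrite -colE; move: (B *m A) (f%:M : 'M[S]_k) => U W.
  by rewrite !mxE => /eqP; rewrite subr_eq0 => /eqP.
have kn : k = n.
  have [x fx] := f_point.
  have ev p q (C : 'M[S]_(p, q)) (D : 'M[S]_(q, p)) : C *m D = f%:M -> (p <= q)%N.
    move=> CD; have := congr1 (map_mx (meval x)) CD.
    rewrite map_mxM map_scalar_mx => CDx; rewrite -(mxrank1 K p) -(mxrank_scale_nz _ fx).
    by rewrite scalemx1 -CDx (leq_trans (mxrankM_maxl _ _)) // rank_leq_col.
  by apply/eqP; rewrite eqn_leq (ev _ _ _ _ AB) (ev _ _ _ _ BA).
have A0 i j : (A i j)@_0%MM = 0 by rewrite mxE; exact: minh (Zz j) i.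
have hA i j : homdeg (e j - d i) (A i j) by rewrite mxE; exact: Gz.
have kerA c : comb h c = 0 <-> exists u, c = A *m u.
  split=> [/genz[u ->]|[u ->]]; first by exists u; rewrite AE.
  by rewrite AE; apply: (submod_sum submod_ker) => j _; apply: (submodZ submod_ker).
clearbody A B; move: e A B AB BA A0 hA kerA {Gz Zz genz minz free z fZ b bE AE}.
by rewrite kn => e A B AB BA A0 hA kerA; exists A, B, e.
Qed.
End FreeSyzygy.

(** * The ring R4 and its dimension *)

Section R4Ring.
Variable K : closedFieldType.
Notation S := {mpoly K[4]}.
Notation f := (f4 K).

Definition toR4 (p : S) : R4 K := (\pi_(R4 K) p)%qT.
HB.instance Definition _ := GRing.RMorphism.copy toR4 (\pi_(R4 K)%qT : S -> R4 K).

Lemma toR4_surj (r : R4 K) : exists p, r = toR4 p.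
Proof. by exists (repr r); rewrite /toR4 reprK. Qed.

Lemma toR4_eq p p' : toR4 p = toR4 p' <-> exists u, p - p' = u * f.
Proof.
split=> [/eqP|[u pE]]; first by rewrite /toR4 -Quotient.idealrBE => /asboolP.
by apply/eqP; rewrite /toR4 -Quotient.idealrBE; apply/asboolP; exists u.
Qed.

Lemma toR4_eq0 p : toR4 p = 0 <-> exists u, p = u * f.
Proof. by rewrite -(rmorph0 toR4) toR4_eq subr0. Qed.

Lemma toR4_f : toR4 f = 0.
Proof. by apply/toR4_eq0; exists 1; rewrite mul1r. Qed.

Lemma R4_irrP p : R4_irr (toR4 p) <-> p@_0%MM = 0.
Proof.
split=> [[p' [/toR4_eq[u pE] p'0]]|p0]; last by exists p.
rewrite -(subrK p' p) pE mcoeffD p'0 addr0 (rmorphM (mcoeff 0%MM)) /= f4_const mulr0 //.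
Qed.

Lemma toR4_deg e p : homdeg e p -> R4_deg e (toR4 p).
Proof.
move=> hp; exists p; split=> //; case: e hp => k hp; last exact: (homog_neg hp).
by apply/dhomogP => m mp; have := hp m; rewrite -mcoeff_msupp => /(_ mp)[].
Qed.

Hypothesis charK : [pchar K] =i pred0.

Lemma R4_domain (x y : R4 K) : x * y = 0 -> x = 0 \/ y = 0.
Proof.
have [p ->] := toR4_surj x; have [p' ->] := toR4_surj y.
rewrite -rmorphM => /toR4_eq0/(f4_prime charK)[]/toR4_eq0 ->; by [left|right].
Qed.

Definition constR4 : K -> R4 K := toR4 \o @mpolyC 4 K.
HB.instance Definition _ := GRing.RMorphism.copy constR4 (toR4 \o @mpolyC 4 K).

Lemma f4_box : box_le 3 f.
Proof.
apply: box_le_sum => i; apply: (@box_leW _ _ (3 * 1)) => //; apply: box_leX => m.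
by rewrite msuppX inE => /eqP-> j; rewrite mnmE; case: (i == j).
Qed.

Lemma R4_dependent (x : nat -> R4 K) : exists n (c : nat -> nat -> nat -> nat -> K),
  (exists i j k l, [/\ (i < n)%N, (j < n)%N, (k < n)%N & (l < n)%N] /\ c i j k l != 0) /\
  \sum_(i < n) \sum_(j < n) \sum_(k < n) \sum_(l < n)
    constR4 (c i j k l) * (x 0%N ^+ i * x 1%N ^+ j * x 2%N ^+ k * x 3%N ^+ l) = 0.
Proof.
have [r rE] := ex_choice (fun k => toR4_surj (x k)).
have [n [c [c0 cE]]] := algebraic_dependence (fun i : 'I_4 => r i) (f4_neq0 K) f4_box.
exists n, c; split=> //; move/toR4_eq0: cE => cE; rewrite -[RHS]cE.
rewrite rmorph_sum; apply: eq_bigr => i _; rewrite rmorph_sum; apply: eq_bigr => j _.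
rewrite rmorph_sum; apply: eq_bigr => k _; rewrite rmorph_sum; apply: eq_bigr => l _.
by rewrite !rE -mul_mpolyC rmorphM /constR4 /mono4 /= !rmorphM !rmorphXn.
Qed.

(** Regular sequences and chains of primes of length 4 would provide four
    algebraically independent elements of R4. *)
Lemma no_regular4 (V : lmodType (R4 K)) (x : nat -> R4 K) (N : nat -> V -> Prop) :
    (forall k, submod (N k)) -> (forall k y, (k < 4)%N -> N k y -> N k.+1 y) ->
    (forall k y, (k < 4)%N -> N k.+1 (x k *: y)) ->
    (forall k y, (k < 4)%N -> N k (x k *: y) -> N k y) -> (exists y, ~ N 4 y) -> False.
Proof.
move=> sN NS xN regx N4; have [n [c [[i [j [k [l [[li lj lk ll] cn0]]]]] c0]]] := R4_dependent x.
case/eqP: cn0; apply: (regular_indep (iota := constR4) sN NS xN regx N4 (n := n)) => // y.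
by rewrite c0 scale0r; exact: (sN 0%N).1.
Qed.

Section XM.
Variables (M : lmodType (R4 K)) (xs : seq (R4 K)).

Lemma submod_xM k : submod (xM (M := M) xs k).
Proof.
split; first by exists (fun=> 0); rewrite big1 // => i _; rewrite scaler0.
move=> a _ _ [u ->] [v ->]; exists (fun i => a *: u i + v i).
rewrite scaler_sumr -big_split; apply: eq_bigr => i _.
by rewrite scalerDr !scalerA mulrC.
Qed.

Lemma xMS k y : xM (M := M) xs k.+1 y <-> exists u, xM xs k (y - xs`_k *: u).
Proof.
split=> [[u ->]|[u [v yE]]].
  exists (u ord_max), (fun i => u (widen_ord (leqnSn k) i)).
  by rewrite big_ord_recr /= addrK.
exists (fun i => if unlift ord_max i is Some j then v j else u).
rewrite big_ord_recr /= unlift_none -[LHS](subrK (xs`_k *: u)) yE; congr (_ + _).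
apply: eq_bigr => i _; rewrite (_ : widen_ord _ i = lift ord_max i) ?liftK //.
by apply/val_inj; rewrite /= /bump leqNgt ltn_ord.
Qed.

Lemma xMW k y : xM (M := M) xs k y -> xM xs k.+1 y.
Proof. by move=> ky; apply/xMS; exists 0; rewrite scaler0 subr0. Qed.

Lemma xM_le k l y : (k <= l)%N -> xM (M := M) xs k y -> xM xs l y.
Proof. by move=> /subnK <-; elim: (l - k)%N => // m IHm /IHm; exact: xMW. Qed.

Lemma xM_mul k y : xM (M := M) xs k.+1 (xs`_k *: y).
Proof. by apply/xMS; exists y; rewrite subrr; exact: (submod_xM k).1. Qed.

Lemma xM0 y : xM (M := M) xs 0 y <-> y = 0.
Proof. by split=> [[u ->]|->]; [rewrite big_ord0 | exact: (submod_xM 0).1]. Qed.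
End XM.

Lemma regular_seq_size (M : lmodType (R4 K)) xs : regular_seq M xs -> (size xs <= 3)%N.
Proof.
move=> [reg [y ny]]; rewrite leqNgt; apply/negP => sz.
apply: (no_regular4 (x := fun k => xs`_k) (N := xM (M := M) xs)).
- exact: submod_xM.
- by move=> k v _; exact: xMW.
- by move=> k v _; exact: xM_mul.
- by move=> k v k4; apply: reg; exact: leq_trans sz.
- by exists y => /(xM_le sz).
Qed.

Section Chain.
Variable sg : 'I_4 -> S.
Hypothesis sgf : subst sg f = 0.

(** The image in R4 of the kernel of a substitution that kills f; it is
    prime because the substitution takes values in a domain. *)
Definition ker_subst : {pred R4 K} :=
  [pred r | `[< exists p, r = toR4 p /\ subst sg p = 0 >]].

Lemma ker_substP p : (toR4 p \in ker_subst) <-> subst sg p = 0.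
Proof.
split=> [/asboolP[p' [/toR4_eq[u pE] p'0]]|p0]; last by apply/asboolP; exists p.
by rewrite -(subrK p' p) pE rmorphD rmorphM /= sgf p'0 mulr0 addr0.
Qed.

Lemma ker_subst_prime : prime_ideal ker_subst.
Proof.
split.
  split; first by rewrite -(rmorph0 toR4); apply/ker_substP; rewrite rmorph0.
    rewrite -(rmorph1 toR4); apply/negP => /ker_substP; rewrite rmorph1 => /eqP.
    by rewrite oner_eq0.
  move=> a u v; have [x ->] := toR4_surj a; have [y ->] := toR4_surj u; have [z ->] := toR4_surj v.
  move=> /ker_substP y0 /ker_substP z0; rewrite -rmorphM -rmorphD; apply/ker_substP.
  by rewrite rmorphD rmorphM /= y0 z0 mulr0 addr0.
move=> u v; have [y ->] := toR4_surj u; have [z ->] := toR4_surj v.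
rewrite -rmorphM => /ker_substP; rewrite rmorphM => /eqP; rewrite mulf_eq0.
by move=> /orP[]/eqP/ker_substP->; rewrite ?orbT.
Qed.
End Chain.

(** The points (-a, a, -b, b) form a line on the cubic surface. The primes
    of R4 defined by this line, by a point on it and by the vertex of the
    cone form a chain above 0. *)
Lemma krull_dim_ge3 : exists P, prime_chain (R := R4 K) 3 P.
Proof.
pose sg (a b : S) (i : 'I_4) : S := [:: - a; a; - b; b]`_i.
have sgf a b : subst (sg a b) f = 0.
  rewrite /f4 rmorph_sum sum4E !rmorphXn /= !substX /sg /=; ring.
pose P k : {pred R4 K} := match k with
  | 0 => [pred r | r == 0] | 1 => ker_subst (sg 'X_0 'X_1)
  | 2 => ker_subst (sg 'X_0 0) | _ => ker_subst (sg 0 0) end.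
have up (a b a' b' : S) (tau : 'I_4 -> S) p :
    (forall i, subst tau (sg a b i) = sg a' b' i) ->
    subst (sg a b) p = 0 -> subst (sg a' b') p = 0.
  move=> comp p0; have := subst_comp (sg a b) tau p; rewrite p0 rmorph0 => /esym <-.
  by congr (subst _ p); apply/funext => i; rewrite comp.
have sub_of (a b a' b' : S) (tau : 'I_4 -> S) : subst tau a = a' -> subst tau b = b' ->
    forall i, subst tau (sg a b i) = sg a' b' i.
  move=> ea eb; case=> [[|[|[|[|//]]]] i4]; rewrite /sg /= ?rmorphN /= ?ea ?eb //.
exists P; split.
  move=> [|[|[|[|//]]]] _; [|exact: ker_subst_prime|exact: ker_subst_prime|exact: ker_subst_prime].
  split.
    split; first by rewrite inE.
      by rewrite inE oner_eq0.
    by move=> a u v; rewrite !inE => /eqP-> /eqP->; rewrite mulr0 addr0.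
  by move=> u v; rewrite !inE => /eqP/R4_domain[]->; rewrite eqxx ?orbT.
have X01 : (0 : 'I_4) != 1 by [].
have Xn0 (i : 'I_4) : 'X_i != 0 :> S.
  by rewrite -msize_poly_eq0 msizeX.
move=> [|[|[|//]]] _; split.
- move=> r /eqP->; rewrite -(rmorph0 toR4); apply/ker_substP; [exact: sgf | exact: rmorph0].
- exists (toR4 ('X_0 + 'X_1)).
    by apply/ker_substP; rewrite ?sgf // rmorphD /= !substX /sg /= addNr.
  rewrite inE; apply/eqP => /toR4_eq0[u] /(congr1 (meval (fun i : 'I_4 => [:: 1; 0; -1; 0]`_i))).
  rewrite mevalM mevalD !mevalXU meval_f4 sum4E /= => /eqP.
  by rewrite (_ : 1 ^+ 3 + _ + _ + _ = 0) ?mulr0 ?addr0 ?oner_eq0 //; ring.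
- move=> r; have [p ->] := toR4_surj r; move=> /(ker_substP (sgf _ _)) p0.
  apply/(ker_substP (sgf _ _)); apply: (up _ _ _ _ (fun i => if i == 0 then 'X_0 else 0) _ _ p0).
  by apply: sub_of; rewrite substX.
- exists (toR4 'X_3%:R); first by apply/ker_substP; rewrite ?sgf // substX.
  by apply/negP => /(ker_substP (sgf _ _)); rewrite substX /sg /= => /eqP; rewrite (negbTE (Xn0 _)).
- move=> r; have [p ->] := toR4_surj r; move=> /(ker_substP (sgf _ _)) p0.
  apply/(ker_substP (sgf _ _)); apply: (up _ _ _ _ (fun i => 0) _ _ p0).
  by apply: sub_of; rewrite ?substX ?rmorph0.
- exists (toR4 'X_1); first by apply/ker_substP; rewrite ?sgf // substX.
  by apply/negP => /(ker_substP (sgf _ _)); rewrite substX /sg /= => /eqP; rewrite (negbTE (Xn0 _)).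
Qed.

(** Elements x_k of P_(k+1) outside P_k are regular modulo P_k. *)
Lemma krull_dim_le3 m P : prime_chain (R := R4 K) m P -> (m <= 3)%N.
Proof.
move=> [prP chP]; rewrite leqNgt; apply/negP => m4.
have /ex_choice[x xP] k : exists x, (k < 4)%N -> x \in P k.+1 /\ x \notin P k.
  have [k4|] := boolP (k < 4)%N; last by exists 0.
  by have [_ [x xP xnP]] := chP k (leq_trans k4 m4); exists x.
pose N k (v : (R4 K)^o) : Prop := (k <= 4)%N -> v \in P k.
have PI k : (k <= 4)%N -> prime_ideal (P k) by move=> k4; apply: prP; exact: leq_trans m4.
have sN k : submod (N k).
  split=> [|a u v uP vP] k4; have [[P0 _ PD] _] := PI _ k4; first exact: P0.
  by apply: PD; [exact: uP | exact: vP].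
have NS k v : (k < 4)%N -> N k v -> N k.+1 v.
  by move=> k4 vP _; apply: (chP k (leq_trans k4 m4)).1; apply: vP; exact: ltnW.
have xN k v : (k < 4)%N -> N k.+1 (x k *: v).
  move=> k4 _; have [[P0 _ PD] _] := PI _ k4.
  by have := PD v _ _ (xP k k4).1 P0; rewrite addr0 mulrC.
have regx k v : (k < 4)%N -> N k (x k *: v) -> N k v.
  move=> k4 xv k4'; have [_ pr] := PI _ (ltnW k4).
  by have /pr := xv k4'; rewrite (negbTE (xP k k4).2).
apply: (no_regular4 sN NS xN regx); exists 1 => /(_ isT).
by have [[_ /negP]] := PI 4 isT.
Qed.

Lemma krull_dim_R4 : krull_dim (R4 K) 3.
Proof. by split; [exact: krull_dim_ge3 | exact: krull_dim_le3]. Qed.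

Lemma krull_dim_R4_uniq d : krull_dim (R4 K) d -> d = 3%N.
Proof.
move=> [[P chP] maxd]; apply/eqP; rewrite eqn_leq (krull_dim_le3 chP) /=.
by have [P' chP'] := krull_dim_ge3; exact: maxd chP'.
Qed.

End R4Ring.

(** * Presentations over the polynomial ring and cokernels *)

Section Iso.
Variable R : comNzRingType.

Lemma iso_sym (M N : lmodType R) : iso M N -> iso N M.
Proof.
move=> [g [g' gK g'K]].
have lg : linear g' by move=> a x y; apply: (can_inj gK); rewrite linearP !g'K.
by exists (linear_of lg); exists g.
Qed.
End Iso.

Section Restriction.
Variable K : closedFieldType.
Notation S := {mpoly K[4]}.
Notation f := (f4 K).
Notation X := (fun i : 'I_4 => 'X_i : S).

(** Restriction of scalars to S, where the results on graded modules over
    polynomial rings apply. *)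
Definition resS (M : lmodType (R4 K)) : Type := M.
HB.instance Definition _ M := GRing.Zmodule.on (resS M).

Section Scale.
Variable M : lmodType (R4 K).
Definition resS_scale (p : S) (x : resS M) : resS M := toR4 p *: (x : M).
Fact resS_scaleA a b x : resS_scale a (resS_scale b x) = resS_scale (a * b) x.
Proof. by rewrite /resS_scale scalerA -rmorphM. Qed.
Fact resS_scale1 : left_id 1 resS_scale.
Proof. by move=> x; rewrite /resS_scale rmorph1 scale1r. Qed.
Fact resS_scaleDr : right_distributive resS_scale +%R.
Proof. by move=> a x y; rewrite /resS_scale scalerDr. Qed.
Fact resS_scaleDl x : {morph resS_scale^~ x : a b / a + b}.
Proof. by move=> a b; rewrite /resS_scale rmorphD scalerDl. Qed.
HB.instance Definition _ := GRing.Zmodule_isLmodule.Build S (resS M)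
  resS_scaleA resS_scale1 resS_scaleDr resS_scaleDl.
End Scale.

Lemma resS_scaleE (M : lmodType (R4 K)) (p : S) (x : resS M) : p *: x = toR4 p *: (x : M).
Proof. by []. Qed.

Lemma resS_kill (M : lmodType (R4 K)) (x : resS M) : f *: x = 0.
Proof. by rewrite resS_scaleE toR4_f scale0r. Qed.

Lemma resS_grading (M : lmodType (R4 K)) G : grading (@R4_deg K) G ->
  grading (@homdeg K 4) (G : int -> resS M -> Prop).
Proof.
move=> [G0 GB GZ Gdec Gdir]; split=> //.
by move=> e d p x hp Gx; rewrite resS_scaleE; apply: GZ => //; exact: toR4_deg.
Qed.

(** M is the cokernel of A, with h the images of the basis vectors. *)
Definition presents n (A : 'M[S]_n) (M : lmodType (R4 K)) (h : 'I_n -> resS M) :=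
  (forall x, exists c, x = comb h c) /\ forall c, comb h c = 0 <-> exists u, c = A *m u.

Lemma presents_linear n (A : 'M[S]_n) (M : lmodType (R4 K)) (g : 'cV[S]_n -> M) :
    (forall a u v, g (a *: u + v) = toR4 a *: g u + g v) -> (forall x, exists v, x = g v) ->
    (forall v, g v = 0 <-> exists u, v = A *m u) ->
  presents A (fun i => g (delta_mx i 0) : resS M).
Proof.
move=> lg sg kg.
have gE c : comb (fun i => g (delta_mx i 0) : resS M) c = g c.
  have lg' : linear (g : 'cV[S]_n -> resS M) by move=> a u v; rewrite lg.
  rewrite [in RHS](matrix_sum_delta c) exchange_big big_ord1.
  rewrite -[g _]/(linear_of lg' _) linear_sum; apply: eq_bigr => i _.
  by rewrite linearZ.
by split=> [x|c]; [have [v ->] := sg x; exists v | ]; rewrite gE.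
Qed.

Lemma presents_iso_img n (A : 'M[S]_n) (M N : lmodType (R4 K)) h :
  iso M N -> presents (M := M) A h -> exists h', presents (M := N) A h'.
Proof.
move=> [g [g' gK g'K]] [gen ker]; exists (fun i => g (h i)).
have gE c : comb (fun i => g (h i) : resS N) c = g (comb h c : M).
  by rewrite linear_sum; apply: eq_bigr => i _; rewrite !resS_scaleE linearZ.
split=> [x|c]; first by have [c cE] := gen (g' x); exists c; rewrite gE -cE g'K.
rewrite gE -ker; split=> [g0|->]; last by rewrite linear0.
by apply: (can_inj gK); rewrite g0 linear0.
Qed.

Lemma presents_unit n (A P : 'M[S]_n) (M : lmodType (R4 K)) (h : 'I_n -> resS M) : P \in unitmx ->
    (forall x, exists c, x = comb h c) ->
    (forall c, comb h c = 0 <-> exists u, c = P *m A *m u) ->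
  exists h', presents (M := M) A h'.
Proof.
move=> uP gen ker; exists (fun j => comb h (col j P)); split=> [x|c].
  by have [c ->] := gen x; exists (invmx P *m c); rewrite -comb_mulmx mulKVmx.
rewrite -comb_mulmx ker; split=> -[u].
  by rewrite -mulmxA => /(can_inj (mulKmx uP)) ->; exists u.
by move=> ->; exists u; rewrite mulmxA.
Qed.

Definition irr_mx m n (A : 'M[S]_(m, n)) := forall i j, (A i j)@_0%MM = 0.

Lemma irr_mulmx m n (A : 'M[S]_(m, n)) u i : irr_mx A -> ((A *m u : 'cV_m) i 0)@_0%MM = 0.
Proof.
move=> A0; rewrite mxE raddf_sum big1 //= => j _.
by rewrite (rmorphM (mcoeff 0%MM)) /= A0 mul0r.
Qed.

Lemma presents_min n (A : 'M[S]_n) (M : lmodType (R4 K)) h : presents (M := M) A h -> irr_mx A ->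
  forall c, comb h c = 0 -> forall i, (c i 0)@_0%MM = 0.
Proof. by move=> [_ ker] A0 c /ker[u ->] i; exact: irr_mulmx. Qed.

(** Lifting the identity of M both ways gives P A = B Q, and P is left
    invertible modulo the irrelevant ideal because A is a minimal
    presentation. *)
Lemma presents_compare n m (A : 'M[S]_n) (B : 'M[S]_m) (M : lmodType (R4 K)) h g :
    presents (M := M) A h -> presents (M := M) B g -> irr_mx A ->
  exists P Q, P *m A = B *m Q /\ exists P', P' *m const_mx0 P = 1%:M.
Proof.
move=> pA pB A0; have [genh kerh] := pA; have [geng kerg] := pB.
have [P PE] := lift_gens h geng; have [P' PE'] := lift_gens g genh.
have /ex_choice[q qE] (j : 'I_n) : exists u, P *m col j A = B *m u.
  by apply/kerg; rewrite -PE; apply/kerh; exists (delta_mx j 0); rewrite colE.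
exists P, (\matrix_(i, j) q j i 0); split; last first.
  by exists (const_mx0 P'); apply: (lift_inverse (presents_min pA A0) PE' PE).
apply/matrixP => i j; have := congr1 (fun v : 'cV[S]_m => v i 0) (qE j).
rewrite !mxE => E; rewrite (eq_bigr (fun l => P i l * col j A l 0)) => [|l _].
  by rewrite E; apply: eq_bigr => l _; rewrite !mxE.
by rewrite mxE.
Qed.

Section Cokernel.
Variables (n : nat) (A B : 'M[S]_n).
Hypothesis AB : A *m B = f%:M.

Definition cokc (v : 'cV[S]_n) : Coker A := (\pi_(Coker A) v)%qT.

Lemma cokc_linear a u v : cokc (a *: u + v) = toR4 a *: cokc u + cokc v.
Proof.
rewrite /cokc raddfD; congr (_ + _); symmetry; exact: coker_scaleE.
Qed.

Lemma cokc_eq0 v : cokc v = 0 <-> exists u, v = A *m u.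
Proof.
have If p : (p \in (@f4_ideal K : pred S)) <-> exists q, p = q * f by split=> /asboolP.
rewrite -(coker_rel_mf If AB) /cokc; split=> [/eqP|vA].
  by rewrite -(raddf0 (\pi_(Coker A))%qT) -Quotient.idealrBE subr0.
apply/eqP; rewrite -[X in _ == X](raddf0 (\pi_(Coker A))%qT) -Quotient.idealrBE.
by rewrite subr0.
Qed.

Lemma Coker_presents : presents (M := Coker A) A (fun i => cokc (delta_mx i 0)).
Proof.
apply: presents_linear; [exact: cokc_linear | | exact: cokc_eq0].
by move=> x; exists (repr x); rewrite /cokc reprK.
Qed.

Lemma presents_iso (M : lmodType (R4 K)) h : presents (M := M) A h -> iso M (Coker A).
Proof.
move=> [gen ker]; have [cc ccE] := ex_choice gen.
have cokcB u v : cokc (u - v) = cokc u - cokc v.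
  by rewrite -[- v]scaleN1r addrC cokc_linear rmorphN rmorph1 scaleN1r addrC.
have FE c : cokc (cc (comb h c)) = cokc c.
  apply/eqP; rewrite -subr_eq0 -cokcB; apply/eqP/cokc_eq0/ker.
  by rewrite linearB /= -ccE subrr.
have lF : linear (fun x : M => cokc (cc x)).
  move=> a x y; have [p ->] := toR4_surj a.
  by rewrite -cokc_linear -[RHS]FE linearP /= -!ccE.
exists (linear_of lF); exists (fun y => comb h (repr y)) => [x|y] /=.
  rewrite [RHS]ccE; apply/eqP; rewrite -subr_eq0 -linearB; apply/eqP/ker/cokc_eq0.
  by rewrite cokcB /cokc reprK subrr.
by rewrite FE /cokc reprK.
Qed.
End Cokernel.

End Restriction.

(** * Cokernels of matrix factorizations are maximal Cohen-Macaulay *)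

Section CokerMCM.
Variable K : closedFieldType.
Notation S := {mpoly K[4]}.
Notation f := (f4 K).
Variables (n : nat) (A B : 'M[S]_n).
Hypotheses (AB : A *m B = f%:M) (BA : B *m A = f%:M).

Lemma cokc0 : cokc A 0 = 0. Proof. by apply/(cokc_eq0 AB); exists 0; rewrite mulmx0. Qed.

Lemma cokcZ p v : cokc A (p *: v) = toR4 p *: cokc A v.
Proof. by have := cokc_linear A p v 0; rewrite !addr0 cokc0 addr0. Qed.

Lemma cokcB u v : cokc A (u - v) = cokc A u - cokc A v.
Proof. by rewrite -[- v]scaleN1r addrC cokc_linear rmorphN rmorph1 scaleN1r addrC. Qed.

Lemma cokc_surj x : exists v, x = cokc A v.
Proof. by exists (repr x); rewrite /cokc reprK. Qed.

(** The image of A is a homogeneous submodule for the grading of S^n with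
    basis in the degrees d, since the columns of A are homogeneous. *)
Lemma coker_gradable (d c : 'I_n -> int) :
  (forall i j, homdeg (c j - d i) (A i j)) -> gradable (Coker A).
Proof.
move=> hA; exists (fun e m => exists v, twist d e v /\ m = cokc A v).
have [T0 TB TZ Tdec Tdir] := @twist_grading K n d.
have ckD u v : cokc A (u + v) = cokc A u + cokc A v.
  by have := cokc_linear A 1 u v; rewrite scale1r rmorph1 scale1r.
have ck_sum (s : seq int) (F : int -> 'cV[S]_n) :
    cokc A (\sum_(e <- s) F e) = \sum_(e <- s) cokc A (F e).
  exact: (big_morph _ ckD cokc0).
split.
- by move=> e; exists 0; split; [exact: T0 | rewrite cokc0].
- move=> e _ _ [u [Gu ->]] [v [Gv ->]]; exists (u - v); split; first exact: TB.
  by rewrite cokcB.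
- move=> e e' r _ [p [-> hp]] [v [Gv ->]]; exists (p *: v); split; last first.
    by rewrite cokcZ.
  apply: TZ => //; case: e hp => [k /dhomogP hp m|k ->]; last exact: homog0.
  by rewrite -mcoeff_msupp => /hp ->.
- move=> x; have [v ->] := cokc_surj x.
  have [s [w [Gw vE]]] := Tdec v.
  exists s, (fun e => cokc A (w e)); split; last by rewrite vE ck_sum.
  by move=> e; exists (w e).
- move=> s m us Gm m0 e es; have [w wP] := ex_choice Gm.
  have : cokc A (\sum_(x <- s) w x) = 0.
    by rewrite ck_sum -[RHS]m0; apply: eq_bigr => x _; have [_ <-] := wP x.
  move=> /(cokc_eq0 AB)[u wE]; have [_ ->] := wP e; apply/(cokc_eq0 AB).
  exists (twist_comp c e u).
  rewrite -(twist_comp_sum us (fun x => (wP x).1) es) wE.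
  apply/colP => i; rewrite !mxE raddf_sum; apply: eq_bigr => j _ /=.
  by rewrite (hcompM _ _ (hA i j)) mxE; congr (_ * hcomp _ _); ring.
Qed.

(** Reduction modulo X_1, ..., X_k. The variable X_0 is spared, so that f
    does not become zero but a polynomial containing X_0^3. *)
Definition kill_vars k (i : 'I_4) : S := if (0 < i <= k)%N then 0 else 'X_i.

Lemma kill_vars_ideal k (J : S^o -> Prop) p : submod J ->
  (forall i : 'I_4, (0 < i <= k)%N -> J 'X_i) -> subst (kill_vars k) p = 0 -> J p.
Proof.
move=> sJ JX p0; rewrite -[p]subr0 -p0; apply: subst_cong => // i; rewrite /kill_vars.
by case: ifP => [ik|_]; [rewrite subr0; exact: JX | rewrite subrr; exact: sJ.1].
Qed.

Lemma kill_vars_f4 k : subst (kill_vars k) f != 0.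
Proof.
apply/eqP => /(congr1 (mcoeff (U_(ord0) *+ 3)%MM)); rewrite mcoeff0 /f4 rmorph_sum raddf_sum /=.
rewrite (bigD1 ord0) //= rmorphXn /= substX /kill_vars /= mcoeffXn eqxx big1 => [/eqP|i i0].
  by rewrite addr0 oner_eq0.
rewrite rmorphXn /= substX; case: ifP => _; first by rewrite expr0n mcoeff0.
rewrite mcoeffXn; case: eqP => // /(congr1 (fun m : 'X_{1..4} => m ord0)).
by rewrite !mulmnE !mnmE (negbTE i0).
Qed.

Lemma subst_kill_vars_const k p : (subst (kill_vars k) p)@_0%MM = p@_0%MM.
Proof.
apply: (rmorph_mpoly_eq (g := mcoeff 0%MM \o subst (kill_vars k)) (h := mcoeff 0%MM)) => [c|i] /=.
  by rewrite substC.
rewrite substX /kill_vars; case: ifP => _ //; rewrite mcoeffX mcoeff0.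
by case: eqP => // /(congr1 (fun m : 'X_{1..4} => m i)); rewrite !mnmE eqxx.
Qed.

Definition xseq : seq (R4 K) := [:: toR4 'X_1; toR4 'X_2%:R; toR4 'X_3%:R].

Lemma xseqE k : (k < 3)%N -> xseq`_k = toR4 'X_(inord k.+1).
Proof.
by case: k => [|[|[|//]]] _ /=; congr (toR4 'X__); apply/val_inj; rewrite /= inordK.
Qed.

Lemma kill_varsS k p : (k < 3)%N -> subst (kill_vars k.+1) p = 0 ->
  exists g, subst (kill_vars k) (p - 'X_(inord k.+1) * g) = 0.
Proof.
move=> k3; set x : S := 'X__.
pose J (p : S^o) := exists g, subst (kill_vars k) (p - x * g : S) = 0.
apply: (@kill_vars_ideal _ J).
  split; first by exists 0; rewrite mulr0 subr0 rmorph0.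
  move=> a u v [g gE] [g' gE']; exists (a * g + g').
  have -> : a *: u + v - x * (a * g + g') = a * (u - x * g) + (v - x * g') :> S.
    by rewrite -[a *: u]/(a * u); ring.
  by rewrite rmorphD rmorphM /= gE gE' mulr0 addr0.
move=> i /andP[i0 ik]; have [ik'|ki] := leqP i k.
  by exists 0; rewrite mulr0 subr0 substX /kill_vars i0 ik'.
exists 1; rewrite mulr1 (_ : 'X_i = x) ?subrr ?rmorph0 //; congr 'X__.
by apply/val_inj; rewrite /= inordK ?ltnS //; apply/eqP; rewrite eqn_leq ik.
Qed.

Lemma kill_varsW k p : subst (kill_vars k) p = 0 -> subst (kill_vars k.+1) p = 0.
Proof.
move=> p0; apply: (@kill_vars_ideal k (fun q : S^o => subst (kill_vars k.+1) (q : S) = 0)) p0.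
  split=> [|a q q' q0 q'0]; first exact: rmorph0.
  transitivity (subst (kill_vars k.+1) a * subst (kill_vars k.+1) q + subst (kill_vars k.+1) q').
    by rewrite -rmorphM -rmorphD.
  by rewrite q0 q'0 mulr0 addr0.
by move=> i /andP[i0 ik]; rewrite substX /kill_vars i0 leqW.
Qed.

Lemma kill_vars_next k : (k < 3)%N -> subst (kill_vars k.+1) 'X_(inord k.+1) = 0.
Proof. by move=> k3; rewrite substX /kill_vars inordK ?ltnS // leqnn. Qed.

Lemma xM_cokc k v : (k <= 3)%N -> xM (M := Coker A) xseq k (cokc A v) <->
  exists u, forall i, subst (kill_vars k) ((v - A *m u) i 0) = 0.
Proof.
elim: k v => [|k IHk] v k3.
  rewrite xM0 (cokc_eq0 AB); split=> -[u uE]; exists u.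
    by move=> i; rewrite uE subrr mxE rmorph0.
  have kill0 p : subst (kill_vars 0) p = p.
    apply: (rmorph_mpoly_eq (g := subst (kill_vars 0)) (h := idfun)) => [c|i] /=.
      exact: substC.
    by rewrite substX /kill_vars; case: (i : nat).
  by apply/eqP; rewrite -subr_eq0; apply/eqP/colP => i; rewrite -[LHS]kill0 uE mxE.
rewrite xMS xseqE //; set x : S := 'X__.
have killx0 : subst (kill_vars k.+1) x = 0 by exact: kill_vars_next.
have xE w : cokc A v - toR4 x *: cokc A w = cokc A (v - x *: w) by rewrite cokcB cokcZ.
split=> [[w]|[u uE]].
  have [w' ->] := cokc_surj w; rewrite xE => /(IHk _ (ltnW k3))[u uE]; exists u => i.
  have := kill_varsW (uE i); move: (A *m u) => Au; rewrite !mxE !rmorphB rmorphM /= killx0 mul0r subr0.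
  by [].
have /ex_choice[g gE] i := kill_varsS k3 (uE i).
exists (cokc A (\col_i g i)); rewrite xE; apply/(IHk _ (ltnW k3)); exists u => i.
rewrite -[RHS](gE i); congr (subst _ _); rewrite -/x; move: (A *m u) => w.
by rewrite !mxE addrAC.
Qed.

Hypothesis A0 : irr_mx A.
Hypothesis n0 : (0 < n)%N.

(** If x v = A u modulo X_1, ..., X_k, multiplication by B gives f u = x B
    v, so f u vanishes modulo x as well. There f is nonzero, hence u is a
    multiple of x, and x can be cancelled. *)
Lemma coker_regular : regular_seq (Coker A) xseq.
Proof.
split=> [k y k3|].
  have [v ->] := cokc_surj y; rewrite xseqE //; set x : S := 'X__.
  have -> : toR4 x *: cokc A v = cokc A (x *: v) by rewrite cokcZ.
  move=> /(xM_cokc _ (ltnW k3))[u uE]; apply/(xM_cokc _ (ltnW k3)).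
  have u0 i : subst (kill_vars k.+1) (u i 0) = 0.
    have killx0 : subst (kill_vars k.+1) x = 0 by exact: kill_vars_next.
    have : subst (kill_vars k.+1) ((B *m (x *: v - A *m u)) i 0) = 0.
      rewrite mxE rmorph_sum big1 // => j _; rewrite rmorphM /=.
      by rewrite (kill_varsW (uE j)) mulr0.
    rewrite mulmxBr mulmxA BA mul_scalar_mx -scalemxAr.
    move: (B *m v) => Bv; rewrite !mxE rmorphB !rmorphM /= killx0 mul0r sub0r.
    by move/eqP; rewrite oppr_eq0 mulf_eq0 (negbTE (kill_vars_f4 _)) => /eqP.
  have /ex_choice[g gE] i := kill_varsS k3 (u0 i).
  exists (\col_i g i) => i.
  have x0 : subst (kill_vars k) x != 0.
    rewrite substX /kill_vars inordK ?ltnS // ltnn andbF -msize_poly_eq0 msizeX //.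
  apply: (mulfI x0); rewrite mulr0 -rmorphM /=.
  have -> : x * (v - A *m \col_i g i) i 0
      = (x *: v - A *m u) i 0 + (A *m (u - x *: \col_i g i)) i 0.
    rewrite mulmxBr -scalemxAr; move: (A *m _) (A *m _) => w w'.
    by rewrite !mxE; ring.
  rewrite rmorphD /= uE add0r mxE rmorph_sum big1 // => j _.
  have -> : (u - x *: \col_i g i) j 0 = u j 0 - x * g j by rewrite !mxE.
  by rewrite rmorphM /= gE mulr0.
pose i0 := Ordinal n0; exists (cokc A (delta_mx i0 0)) => /xM_cokc[] // u /(_ i0).
move/(congr1 (mcoeff 0%MM)); rewrite subst_kill_vars_const mcoeff0.
have := irr_mulmx u i0 A0; move: (A *m u) => w w0; rewrite !mxE eqxx mcoeffB w0.
by rewrite subr0 mcoeff1 eqxx => /eqP; rewrite oner_eq0.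
Qed.

Hypothesis charK : [pchar K] =i pred0.

Lemma coker_MCM : MCM (@R4_irr K) (Coker A).
Proof.
split.
  have [gen _] := Coker_presents AB.
  exists n, (fun i => cokc A (delta_mx i 0)) => x; have [c ->] := gen x.
  by exists (fun i => toR4 (c i 0)).
exists 3%N; split; first exact: krull_dim_R4.
split; last by move=> xs _; exact: regular_seq_size.
exists xseq; split=> //; last exact: coker_regular.
have irrX i : R4_irr (toR4 ('X_i : S)).
  apply/R4_irrP; rewrite mcoeffX; case: eqP => // /(congr1 (fun m : 'X_{1..4} => m i)).
  by rewrite !mnmE eqxx.
by move=> x; rewrite !inE => /or3P[]/eqP->; exact: irrX.
Qed.

End CokerMCM.

(** * Relations of a module with two generators; linear parts *)

Section Structure.
Variable K : closedFieldType.
Hypothesis charK : [pchar K] =i pred0.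
Notation S := {mpoly K[4]}.
Notation f := (f4 K).
Notation X := (fun i : 'I_4 => 'X_i : S).

(** The depth of M is the dimension of R4, so the module has a regular
    sequence of length 3 in the irrelevant ideal, each element of which is a
    combination of the variables. *)
Lemma MCM_exact (M : lmodType (R4 K)) : MCM (@R4_irr K) M ->
  exact_mod (fun v : resS M => v = 0) (kos2 X) (kos3 X).
Proof.
move=> [_ [d [/(krull_dim_R4_uniq charK)-> [[xs [irr [reg _] sz]] _]]]].
have [p pE] := ex_choice (fun k : nat => toR4_surj (xs`_k)).
pose N k (v : resS M) := xM (M := M) xs k v.
have sN k : submod (N k).
  have [N0 ND] := @submod_xM K M xs k.
  by split=> // a x y Nx Ny; rewrite resS_scaleE; apply: ND.
have exN : exact_mod (N 0%N) (kos2 X) (kos3 X).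
  apply: (koszul_regular (x := p) sN).
  - by move=> k v k3; rewrite resS_scaleE -pE; apply: reg; rewrite sz.
  - by move=> k v; exact: xMW.
  - by move=> k v; rewrite resS_scaleE -pE; exact: xM_mul.
  - by move=> k v /xMS[u uN]; exists u; rewrite resS_scaleE -pE.
  - move=> k k3; have /R4_irrP/irrelevant_expand[c cE] : R4_irr (toR4 (p k)).
      by rewrite -pE; apply: irr; rewrite mem_nth ?sz.
    by exists c; rewrite cE sum4E.
move=> a a0; have [i|b bP] := exN a; first by apply/xM0.
by exists b => i; have /xM0 := bP i.
Qed.

Lemma free_iso n (M : lmodType (R4 K)) (h : 'I_n -> resS M) :
    (forall x, exists c, x = comb h c) ->
    (forall c, comb h c = 0 -> exists w, c = f *: w) ->
  iso M 'rV[R4 K]_n.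
Proof.
move=> gen ker; apply: iso_sym.
have lg : linear (fun r : 'rV[R4 K]_n => \sum_i r 0 i *: (h i : M)).
  move=> a x y; rewrite scaler_sumr -big_split; apply: eq_bigr => i _.
  by rewrite !mxE scalerDl scalerA.
have gE (c : 'cV[S]_n) : linear_of lg (\row_i toR4 (c i 0)) = comb h c.
  by apply: eq_bigr => i _; rewrite mxE.
have lift (r : 'rV[R4 K]_n) : exists c : 'cV[S]_n, r = \row_i toR4 (c i 0).
  have [p pE] := ex_choice (fun i => toR4_surj (r 0 i)).
  by exists (\col_i p i); apply/rowP => i; rewrite !mxE pE.
have inj r : linear_of lg r = 0 -> r = 0.
  have [c ->] := lift r; rewrite gE => /ker[w ->].
  by apply/rowP => i; rewrite !mxE rmorphM /= toR4_f mul0r.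
have surj x : exists r, linear_of lg r = x.
  by have [c ->] := gen x; exists (\row_i toR4 (c i 0)); rewrite gE.
have [g' g'E] := ex_choice surj.
exists (linear_of lg); exists g' => [r|x]; last exact: g'E.
by apply/eqP; rewrite -subr_eq0; apply/eqP/inj; rewrite linearB g'E subrr.
Qed.

Lemma free_presents n (M : lmodType (R4 K)) : iso M 'rV[R4 K]_n ->
  exists g, presents (f%:M : 'M_n) (M := M) g.
Proof.
move=> /iso_sym iM; pose g (v : 'cV[S]_n) : 'rV[R4 K]_n := \row_i toR4 (v i 0).
have pg : presents f%:M (fun i => g (delta_mx i 0) : resS 'rV[R4 K]_n).
  apply: presents_linear.
  - by move=> a u v; apply/rowP => i; rewrite !mxE rmorphD rmorphM.
  - move=> r; have [p pE] := ex_choice (fun i => toR4_surj (r 0 i)).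
    by exists (\col_i p i); apply/rowP => i; rewrite !mxE pE.
  - move=> v; split=> [/rowP v0|[u ->]]; last first.
      by apply/rowP => i; rewrite mul_scalar_mx !mxE rmorphM /= toR4_f mul0r.
    have /ex_choice[w wE] i : exists w, v i 0 = w * f.
      by apply/toR4_eq0; have := v0 i; rewrite !mxE.
    by exists (\col_i w i); rewrite mul_scalar_mx; apply/colP => i; rewrite !mxE wE mulrC.
exact: presents_iso_img iM pg.
Qed.

Lemma factor_f2 (x y : S) : x * y = f ^+ 2 ->
  [\/ x \is a GRing.unit, y \is a GRing.unit | exists2 u, u \is a GRing.unit & x = u * f].
Proof.
move=> xy; have f0 := f4_neq0 K.
have inv (u v : S) : u * v = 1 -> u \is a GRing.unit.
  by move=> uv; apply/unitrPr; exists v.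
have half (z w : S) : z * w * f = f ^+ 2 -> z * w = f.
  by rewrite expr2 => /(mulIf f0).
have one (z w : S) : z * w * f = f -> z * w = 1.
  by rewrite -[RHS]mul1r => /(mulIf f0).
have [|[u xE]|[u yE]] := f4_prime charK (p := x) (q := y); first by exists f; rewrite xy expr2.
  have uy : u * y = f by apply: half; rewrite -xy xE mulrAC.
  have [|[v uE]|[v yE]] := f4_prime charK (p := u) (q := y); first by exists 1; rewrite mul1r.
    by constructor 2; apply: (inv _ v); rewrite mulrC; apply: one; rewrite -[RHS]uy uE mulrAC.
  constructor 3; exists u => //; apply: (inv _ v); apply: one; by rewrite -[RHS]uy yE mulrA.
have xu : x * u = f by apply: half; rewrite -xy yE mulrA.
have [|[v xE]|[v uE]] := f4_prime charK (p := x) (q := u); first by exists 1; rewrite mul1r.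
  constructor 3; exists v => //; apply: (inv _ u); apply: one; by rewrite -[RHS]xu xE mulrAC.
constructor 1; apply: (inv _ v); apply: one; by rewrite -[RHS]xu uE mulrA.
Qed.

(** By [free_syzygy] the relations are the image of a factor A of f. Its
    determinant is not a unit, its entries being in the irrelevant ideal. If
    det B is a unit, the image of A is f S^2 and M is free. So det A is f up
    to a unit, and [classify_matrix] applies. *)
Lemma two_gens_relations (M : lmodType (R4 K)) G (h : 'I_2 -> resS M) (d : 'I_2 -> int) :
    grading (@R4_deg K) G -> MCM (@R4_irr K) M -> ~ fin_free M ->
    (forall j, G (d j) (h j)) -> (forall x, exists c, x = comb h c) ->
    (forall c, comb h c = 0 -> forall i, (c i 0)@_0%MM = 0) ->
  exists A P, [/\ famM A \/ famN A, P \in unitmx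
    & forall c, comb h c = 0 <-> exists u, c = P *m A *m u].
Proof.
move=> grG mcm nfree Gh gen minh.
have f_point : exists x : 'I_4 -> K, f.@[x] != 0.
  exists (fun i => if i == 0 then 1 else 0); rewrite meval_f4 (bigD1 0) //= expr1n.
  rewrite big1 ?addr0 ?oner_neq0 // => i /negbTE->; by rewrite expr0n.
have [A [B [e [hA A0 AB BA ker]]]] := free_syzygy charK (resS_grading grG) Gh gen
  (MCM_exact mcm) (@resS_kill K M) f_point minh.
have detAB : \det A * \det B = f ^+ 2 by rewrite -det_mulmx AB det_scalar.
have [uA|uB|[u uu detA]] := factor_f2 detAB.
- case/negP: (oner_neq0 K); have : (\det A)@_0%MM = 0.
    rewrite [A]mat2E det_mat2 mcoeffB !(rmorphM (mcoeff 0%MM)) /= !A0 !mul0r subr0 //.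
  move=> d0; have := rmorph_unit (mcoeff 0%MM) uA; rewrite /= d0 unitr0 //.
- case: nfree; exists 2; apply: (free_iso gen) => c /ker[u ->].
  exists (invmx B *m u); rewrite scalemxAl.
  by rewrite -mul_scalar_mx -AB mulmxK ?unitmxE.
have [B' [famB' [P [Q [uP uQ B'E]]]]] := classify_matrix charK hA A0 uu detA.
exists B', (invmx P); split=> //; first by rewrite unitmx_inv.
have AE : invmx P *m B' = A *m Q by rewrite B'E -(mulmxA P A Q) (mulKmx uP).
move=> c; rewrite ker AE; split=> -[w ->].
  by exists (invmx Q *m w); rewrite -mulmxA mulKVmx.
by exists (Q *m w); rewrite mulmxA.
Qed.

Lemma mcoeffU_M (x y : S) i :
  (x * y)@_U_(i) = x@_0%MM * y@_U_(i) + x@_U_(i) * y@_0%MM.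
Proof.
have E (z : S) : z@_U_(i) = (z^`M(i))@_0%MM.
  by rewrite mcoeff_deriv mnm0E mulr1n add0m.
by rewrite !E mderivM mcoeffD !(rmorphM (mcoeff 0%MM)) /= addrC.
Qed.

Definition linear_part (k : 'I_4) m n (A : 'M[S]_(m, n)) : 'M[K]_(m, n) :=
  map_mx (mcoeff U_(k)) A.

(** Entries without constant term: the linear part of a product only sees
    the constant part of the other factor. *)
Lemma linear_part_mulmx k m n p (P : 'M[S]_(m, n)) (A : 'M[S]_(n, p)) (B : 'M[S]_(m, n)) (Q : 'M[S]_(n, p)) :
  irr_mx A -> irr_mx B -> P *m A = B *m Q ->
  const_mx0 P *m linear_part k A = linear_part k B *m const_mx0 Q.
Proof.
move=> A0 B0 E; apply/matrixP => i j.
have := congr1 (fun M : 'M[S]_(m, p) => (M i j)@_U_(k)) E; rewrite !mxE !raddf_sum /=.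
rewrite (eq_bigr (fun l => const_mx0 P i l * linear_part k A l j)) => [->|l _].
  by apply: eq_bigr => l _; rewrite mcoeffU_M B0 mul0r add0r !mxE.
by rewrite mcoeffU_M A0 mulr0 addr0 !mxE.
Qed.

(** The coefficient of X_k in X_0 - a X_s. *)
Definition linX0_coef (s : 'I_4) (a : K) (k : 'I_4) : K := (0 == k)%:R - a * (s == k)%:R.
(** The coefficient of X_k in X_i - b X_j. *)
Definition linXi_coef (i j : 'I_4) (b : K) (k : 'I_4) : K := (i == k)%:R - b * (j == k)%:R.

Lemma linX0_coefE s a k : ('X_0 - a *: 'X_s : S)@_U_(k) = linX0_coef s a k.
Proof. by rewrite mcoeffB mcoeffZ !mcoeffXU. Qed.
Lemma linXi_coefE i j b k : ('X_i - b *: 'X_j : S)@_U_(k) = linXi_coef i j b k.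
Proof. by rewrite mcoeffB mcoeffZ !mcoeffXU. Qed.

Lemma homog_quadric (x y : 'I_4) (c : K) :
  homdeg 2 ('X_x ^+ 2 + c *: ('X_x * 'X_y) + c ^+ 2 *: 'X_y ^+ 2 : S).
Proof.
have X2 t : homdeg 2 ('X_t ^+ 2 : S) by exact: (@homogXn _ _ 1 _ 2 (@homogX _ _ t)).
have XY : homdeg 2 ('X_x * 'X_y : S) by exact: (homogM (@homogX _ _ x) (@homogX _ _ y)).
by apply: homogD; [apply: homogD => //; exact: homogZ | exact: homogZ].
Qed.

Lemma quadric_linear_coef (x y : 'I_4) (c : K) k :
  ('X_x ^+ 2 + c *: ('X_x * 'X_y) + c ^+ 2 *: 'X_y ^+ 2 : S)@_U_(k) = 0.
Proof. by apply/eqP; apply: contraT => /homog_quadric; rewrite mdeg1. Qed.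

Lemma linear_part_phi i j s a b k : linear_part k (phi i j s a b) =
  \matrix_(r, t) if t == 0 then (if r == 0 then linX0_coef s a k else linXi_coef i j b k) else 0.
Proof.
apply/matrixP => r t; rewrite !mxE.
have [->|->] := ord2P r; have [->|->] := ord2P t; rewrite /=.
- exact: linX0_coefE.
- by rewrite mcoeffN quadric_linear_coef oppr0.
- exact: linXi_coefE.
- exact: quadric_linear_coef.
Qed.

Lemma linear_part_psi i j s a b k : linear_part k (psi i j s a b) =
  \matrix_(r, t) if r == 0 then 0 else (if t == 0 then - linXi_coef i j b k else linX0_coef s a k).
Proof.
apply/matrixP => r t; rewrite !mxE.
have [->|->] := ord2P r; have [->|->] := ord2P t; rewrite /=.
- exact: quadric_linear_coef.
- exact: quadric_linear_coef.
- by rewrite mcoeffN linXi_coefE.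
- exact: linX0_coefE.
Qed.

Lemma lin_coefs_free i j s a b (x y : K) : uniq [:: 0; s; i; j] ->
  (forall k, x * linX0_coef s a k + y * linXi_coef i j b k = 0) -> x = 0 /\ y = 0.
Proof.
rewrite /= !inE !negb_or => /and4P[/and3P[s0 i0 j0] /andP[si sj] ij _] E; split.
  have := E 0; rewrite /linX0_coef /linXi_coef eqxx ![_ == 0]eq_sym (negbTE s0) (negbTE i0) (negbTE j0).
  by rewrite !mulr0 !subr0 mulr1 mulr0 addr0.
have := E i; rewrite /linX0_coef /linXi_coef eqxx (negbTE i0) (negbTE si) [j == i]eq_sym (negbTE ij).
by rewrite !mulr0 !subr0 mulr1 mulr0 add0r.
Qed.

(** The span of X_0 - a X_s and X_i - b X_j contains a single form in which
    X_0 has coefficient 1 and no third variable occurs, and a single one, up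
    to scalars, without X_0. *)
Lemma same_span i j s a b i' j' s' a' b' (x y z w : K) :
    admissible i j s a b -> admissible i' j' s' a' b' ->
    (forall k, linX0_coef s' a' k = x * linX0_coef s a k + y * linXi_coef i j b k) ->
    (forall k, linXi_coef i' j' b' k = z * linX0_coef s a k + w * linXi_coef i j b k) ->
  [/\ i' = i, j' = j, s' = s, a' = a & b' = b].
Proof.
move=> [ij ijs a3 b3] [ij' ijs' a3' b3'] E1 E2.
have nz (c : K) : c ^+ 3 = -1 -> c != 0.
  by move=> c3; apply: contra_eq_neq c3 => ->; rewrite expr0n eq_sym oppr_eq0 oner_eq0.
have := set3_uniq ijs ij; rewrite /= !inE !negb_or => /and4P[/and3P[s0 i0 j0] /andP[si sj] ijn _].
have := set3_uniq ijs' ij'; rewrite /= !inE !negb_or => /and4P[/and3P[s0' i0' j0'] /andP[si' sj'] ijn' _].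
have x1 : x = 1.
  have := E1 0; rewrite /linX0_coef /linXi_coef eqxx ![_ == 0]eq_sym.
  rewrite (negbTE s0) (negbTE i0) (negbTE j0) (negbTE s0').
  by rewrite !mulr0 !subr0 mulr1 mulr0 addr0.
have := E1 s; rewrite x1 mul1r /linX0_coef /linXi_coef eqxx (negbTE s0) ![_ == s]eq_sym (negbTE si) (negbTE sj).
rewrite !mulr0 !subr0 !sub0r mulr1 mulr0 addr0 => /eqP; rewrite eqr_opp.
have [ss' /eqP aa|ss'] := eqVneq s s'; last by rewrite mulr0 eq_sym (negbTE (nz _ a3)).
rewrite mulr1 in aa.
have z0 : z = 0.
  have := E2 0; rewrite /linX0_coef /linXi_coef eqxx ![_ == 0]eq_sym.
  rewrite (negbTE s0) (negbTE i0) (negbTE j0) (negbTE i0') (negbTE j0').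
  by rewrite !mulr0 !subr0 mulr1 mulr0 addr0.
have mE k : linXi_coef i' j' b' k = w * linXi_coef i j b k by rewrite E2 z0 mul0r add0r.
have in1 : (i' == i) || (i' == j).
  apply: contraT; rewrite negb_or => /andP[n1 n2]; have := mE i'.
  rewrite /linXi_coef eqxx [j' == _]eq_sym (negbTE ijn') ![_ == i']eq_sym (negbTE n1) (negbTE n2).
  by rewrite !mulr0 !subr0 mulr0 => /eqP; rewrite oner_eq0.
have in2 : (j' == i) || (j' == j).
  apply: contraT; rewrite negb_or => /andP[n1 n2]; have := mE j'.
  rewrite /linXi_coef eqxx (negbTE ijn') ![_ == j']eq_sym (negbTE n1) (negbTE n2).
  by rewrite !mulr0 subr0 mulr0 sub0r mulr1 => /eqP; rewrite oppr_eq0 (negbTE (nz _ b3')).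
have [ii jj] : i' = i /\ j' = j.
  have ji : (j <= i)%N = false by rewrite leqNgt ij.
  move: in1 in2 ij' => /orP[]/eqP-> /orP[]/eqP-> //.
  - by rewrite ltnn.
  - by move=> /ltnW; rewrite ji.
  - by rewrite ltnn.
subst i' j'; have w1 : w = 1.
  have := mE i; rewrite /linXi_coef eqxx [j == i]eq_sym (negbTE ijn).
  by rewrite !mulr0 !subr0 mulr1 => <-.
split=> //; have := mE j; rewrite w1 mul1r /linXi_coef eqxx (negbTE ijn).
by rewrite !sub0r !mulr1 => /eqP; rewrite eqr_opp => /eqP.
Qed.

Lemma mul_mx2 (P A : 'M[K]_2) i j : (P *m A) i j = P i 0 * A 0 j + P i 1 * A 1 j.
Proof.
by rewrite mxE !big_ord_recl big_ord0 addr0; congr (_ + P i _ * A _ j); apply/val_inj.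
Qed.

End Structure.

(** * The two families *)

Section Families.
Variable K : closedFieldType.
Hypothesis charK : [pchar K] =i pred0.
Notation S := {mpoly K[4]}.
Notation f := (f4 K).

Lemma phi_degrees i j s (a b : K) : exists d c : 'I_2 -> int,
  forall r t, homdeg (c t - d r) (phi i j s a b r t).
Proof.
exists (fun=> 0), (fun t => if t == 0 then 1 else 2) => r t.
have [->|->] := ord2P r; have [->|->] := ord2P t; rewrite mxE /= subr0.
- exact: homog_binomial.
- by apply: homogN; exact: homog_quadric.
- exact: homog_binomial.
- exact: homog_quadric.
Qed.

Lemma psi_degrees i j s (a b : K) : exists d c : 'I_2 -> int,
  forall r t, homdeg (c t - d r) (psi i j s a b r t).
Proof.
exists (fun r => if r == 0 then 0 else 1), (fun=> 2) => r t.
have [->|->] := ord2P r; have [->|->] := ord2P t; rewrite mxE /= ?subr0.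
- exact: homog_quadric.
- exact: homog_quadric.
- by apply: homogN; exact: homog_binomial.
- exact: homog_binomial.
Qed.

Lemma phi_irr i j s (a b : K) : irr_mx (phi i j s a b).
Proof.
move=> r t; have [->|->] := ord2P r; have [->|->] := ord2P t; rewrite mxE /= ?mcoeffN.
- exact: (homog_coef0 (@homog_binomial _ _ _ _)).
- by rewrite (homog_coef0 (@homog_quadric _ _ _ _)) // oppr0.
- exact: (homog_coef0 (@homog_binomial _ _ _ _)).
- exact: (homog_coef0 (@homog_quadric _ _ _ _)).
Qed.

Lemma psi_irr i j s (a b : K) : irr_mx (psi i j s a b).
Proof.
move=> r t; have [->|->] := ord2P r; have [->|->] := ord2P t; rewrite mxE /= ?mcoeffN.
- exact: (homog_coef0 (@homog_quadric _ _ _ _)).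
- exact: (homog_coef0 (@homog_quadric _ _ _ _)).
- by rewrite (homog_coef0 (@homog_binomial _ _ _ _)) // oppr0.
- exact: (homog_coef0 (@homog_binomial _ _ _ _)).
Qed.

Lemma fam_factorization (A : 'M[S]_2) : famM A \/ famN A ->
  [/\ irr_mx A, exists B, A *m B = f%:M /\ B *m A = f%:M
    & exists d c : 'I_2 -> int, forall r t, homdeg (c t - d r) (A r t)].
Proof.
case=> -[i [j [s [a [b [adm ->]]]]]]; have [phipsi psiphi _] := phi_psi adm.
  by split; [exact: phi_irr | exists (psi i j s a b) | exact: phi_degrees].
by split; [exact: psi_irr | exists (phi i j s a b) | exact: psi_degrees].
Qed.

Lemma fam_graded_MCM (A : 'M[S]_2) : famM A \/ famN A -> graded_MCM (Coker A).
Proof.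
move=> /fam_factorization[A0 [B [AB BA]] [d [c hA]]].
split; first exact: (coker_gradable AB hA).
exact: (coker_MCM AB BA A0).
Qed.

(** Let P A = B Q compare the two presentations and reduce P and Q modulo
    the irrelevant ideal. The linear entries of phi form its first column
    and those of psi its second row, so between phi and psi the first row of
    P would be a relation between independent forms. Within a family, the
    linear forms of A and B span the same space. *)
Lemma fam_distinct (A B : 'M[S]_2) (M : lmodType (R4 K)) h g :
    famM A \/ famN A -> famM B \/ famN B ->
    presents (M := M) A h -> presents (M := M) B g -> A = B.
Proof.
have mixed i j s (a b : K) i' j' s' a' b' (N : lmodType (R4 K)) h' g' :
    admissible i j s a b -> presents (M := N) (phi i j s a b) h' ->
    presents (M := N) (psi i' j' s' a' b') g' -> False.
  move=> adm pA pB; have [ij ijs _ _] := adm.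
  have [P [Q [PQ [P' P'P]]]] := presents_compare pA pB (@phi_irr _ _ _ _ _).
  have E k := linear_part_mulmx k (@phi_irr _ _ _ _ _) (@psi_irr _ _ _ _ _) PQ.
  have [p00 p01] : const_mx0 P 0 0 = 0 /\ const_mx0 P 0 1 = 0.
    apply: (lin_coefs_free (a := a) (b := b) (set3_uniq ijs ij)) => k.
    have := congr1 (fun M : 'M[K]_2 => M 0 0) (E k).
    by rewrite /= !mul_mx2 linear_part_phi linear_part_psi !mxE /= !mul0r addr0.
  have /eqP := congr1 (fun M : 'M[K]_2 => M 0 0) (mulmx1C P'P).
  by rewrite /= mul_mx2 p00 p01 !mul0r addr0 mxE eqxx eq_sym oner_eq0.
move=> famA famB pA pB; case: famA famB pA pB.
  move=> [i [j [s [a [b [adm ->]]]]]] [] [i' [j' [s' [a' [b' [adm' ->]]]]]] pA pB; last first.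
    by case: (mixed _ _ _ _ _ _ _ _ _ _ _ _ _ adm pA pB).
  have [ij ijs _ _] := adm.
  have [P [Q [PQ [P' P'P]]]] := presents_compare pA pB (@phi_irr _ _ _ _ _).
  have E k := linear_part_mulmx k (@phi_irr _ _ _ _ _) (@phi_irr _ _ _ _ _) PQ.
  move: (const_mx0 P) (const_mx0 Q) E P'P => p Q0 E P'P {PQ P Q}; set q := Q0 0 0.
  have E0 k : p 0 0 * linX0_coef s a k + p 0 1 * linXi_coef i j b k = linX0_coef s' a' k * q.
    have := congr1 (fun M : 'M[K]_2 => M 0 0) (E k).
    by rewrite /= !mul_mx2 !linear_part_phi !mxE /= mul0r addr0 -/q.
  have E1 k : p 1 0 * linX0_coef s a k + p 1 1 * linXi_coef i j b k = linXi_coef i' j' b' k * q.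
    have := congr1 (fun M : 'M[K]_2 => M 1 0) (E k).
    by rewrite /= !mul_mx2 !linear_part_phi !mxE /= mul0r addr0 -/q.
  have q0 : q != 0.
    apply/eqP => q0; have [p00 p01] : p 0 0 = 0 /\ p 0 1 = 0.
      apply: (lin_coefs_free (a := a) (b := b) (set3_uniq ijs ij)) => k.
      by rewrite E0 q0 mulr0.
    have /eqP := congr1 (fun M : 'M[K]_2 => M 0 0) (mulmx1C P'P).
    by rewrite /= mul_mx2 p00 p01 !mul0r addr0 mxE eqxx eq_sym oner_eq0.
  have [||-> -> -> -> ->] // := @same_span K i j s a b i' j' s' a' b'
    (p 0 0 / q) (p 0 1 / q) (p 1 0 / q) (p 1 1 / q) adm adm'.
    by move=> k; apply: (mulIf q0); rewrite -E0; field.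
  by move=> k; apply: (mulIf q0); rewrite -E1; field.
move=> [i [j [s [a [b [adm ->]]]]]] [] [i' [j' [s' [a' [b' [adm' ->]]]]]] pA pB.
  by case: (mixed _ _ _ _ _ _ _ _ _ _ _ _ _ adm' pB pA).
have [P [Q [PQ [P' P'P]]]] := presents_compare pA pB (@psi_irr _ _ _ _ _).
have E k := linear_part_mulmx k (@psi_irr _ _ _ _ _) (@psi_irr _ _ _ _ _) PQ.
move: (const_mx0 P) (const_mx0 Q) E P'P => p q E P'P {PQ P Q}.
have p01 : p 0 1 = 0.
  have := congr1 (fun M : 'M[K]_2 => M 0 1) (E 0).
  rewrite /= !mul_mx2 !linear_part_psi !mxE /= !mul0r mulr0 !add0r /linX0_coef eqxx.
  have := set3_uniq (let: And4 _ x _ _ := adm in x) (let: And4 x _ _ _ := adm in x).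
  rewrite /= inE => /andP[/norP[s0 _] _].
  by rewrite [s == 0]eq_sym (negbTE s0) mulr0 subr0 mulr1.
have p11 : p 1 1 != 0.
  apply/eqP => p11; have /eqP := congr1 (fun M : 'M[K]_2 => M 1 1) P'P.
  by rewrite /= mul_mx2 p11 p01 !mulr0 addr0 mxE eqxx eq_sym oner_eq0.
have E0 k : p 1 1 * linXi_coef i j b k = linXi_coef i' j' b' k * q 0 0 - linX0_coef s' a' k * q 1 0.
  have := congr1 (fun M : 'M[K]_2 => M 1 0) (E k).
  rewrite /= !mul_mx2 !linear_part_psi !mxE /= mulr0 add0r mulrN => H.
  by apply: oppr_inj; rewrite H; ring.
have E1 k : p 1 1 * linX0_coef s a k = - (linXi_coef i' j' b' k * q 0 1) + linX0_coef s' a' k * q 1 1.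
  have := congr1 (fun M : 'M[K]_2 => M 1 1) (E k).
  by rewrite /= !mul_mx2 !linear_part_psi !mxE /= mulr0 add0r mulNr.
have [||-> -> -> -> ->] // := @same_span K i' j' s' a' b' i j s a b
  (q 1 1 / p 1 1) (- q 0 1 / p 1 1) (- q 1 0 / p 1 1) (q 0 0 / p 1 1) adm' adm.
  by move=> k; apply: (mulfI p11); rewrite E1; field.
by move=> k; apply: (mulfI p11); rewrite E0; field.
Qed.

Lemma fam_lin_neq0 (A : 'M[S]_2) : famM A \/ famN A -> linear_part 0 A != 0.
Proof.
case=> -[i [j [s [a [b [[ij ijs _ _] ->]]]]]]; apply/eqP.
all: have := set3_uniq ijs ij; rewrite /= inE => /andP[/norP[s0 _] _].
all: have l0 : linX0_coef s a 0 = 1 by rewrite /linX0_coef eqxx [s == 0]eq_sym (negbTE s0) mulr0 subr0.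
  move=> /(congr1 (fun M : 'M[K]_2 => M 0 0)).
  by rewrite linear_part_phi !mxE /= l0 => /eqP; rewrite oner_eq0.
move=> /(congr1 (fun M : 'M[K]_2 => M 1 1)).
by rewrite linear_part_psi !mxE /= l0 => /eqP; rewrite oner_eq0.
Qed.

Lemma scalar_irr n : irr_mx (f%:M : 'M[S]_n).
Proof. by move=> r t; rewrite mxE; case: (r == t); rewrite ?mulr1n ?mulr0n ?mcoeff0 ?f4_const. Qed.

Lemma presents_size n m (A : 'M[S]_n) (B : 'M[S]_m) (M : lmodType (R4 K)) h g :
  irr_mx A -> irr_mx B -> presents (M := M) A h -> presents (M := M) B g -> n = m.
Proof.
move=> A0 B0 pA pB; apply/eqP; rewrite eqn_leq.
rewrite (min_gens_le pA.1 (presents_min pA A0) pB.1).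
by rewrite (min_gens_le pB.1 (presents_min pB B0) pA.1).
Qed.

(** A free module of rank n is presented by f I_n, which has no linear part. *)
Lemma fam_not_free (A : 'M[S]_2) (M : lmodType (R4 K)) h :
  famM A \/ famN A -> presents (M := M) A h -> ~ fin_free M.
Proof.
move=> famA pA [n /free_presents[g pF]]; have [A0 _ _] := fam_factorization famA.
have n2 := presents_size A0 (@scalar_irr n) pA pF; subst n.
have [P [Q [PQ [P' P'P]]]] := presents_compare pA pF A0.
have := linear_part_mulmx 0 A0 (@scalar_irr 2) PQ.
have -> : linear_part 0 (f%:M : 'M[S]_2) = 0.
  apply/matrixP => r t; rewrite !mxE; case: (r == t); rewrite ?mulr1n ?mulr0n ?mcoeff0 //.
  by apply/eqP; apply: contraT => /f4_homog; rewrite mdeg1.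
rewrite mul0mx => /(congr1 (mulmx P')); rewrite mulmxA P'P mul1mx mulmx0 => /eqP.
by rewrite (negbTE (fam_lin_neq0 famA)).
Qed.

Lemma generated_comb (M : lmodType (R4 K)) n : generated_by M n ->
  exists g : 'I_n -> resS M, forall x, exists c, x = comb g c.
Proof.
move=> [g gen]; exists g => x; have [c ->] := gen x.
have [p pE] := ex_choice (fun i => toR4_surj (c i)).
by exists (\col_i p i); apply: eq_bigr => i _; rewrite mxE pE.
Qed.

Lemma comb_generated (M : lmodType (R4 K)) n (g : 'I_n -> resS M) :
  (forall x, exists c, x = comb g c) -> generated_by M n.
Proof. by move=> gen; exists g => x; have [c ->] := gen x; exists (fun i => toR4 (c i 0)). Qed.

Lemma graded_min_gens (M : lmodType (R4 K)) G : grading (@R4_deg K) G ->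
    (exists n, generated_by M n) ->
  exists n (h : 'I_n -> resS M) (d : 'I_n -> int),
  [/\ forall i, G (d i) (h i), forall x, exists c, x = comb h c
    & forall c, comb h c = 0 -> forall i, (c i 0)@_0%MM = 0].
Proof.
move=> grG [m /generated_comb[g geng]].
have [||n [h [d [Gh _ gen minh]]]] := @min_homog_gens _ _ _ _ (resS_grading grG) (fun=> True).
- by [].
- exists (codom g); split=> // J sJ Jg x _; have [c ->] := geng x.
  apply: (submod_sum sJ) => i _; apply: (submodZ sJ); apply: Jg; exact: codom_f.
by exists n, h, d; split=> // x; exact: gen.
Qed.

Lemma two_generated (M : lmodType (R4 K)) : graded_MCM M -> min_gens M 2 -> ~ fin_free M ->
  exists A : 'M[S]_2, (famM A \/ famN A) /\ iso M (Coker A).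
Proof.
move=> [[G grG] mcm] [gen2 min2] nfree.
have [n [h [d [Gh genh minh]]]] := graded_min_gens grG mcm.1.
have [g geng] := generated_comb gen2.
have n2 : n = 2%N.
  by apply/eqP; rewrite eqn_leq (min_gens_le genh minh geng) (min2 _ (comb_generated genh)).
subst n; have [A [P [famA uP ker]]] := two_gens_relations charK grG mcm nfree Gh genh minh.
have [h' pA] := presents_unit uP genh ker.
have [_ [B [AB _]] _] := fam_factorization famA.
by exists A; split=> //; exact: (presents_iso AB pA).
Qed.

Lemma not_iso (A B : 'M[S]_2) : famM A \/ famN A -> famM B \/ famN B -> A <> B ->
  ~ iso (Coker A) (Coker B).
Proof.
move=> famA famB nAB isoAB; apply: nAB.
have [_ [A' [AA' _]] _] := fam_factorization famA; have [_ [B' [BB' _]] _] := fam_factorization famB.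
have [h pA] := presents_iso_img isoAB (Coker_presents AA').
exact: fam_distinct famA famB pA (Coker_presents BB').
Qed.

End Families.

(** * First syzygies *)

Section Syzygy.
Variable K : closedFieldType.
Hypothesis charK : [pchar K] =i pred0.
Notation S := {mpoly K[4]}.
Notation f := (f4 K).

(** The universal property of the cokernel. *)
Lemma presents_lift n (A : 'M[S]_n) (M N : lmodType (R4 K)) h (g : 'cV[S]_n -> N) :
    presents (M := M) A h ->
    (forall a u v, g (a *: u + v) = toR4 a *: g u + g v) ->
    (forall u, g (A *m u) = 0) ->
  exists F : {linear M -> N}, forall c, F (comb h c) = g c.
Proof.
move=> [gen ker] lg gA; have [cc ccE] := ex_choice gen.
have gB u v : g (u - v) = g u - g v.
  by rewrite -[- v]scaleN1r addrC lg rmorphN rmorph1 scaleN1r addrC.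
have FE c : g (cc (comb h c)) = g c.
  apply/eqP; rewrite -subr_eq0 -gB; apply/eqP.
  have /ker[u ->] : comb h (cc (comb h c) - c) = 0; last exact: gA.
  by rewrite linearB /= -ccE subrr.
have lF : linear (fun x : M => g (cc x)).
  move=> a x y; have [p ->] := toR4_surj a.
  by rewrite -lg -[RHS]FE linearP /= -!ccE.
by exists (linear_of lF) => c; exact: FE.
Qed.

Definition rowR4 n (c : 'cV[S]_n) : 'rV[R4 K]_n := \row_i toR4 (c i 0).

Lemma rowR4_linear n a (u v : 'cV[S]_n) : rowR4 (a *: u + v) = toR4 a *: rowR4 u + rowR4 v.
Proof. by apply/rowP => i; rewrite !mxE rmorphD rmorphM. Qed.

Lemma rowR4_surj n (r : 'rV[R4 K]_n) : exists c, r = rowR4 c.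
Proof.
have [p pE] := ex_choice (fun i => toR4_surj (r 0 i)).
by exists (\col_i p i); apply/rowP => i; rewrite !mxE pE.
Qed.

Lemma rowR4_eq0 n (c : 'cV[S]_n) : rowR4 c = 0 <-> exists w, c = f *: w.
Proof.
split=> [/rowP c0|[w ->]]; last by apply/rowP => i; rewrite !mxE rmorphM /= toR4_f mul0r.
have /ex_choice[w wE] i : exists w, c i 0 = w * f.
  by apply/toR4_eq0; have := c0 i; rewrite !mxE.
by exists (\col_i w i); apply/colP => i; rewrite !mxE wE mulrC.
Qed.

Variables (A B : 'M[S]_2).
Hypotheses (AB : A *m B = f%:M) (BA : B *m A = f%:M) (famB : famM B \/ famN B).

(** Exactness of the periodic complex of a matrix factorization: if B u = f
    w then f u = A B u = f A w, and f is a nonzero divisor. The invertible P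
    is the change to arbitrary minimal generators. *)
Lemma rowR4_ker (P : 'M[S]_2) u : P \in unitmx ->
  rowR4 (P *m B *m u) = 0 <-> exists v, u = A *m v.
Proof.
move=> uP; rewrite rowR4_eq0; split=> [[w]|[v ->]]; last first.
  exists (P *m v); rewrite mulmxA -(mulmxA P B A) BA mul_mx_scalar.
  by rewrite -scalemxAl.
rewrite -mulmxA => E; exists (invmx P *m w).
have f0 := f4_neq0 K.
have fI (x y : 'cV[S]_2) : f *: x = f *: y -> x = y.
  by move=> /colP xy; apply/colP => i; have := xy i; rewrite !mxE => /(mulfI f0).
apply: fI; rewrite -mul_scalar_mx -AB -mulmxA; have := congr1 (mulmx (invmx P)) E.
by rewrite mulKmx // => ->; rewrite -!scalemxAr.
Qed.

Lemma min_gens_size (M : lmodType (R4 K)) g n (h : 'I_n -> resS M) :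
    presents (M := M) B g -> (forall x, exists c, x = comb h c) ->
    (forall c, comb h c = 0 -> forall i, (c i 0)@_0%MM = 0) -> n = 2%N.
Proof.
move=> pB gen minh; have [B0 _ _] := fam_factorization famB.
apply/eqP; rewrite eqn_leq (min_gens_le gen minh pB.1).
by rewrite (min_gens_le pB.1 (presents_min pB B0) gen).
Qed.

(** Every choice of minimal homogeneous generators, for whichever grading,
    has the relations of the given presentation up to a change of basis,
    because B is determined by the module. *)
Lemma kernel_of_min_gens (M : lmodType (R4 K)) G g (h : 'I_2 -> resS M) d :
    presents (M := M) B g -> MCM (@R4_irr K) M -> grading (@R4_deg K) G ->
    (forall j, G (d j) (h j)) -> (forall x, exists c, x = comb h c) ->
    (forall c, comb h c = 0 -> forall i, (c i 0)@_0%MM = 0) ->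
  exists2 P, P \in unitmx & forall c, comb h c = 0 <-> exists u, c = P *m B *m u.
Proof.
move=> pB mcm grG Gh gen minh.
have [B' [P [famB' uP ker]]] := two_gens_relations charK grG mcm (fam_not_free famB pB) Gh gen minh.
have [h' pB'] := presents_unit uP gen ker.
have BE := fam_distinct famB' famB pB' pB.
by subst B'; exists P.
Qed.

(** The free module maps onto Coker B by minimal homogeneous generators h,
    with relations the image of P B; modulo f the latter is the cokernel of
    A. *)
Lemma first_syzygy_iso G Z : grading (@R4_deg K) G ->
  first_syzygy (@R4_deg K) (@R4_irr K) (M := Coker B) G Z -> iso Z (Coker A).
Proof.
move=> grG [n [d [p [k [pdeg psurj pmin kinj kex]]]]].
pose h (i : 'I_n) : resS (Coker B) := p (delta_mx 0 i).
have hE c : comb h c = p (rowR4 c).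
  rewrite (row_sum_delta (rowR4 c)) linear_sum; apply: eq_bigr => i _.
  by rewrite linearZ mxE.
have gen x : exists c, x = comb h c.
  by have [v <-] := psurj x; have [c ->] := rowR4_surj v; exists c; rewrite hE.
have minh c : comb h c = 0 -> forall i, (c i 0)@_0%MM = 0.
  by rewrite hE => /pmin c0 i; apply/R4_irrP; have := c0 i; rewrite mxE.
have Gh j : G (d j) (h j).
  apply: pdeg => l; rewrite mxE eqxx /=; have [->|lj] := eqVneq l j.
    by rewrite subrr -[true%:R](rmorph1 (@toR4 K)); apply: toR4_deg; exact: (@homogC _ _ 1).
  by rewrite -[false%:R](rmorph0 (@toR4 K)); apply: toR4_deg; exact: homog0.
have pB := Coker_presents BA; have [_ mcm] := fam_graded_MCM charK famB.
have n2 := min_gens_size pB gen minh; subst n.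
have [P uP ker] := kernel_of_min_gens pB mcm grG Gh gen minh.
have /ex_choice[g gE] u : exists z, rowR4 (P *m B *m u) = k z.
  by apply/kex; rewrite -hE; apply/ker; exists u.
apply: (presents_iso AB (h := fun i => g (delta_mx i 0))).
apply: presents_linear.
- by move=> a u v; apply: kinj; rewrite linearP -!gE -rowR4_linear linearP.
- move=> z; have [c cE] := rowR4_surj (k z).
  have /kex : exists z', rowR4 c = k z' by exists z.
  rewrite -hE => /ker[u cu].
  by exists u; apply: kinj; rewrite -gE -cu.
- move=> u; rewrite -(rowR4_ker u uP) gE; split=> [->|]; first by rewrite linear0.
  by rewrite -[RHS](linear0 k) => /kinj.
Qed.

Lemma iso_first_syzygy G Z : grading (@R4_deg K) G ->
  iso Z (Coker A) -> first_syzygy (@R4_deg K) (@R4_irr K) (M := Coker B) G Z.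
Proof.
move=> grG isoZ; have pB := Coker_presents BA; have [_ mcm] := fam_graded_MCM charK famB.
have [n [h [d [Gh gen minh]]]] := graded_min_gens grG mcm.1.
have n2 := min_gens_size pB gen minh; subst n.
have [P uP ker] := kernel_of_min_gens pB mcm grG Gh gen minh.
have [z pz] := presents_iso_img (iso_sym isoZ) (Coker_presents AB).
have [||k kE] := presents_lift (g := fun u => rowR4 (P *m B *m u)) pz.
- by move=> a u v; rewrite linearP rowR4_linear.
- by move=> u; apply/(rowR4_ker _ uP); exists u.
have lp : linear (fun r : 'rV[R4 K]_2 => (\sum_i r 0 i *: (h i : Coker B) : Coker B)).
  move=> a x y; rewrite scaler_sumr -big_split; apply: eq_bigr => i _.
  by rewrite !mxE scalerDl scalerA.
have pE c : linear_of lp (rowR4 c) = comb h c.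
  by apply: eq_bigr => i _; rewrite mxE.
exists 2%N, d, (linear_of lp), k; split.
- move=> e v vdeg; have [_ GB GZ _ _] := grG; have [G0 _ _ _ _] := grG.
  have GD x y : G e x -> G e y -> G e (x + y).
    by move=> Gx Gy; rewrite -[y]opprK -[- y]sub0r; do !apply: (GB e).
  apply: (big_ind (G e)) => // i _.
  by rewrite -[e](subrK (d i)); apply: GZ.
- by move=> x; have [c ->] := gen x; exists (rowR4 c).
- move=> v; have [c ->] := rowR4_surj v; rewrite pE => /minh c0 j.
  by rewrite mxE; apply/R4_irrP.
- move=> x y; have [c ->] := pz.1 x; have [c' ->] := pz.1 y; rewrite !kE => E.
  have Ecc : comb z (c - c') = 0.
    apply/pz.2/(rowR4_ker _ uP); rewrite -kE linearB /=.
    by rewrite (linearB k) !kE E subrr.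
  have -> : comb z c = comb z (c - c') + comb z c' by rewrite linearB subrK.
  by rewrite Ecc add0r.
- move=> v; have [c ->] := rowR4_surj v; rewrite pE ker; split.
    by move=> [u ->]; exists (comb z u); rewrite kE.
  move=> [x]; have [u ->] := pz.1 x; rewrite kE => E.
  have /rowR4_eq0[w cE] : rowR4 (c - P *m B *m u) = 0.
    by rewrite -scaleN1r addrC rowR4_linear E rmorphN rmorph1 scaleN1r addNr.
  exists (u + A *m (invmx P *m w)); rewrite mulmxDr -[LHS](subrK (P *m B *m u)) addrC.
  rewrite cE; congr (_ + _); rewrite mulmxA -(mulmxA P B A) BA mul_mx_scalar.
  by rewrite -scalemxAl mulKVmx.
Qed.

Lemma first_syzygy_fam : is_the_first_syzygy (Coker B) (Coker A).
Proof. by move=> G grG Z; split; [exact: first_syzygy_iso | exact: iso_first_syzygy]. Qed.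

End Syzygy.

(** * Duals *)

Section Dual.
Variable K : closedFieldType.
Notation S := {mpoly K[4]}.
Notation f := (f4 K).

Lemma dual_ext (R : comNzRingType) (M : lmodType R) (D D' : dual M) :
  (forall x, dual_val D x = dual_val D' x) -> D = D'.
Proof. by move=> E; apply/val_inj/funext. Qed.

Lemma dual_valP (R : comNzRingType) (M : lmodType R) (a : R) (D D' : dual M) x :
  dual_val (a *: D + D') x = a * dual_val D x + dual_val D' x.
Proof. by []. Qed.

Lemma dual_val_linear (R : comNzRingType) (M : lmodType R) (D : dual M) :
  linear (dual_val D).
Proof. by apply/asboolP; exact: (valP D). Qed.

Lemma dual_of_linear (R : comNzRingType) (M : lmodType R) (F : {linear M -> R^o}) :
  exists D : dual M, forall x, dual_val D x = F x.
Proof.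
have FP : (F : M -> R^o) \in @is_linear_form R M.
  by rewrite inE; apply/asboolP => a x y; rewrite linearP.
by exists (Dual FP).
Qed.

(** The transposed complex is exact as well: if p^T A = f y^T then f p^T = f
    y^T B. *)
Lemma toR4_row_ker n (A B : 'M[S]_n) (p : 'cV[S]_n) : A *m B = f%:M -> B *m A = f%:M ->
  (forall w : 'cV[S]_n, toR4 ((p^T *m A *m w) 0 0) = 0) <-> exists y, p = B^T *m y.
Proof.
move=> AB BA; split=> [p0|[y ->] w]; last first.
  rewrite trmx_mul trmxK -(mulmxA y^T) BA mul_mx_scalar -scalemxAl.
  by move: (_ *m w) => z; rewrite mxE rmorphM /= toR4_f mul0r.
have /ex_choice[y yE] j : exists y, (p^T *m A) 0 j = y * f.
  apply/toR4_eq0; have := p0 (delta_mx j 0); rewrite -colE mxE; exact.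
exists (\col_j y j).
have E : p^T *m A = f *: (\col_j y j)^T.
  by apply/rowP => j; rewrite yE !mxE mulrC.
apply/trmx_inj; rewrite trmx_mul trmxK.
have := congr1 (mulmx^~ B) E; rewrite /= -mulmxA AB -scalemxAl mul_mx_scalar.
move: (_ *m B) => z /rowP Ez; apply/rowP => i; apply: (mulfI (f4_neq0 K)).
by have := Ez i; rewrite !mxE.
Qed.

(** A functional on Coker B is a row of R4^n killed by B. By the exactness
    of the transposed complex these are the rows y^T A, and y^T A vanishes
    exactly when y is in the image of B^T. *)
Lemma dual_presents n (A B : 'M[S]_n) (M : lmodType (R4 K)) h :
    A *m B = f%:M -> B *m A = f%:M -> presents (M := M) B h ->
  exists h', presents (M := dual M) B^T h'.
Proof.
move=> AB BA pB; have [gen ker] := pB.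
have /ex_choice[g gE] (v : 'cV[S]_n) : exists D : dual M,
    forall w, dual_val D (comb h w) = toR4 ((v^T *m A *m w) 0 0).
  have [||F FE] := presents_lift (N := (R4 K)^o) (g := fun w => toR4 ((v^T *m A *m w) 0 0)) pB.
  - by move=> a u w; rewrite linearP !mxE rmorphD rmorphM.
  - move=> u; rewrite -mulmxA (mulmxA A) AB mul_scalar_mx -scalemxAr mxE rmorphM /=.
    by rewrite toR4_f mul0r.
  by have [D DE] := dual_of_linear F; exists D => w; rewrite DE FE.
exists (fun i => g (delta_mx i 0)); apply: presents_linear.
- move=> a u v; apply: dual_ext => x; have [w ->] := gen x.
  rewrite dual_valP !gE linearP /= !mulmxDl -!scalemxAl.
  move: (u^T *m A *m w) (v^T *m A *m w) => y z.
  by rewrite !mxE rmorphD rmorphM.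
- move=> D; have /ex_choice[p pE] i : exists p, dual_val D (h i) = toR4 p by exact: toR4_surj.
  have DE w : dual_val D (comb h w) = toR4 (((\col_i p i)^T *m w) 0 0).
    rewrite -[dual_val D _]/(linear_of (dual_val_linear D) _) linear_sum mxE rmorph_sum.
    apply: eq_bigr => i _; rewrite resS_scaleE linearZ /= pE !mxE rmorphM mulrC //.
  have [] := @toR4_row_ker n B A (\col_i p i) BA AB.
  case=> [w|y yE _].
    have Bw : comb h (B *m w) = 0 by apply/ker; exists w.
    rewrite -mulmxA -DE Bw; exact: (linear0 (linear_of (dual_val_linear D))).
  exists y; apply: dual_ext => x; have [w ->] := gen x.
  by rewrite gE DE yE trmx_mul trmxK.
- move=> v; rewrite -(toR4_row_ker v AB BA); split=> [g0 w|E].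
    by rewrite -gE g0.
  by apply: dual_ext => x; have [w ->] := gen x; rewrite gE E.
Qed.

(** The adjugate of a 2 x 2 matrix is its transpose conjugated by the
    rotation J; so the transpose of psi is phi up to a change of bases. *)
Lemma dual_fam i j s (a b : K) : admissible i j s a b ->
  iso (Coker (phi i j s a b)) (dual (Coker (psi i j s a b))).
Proof.
move=> adm; have [AB BA _] := phi_psi adm.
have [h [gen ker]] := dual_presents AB BA (Coker_presents BA).
pose J : 'M[S]_2 := mat2 0 1 (-1) 0.
have JJ : J *m J^T = 1%:M.
  by rewrite /J tr_mat2 mul_mat2 scalar_mat2; congr mat2; ring.
have JJ' : J^T *m J = 1%:M by exact: mulmx1C.
have E : (psi i j s a b)^T = J^T *m phi i j s a b *m J.
  by rewrite /J /psi /phi !tr_mat2 !mul_mat2; congr mat2; ring.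
have [uJ _] := mulmx1_unit JJ'.
have [|h' pA] := @presents_unit K 2 (phi i j s a b) J^T _ h uJ gen.
  move=> c; rewrite ker E; split=> -[u ->].
    by exists (J *m u); rewrite !mulmxA.
  by exists (J^T *m u); rewrite -(mulmxA (J^T *m _) J) (mulmxA J) JJ mul1mx.
exact: iso_sym (presents_iso AB pA).
Qed.
End Dual.

(** * Rank *)

Section ClassicalDomain.
Variable R : comNzRingType.
Hypothesis domR : forall x y : R, x * y = 0 -> x = 0 \/ y = 0.

(** A domain in which inverses of units are chosen classically, so that its
    field of fractions can be formed. *)
Definition as_domain of (forall x y : R, x * y = 0 -> x = 0 \/ y = 0) : Type := R.
Notation D := (as_domain domR).
HB.instance Definition _ := GRing.ComNzRing.on D.

Definition is_unit : {pred D} := [pred x | `[< exists y : D, y * x = 1 >]].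
Fact inverse_exists (x : D) : exists y : D, if x \in is_unit then y * x = 1 else y = x.
Proof.
by have [/asboolP[y yx]|_] := boolP (x \in is_unit); [exists y | exists x].
Qed.
Definition inverse (x : D) : D := projT1 (cid (inverse_exists x)).
Fact mul_inverse : {in is_unit, left_inverse 1 inverse *%R}.
Proof. by move=> x xu; rewrite /inverse; case: cid => y /=; rewrite xu. Qed.
Fact is_unitP x y : y * x = 1 -> x \in is_unit.
Proof. by move=> yx; apply/asboolP; exists y. Qed.
Fact inverse_out : {in [predC is_unit], inverse =1 id}.
Proof. by move=> x /negbTE xu; rewrite /inverse; case: cid => y /=; rewrite xu. Qed.
HB.instance Definition _ := GRing.ComNzRing_hasMulInverse.Build D
  mul_inverse is_unitP inverse_out.
Fact as_domain_integral (x y : D) : x * y = 0 -> (x == 0) || (y == 0).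
Proof. by case/domR => ->; rewrite eqxx ?orbT. Qed.
HB.instance Definition _ := GRing.ComUnitRing_isIntegral.Build D as_domain_integral.

Lemma lregP (x : R) : GRing.lreg x <-> x <> 0.
Proof.
split=> [xl x0|x0 y z /eqP].
  suff /eqP : 1 = 0 :> R by rewrite oner_eq0.
  by apply: xl; rewrite x0 !mul0r.
by rewrite -subr_eq0 -mulrBr => /eqP/domR[]// /eqP; rewrite subr_eq0 => /eqP.
Qed.

Lemma total_quotient_domain : exists (Q : fieldType) (h : {rmorphism R -> Q}),
  total_quotient h.
Proof.
pose h : {rmorphism R -> {fraction D}} := (@FracField.tofrac D : {rmorphism D -> {fraction D}}).
exists {fraction D}, h; split.
- by move=> x y /eqP; rewrite tofrac_eq => /eqP.
- by move=> s /lregP s0; rewrite unitfE; rewrite tofrac_eq0; apply/eqP.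
- move=> q; have [a [s [s0 ->]]] : exists a s : D, s != 0 /\ q = FracField.tofrac a / FracField.tofrac s.
    have [a [s [s0 E]]] := fraction_numden q; exists a, s; split=> //.
    by rewrite -E mulfK // tofrac_eq0.
  by exists a, s; split=> //; apply/lregP/eqP.
Qed.
End ClassicalDomain.

Section RankOne.
(** A nonzero functional whose kernel is torsion becomes an isomorphism onto
    the field of fractions after localization. *)
Lemma rank_one (R : comNzRingType) (M : lmodType R) (L : {linear M -> R^o}) (x0 : M) (s0 : R) :
    (forall x y : R, x * y = 0 -> x = 0 \/ y = 0) ->
    L x0 <> 0 -> s0 <> 0 -> (forall x, L x = 0 -> s0 *: x = 0) ->
  has_rank M 1.
Proof.
move=> domR Lx0 s00 kerL; have [Q [h tq]] := total_quotient_domain domR.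
have [hinj hunit hfrac] := tq.
pose j0 (x : M) : 'rV[Q]_1 := const_mx (h (L x)).
have lj : linear_for (h \; *:%R) j0.
  by move=> a x y; apply/rowP => i; rewrite !mxE linearP rmorphD rmorphM.
pose j : {linear M -> 'rV[Q]_1 | h \; *:%R} :=
  HB.pack j0 (GRing.isLinear.Build R M _ _ j0 lj).
exists Q, h; split=> //; exists j; split=> [v|x] /=.
  have [r [t [tl vE]]] := hfrac (v 0 0).
  have t0 : h t != 0 by have := hunit _ tl; rewrite unitfE.
  exists (t * (L x0 : R)), (r *: x0); split.
    by apply/(lregP domR) => /domR[]; [exact/(lregP domR) | exact: Lx0].
  apply/rowP => i; rewrite ord1 !mxE vE linearZ /= !rmorphM /=.
  by field.
split=> [/rowP/(_ 0)|[s [sl sx]]].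
  rewrite !mxE -(rmorph0 h) => /hinj Lx; exists s0; split; first exact/(lregP domR).
  exact: kerL.
have s'0 : h s != 0 by have := hunit _ sl; rewrite unitfE.
apply/rowP => i; rewrite !mxE; apply: (mulfI s'0); rewrite mulr0 -rmorphM.
rewrite -[s * _]/(s *: (L x : R^o)) -linearZ sx /=.
by rewrite linear0 rmorph0.
Qed.

Variable K : closedFieldType.
Hypothesis charK : [pchar K] =i pred0.
Notation S := {mpoly K[4]}.
Notation f := (f4 K).

(** The row (-c, a) is orthogonal to the first column of the matrix, and its
    product with the second is the determinant f. If it is also orthogonal
    to v modulo f, then a v is in the image of the matrix, so a kills the
    kernel of the functional. *)
Lemma rank_mat2 (a b c d : S) (M : lmodType (R4 K)) h : a * d - b * c = f ->
  ~ (exists q, a = q * f) -> presents (M := M) (mat2 a b c d) h -> has_rank M 1.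
Proof.
move=> detf nfa pA; have [gen ker] := pA.
have [||L LE] := presents_lift (N := (R4 K)^o)
    (g := fun v : 'cV[S]_2 => toR4 (a * v 1 0 - c * v 0 0)) pA.
- move=> e u v; rewrite !mxE -[RHS]/(toR4 e * toR4 _ + toR4 _) -rmorphM -rmorphD; congr toR4; ring.
- move=> u; apply/toR4_eq0; exists (u 1 0); rewrite !mxE !big_ord_recl !big_ord0 !mxE /=.
  have -> : lift 0 0 = 1 :> 'I_2 by apply/val_inj.
  rewrite -detf; ring.
have a0 : toR4 a <> 0 by move=> /toR4_eq0.
apply: (@rank_one _ _ L (comb h (delta_mx 1 0)) (toR4 a)) => //.
- exact: R4_domain.
- rewrite LE !mxE /= mulr0 subr0 mulr1; exact: a0.
move=> x; have [v ->] := gen x; rewrite LE => /toR4_eq0[y E].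
rewrite -resS_scaleE -linearZ; apply/ker.
exists (\col_i (if i == 0 then v 0 0 - b * y else a * y)).
apply/colP => i; have [->|->] := ord2P i; rewrite !mxE !big_ord_recl !big_ord0 !mxE /=.
  ring.
transitivity (c * v 0 0 + (a * d - b * c) * y); last by ring.
rewrite detf [f * y]mulrC -E; ring.
Qed.
End RankOne.

(** * The classification *)

Section Final.
Variable K : closedFieldType.
Hypothesis charK : [pchar K] =i pred0.
Notation S := {mpoly K[4]}.
Notation f := (f4 K).

Lemma low_degree_not_dvd (z : int) (p : S) (x : 'I_4 -> K) :
  z < 3 -> homdeg z p -> p.@[x] <> 0 -> ~ exists q, p = q * f.
Proof.
move=> z3 hp px [q pE]; apply: px.
have f3 : homdeg 3 f by move=> m; exact: f4_homog.
have E : p = hcomp (z - 3) q * f by rewrite mulrC -(hcompM z q f3) mulrC -pE hcomp_id.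
have -> : p = 0; last by rewrite meval0.
have q0 : hcomp (z - 3) q = 0.
  by apply: (@homog_neg _ _ (z - 3)); [exact: homog_hcomp | rewrite subr_lt0].
by rewrite E q0 mul0r.
Qed.

Lemma rank_fam (A : 'M[S]_2) : famM A \/ famN A -> has_rank (Coker A) 1.
Proof.
pose e (i : 'I_4) : K := (i == 0)%:R.
case=> -[i [j [s [a [b [adm ->]]]]]]; have [AB BA [dphi dpsi]] := phi_psi adm.
- have [ij ijs _ _] := adm; have := set3_uniq ijs ij.
  rewrite /= inE => /andP[/norP[s0 _] _].
  apply: (rank_mat2 charK _ _ (Coker_presents AB)); first by rewrite -det_mat2.
  apply: (low_degree_not_dvd (z := 1) (x := e)) => //; first exact: homog_binomial.
  rewrite mevalB mevalZ !mevalXU /e eqxx [s == 0]eq_sym (negbTE s0) mulr0 subr0.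
  by apply/eqP; rewrite oner_eq0.
have [ij ijs _ _] := adm; have := set3_uniq ijs ij.
rewrite /= inE => /andP[/norP[s0 _] _].
apply: (rank_mat2 charK _ _ (Coker_presents BA)); first by rewrite -det_mat2.
apply: (low_degree_not_dvd (z := 2) (x := e)) => //; first exact: homog_quadric.
rewrite !mevalD !mevalZ (mevalM _ 'X_0 'X_s) !rmorphXn /= !mevalXU /e eqxx.
rewrite [s == 0]eq_sym (negbTE s0) expr0n !mulr0 !addr0 expr1n.
by apply/eqP; rewrite oner_eq0.
Qed.

End Final.

Theorem theorem2p1 (K : closedFieldType) (charK : [pchar K] =i pred0) :
  [/\
    (forall (i j s : 'I_4) (a b : K), admissible i j s a b ->
       matrix_factorization (f4 K) (phi i j s a b) (psi i j s a b)),
    (forall A : 'M[{mpoly K[4]}]_2, famM A \/ famN A -> graded_MCM (Coker A))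
  & [/\
    (* (i) *)
    (forall M : lmodType (R4 K),
       graded_MCM M -> min_gens M 2 -> ~ fin_free M ->
       exists A : 'M[{mpoly K[4]}]_2,
         (famM A \/ famN A) /\ iso M (Coker A)),
    (* (ii) *)
    (forall A B : 'M[{mpoly K[4]}]_2,
       famM A \/ famN A -> famM B \/ famN B -> A <> B ->
       ~ iso (Coker A) (Coker B)),
    (* (iii), first syzygies *)
    (forall A : 'M[{mpoly K[4]}]_2, famM A ->
       exists2 B : 'M[{mpoly K[4]}]_2, famN B & is_the_first_syzygy (Coker B) (Coker A)) /\
    (forall B : 'M[{mpoly K[4]}]_2, famN B ->
       exists2 A : 'M[{mpoly K[4]}]_2, famM A & is_the_first_syzygy (Coker B) (Coker A)),
    (* (iii), duals *)
    (forall A : 'M[{mpoly K[4]}]_2, famM A ->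
       exists2 B : 'M[{mpoly K[4]}]_2, famN B & iso (Coker A) (dual (Coker B))) /\
    (forall B : 'M[{mpoly K[4]}]_2, famN B ->
       exists2 A : 'M[{mpoly K[4]}]_2, famM A & iso (Coker A) (dual (Coker B)))
    (* (iv) *)
  & (forall A : 'M[{mpoly K[4]}]_2, famM A \/ famN A ->
       has_rank (Coker A) 1)]].
Proof.
have syz i j s (a b : K) : admissible i j s a b ->
    is_the_first_syzygy (Coker (psi i j s a b)) (Coker (phi i j s a b)).
  move=> adm; have [AB BA _] := phi_psi adm.
  by apply: (first_syzygy_fam charK AB BA); right; exists i, j, s, a, b.
have inM i j s (a b : K) : admissible i j s a b -> famM (phi i j s a b).
  by move=> adm; exists i, j, s, a, b.
have inN i j s (a b : K) : admissible i j s a b -> famN (psi i j s a b).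
  by move=> adm; exists i, j, s, a, b.
split; last split.
- by move=> i j s a b /phi_psi[AB BA _]; split.
- exact: fam_graded_MCM.
- exact: two_generated.
- exact: not_iso.
- split=> _ [i [j [s [a [b [adm ->]]]]]].
    by exists (psi i j s a b); [exact: inN | exact: syz].
  by exists (phi i j s a b); [exact: inM | exact: syz].
- split=> _ [i [j [s [a [b [adm ->]]]]]].
    by exists (psi i j s a b); [exact: inN | exact: dual_fam].
  by exists (phi i j s a b); [exact: inM | exact: dual_fam].
- exact: rank_fam.
Qed.
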